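(* $\mathcal{A}_c(\mathbb{T})=L^1(\mathbb{T})\ast\mathcal{A}_c(\mathbb{T})$; that is, $g\ast h\in\mathcal{A}_c(\mathbb{T})$ for all $g\in L^1(\mathbb{T})$, $h\in\mathcal{A}_c(\mathbb{T})$, and for each $f\in\mathcal{A}_c(\mathbb{T})$ there exist $g\in L^1(\mathbb{T})$ and $h\in\mathcal{A}_c(\mathbb{T})$ such that $f=g\ast h$.
   Context: ''Periodic'' means $2\pi$-periodic, and $\mathbb{T}$ is modelled by $[-\pi,\pi)$. $L^1(\mathbb{T})$ is the space of periodic locally Lebesgue integrable functions on $\mathbb{R}$, $\|g\|_1=\int_{-\pi}^{\pi}|g|$. $\mathcal{B}_c(\mathbb{T})$ is the set of continuous $F:\mathbb{R}\to\mathbb{R}$ with $F(-\pi)=0$ and $F(y+2n\pi)=F(y)+nF(\pi)$ for all $y\in[-\pi,\pi)$, $n\in\mathbb{Z}$. $\mathcal{A}_c(\mathbb{T})$ is the set of Schwartz distributions $f$ on $\mathbb{R}$ such that $f=F'$ (distributional derivative) for some $F\in\mathcal{B}_c(\mathbb{T})$; this $F$ is unique and is called the primitive of $f$. The continuous primitive integral is $\int_a^bf=F(b)-F(a)$. The Alexiewicz norm is $\|f\|_{\mathbb{T}}=\sup_{|I|\le2\pi}\left|\int_If\right|$, supremum over intervals $I\subset\mathbb{R}$ of length at most $2\pi$; $\mathcal{A}_c(\mathbb{T})$ is a Banach space with this norm. $\mathcal{BV}(\mathbb{T})$ is the set of periodic functions $g:\mathbb{R}\to\mathbb{R}$ of finite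 variation over $[-\pi,\pi]$. For $f\in\mathcal{A}_c(\mathbb{T})$ with primitive $F$ and $g\in\mathcal{BV}(\mathbb{T})$, $\int_{-\pi}^{\pi}fg=F(\pi)g(\pi)-\int_{-\pi}^{\pi}F\,dg$ (Riemann--Stieltjes integral), and $f\ast g(x)=\int_{-\pi}^{\pi}f(x-t)g(t)\,dt$, where $t\mapsto f(x-t)$ is the distribution $f\circ r_x$, $r_x(t)=x-t$; one has $\|f\ast g\|_{\mathbb{T}}\le\|f\|_{\mathbb{T}}\|g\|_1$. For $h\in\mathcal{A}_c(\mathbb{T})$ and $g\in L^1(\mathbb{T})$, $g\ast h=h\ast g$ is defined as the unique element of $\mathcal{A}_c(\mathbb{T})$ such that $\|h\ast g_k-h\ast g\|_{\mathbb{T}}\to0$ for any sequence $\{g_k\}\subset\mathcal{BV}(\mathbb{T})$ with $\|g_k-g\|_1\to0$. *)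

(* Defs.v *)
From HB Require Import structures.
From mathcomp Require Import all_boot all_order all_algebra.
From mathcomp Require Import all_classical all_reals all_analysis.

Set Implicit Arguments.
Unset Strict Implicit.
Unset Printing Implicit Defensive.

Import Order.TTheory GRing.Theory Num.Theory.
Import numFieldNormedType.Exports.

Local Open Scope classical_set_scope.
Local Open Scope ring_scope.

Section test_functions.
Context {R : realType}.
Implicit Types phi psi : R -> R.

Definition smooth phi := forall n x, derivable (derive1n n phi) x 1.

Definition supp phi : set R := closure [set x | phi x != 0].

Definition test_function : {pred R -> R} :=
  mem [set phi | smooth phi /\ compact (supp phi)].

Lemma smooth_lin (a : R) phi psi : smooth phi -> smooth psi ->
  forall n, derive1n n (a *: phi + psi) = a *: derive1n n phi + derive1n n psi.
Proof.
move=> sphi spsi; elim=> [//|n ih].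
rewrite !derive1nS ih; apply/funext => x.
rewrite !fctE !derive1E deriveD//; last exact: derivableZ.
by rewrite deriveZ.
Qed.

Lemma smoothL (a : R) phi psi :
  smooth phi -> smooth psi -> smooth (a *: phi + psi).
Proof.
move=> sphi spsi n x; rewrite smooth_lin//.
by apply: derivableD => //; exact: derivableZ.
Qed.

Lemma test_function_submod : submod_closed test_function.
Proof.
split.
  rewrite inE; split.
    suff E n : derive1n n (0 : R -> R) = 0 by move=> n x; rewrite E.
    elim: n => // n ih; rewrite derive1nS ih; apply/funext => x.
    by rewrite derive1E derive_cst.
  rewrite /supp (_ : [set _ | _] = set0) ?closure0; first exact: compact0.
  by apply/seteqP; split => // x /=; rewrite eqxx.
move=> a phi psi; rewrite !inE => -[sphi cphi] [spsi cpsi]; split.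
  exact: smoothL.
apply: (@subclosed_compact _ _ (supp phi `|` supp psi)).
- exact: closed_closure.
- exact: compactU.
- rewrite /supp -closureU; apply: closure_subset => x /=.
  apply: contra_neqP => /not_orP[].
  move=> /negP/negPn/eqP phi0 /negP/negPn/eqP psi0.
  by rewrite !fctE phi0 psi0 scaler0 addr0.
Qed.

HB.instance Definition _ :=
  GRing.isSubmodClosed.Build R (R -> R) test_function test_function_submod.

Record testfun := TestFun {
  test_val :> R -> R ;
  testfunP : test_val \in test_function }.

HB.instance Definition _ := [isSub for test_val].
HB.instance Definition _ := [Choice of testfun by <:].
HB.instance Definition _ := [SubChoice_isSubLmodule of testfun by <:].

Lemma testfun_smooth (phi : testfun) : smooth phi.
Proof. by have := testfunP phi; rewrite inE => -[]. Qed.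

Lemma testfun_compact (phi : testfun) : compact (supp phi).
Proof. by have := testfunP phi; rewrite inE => -[]. Qed.

Lemma test_derive_subproof (phi : testfun) : derive1 phi \in test_function.
Proof.
rewrite inE; split.
  by move=> n x; have := @testfun_smooth phi n.+1 x; rewrite derive1Sn.
apply: (@subclosed_compact _ _ (supp phi)).
- exact: closed_closure.
- exact: testfun_compact.
rewrite [X in _ `<=` X](closure_id _).1; last exact: closed_closure.
apply: closure_subset => x /=; apply: contra_neqP => xphi.
have : nbhs x (~` supp phi).
  by apply: open_nbhs_nbhs; split=> //; exact/closed_openC/closed_closure.
move=> nx; rewrite derive1E (@near_eq_derive _ _ _ _ (cst 0)) ?derive_cst//.
near=> y; apply/eqP/negPn/negP => phiy.
have : (~` supp phi) y by near: y.
by apply; exact: subset_closure.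
Unshelve. all: by end_near. Qed.

Definition test_derive (phi : testfun) : testfun :=
  TestFun (test_derive_subproof phi).

Lemma is_derive_reflect phi (x t : R) : derivable phi (x - t) 1 ->
  is_derive t (1 : R) (fun t => phi (x - t)) (- derive1 phi (x - t)).
Proof.
move=> dphi; rewrite -mulrN1.
have D : is_derive t (1 : R) (fun t => x - t) (-1).
  by rewrite -[X in is_derive _ _ _ X]add0r; apply: is_deriveB.
apply: (@is_derive1_comp _ phi (fun t => x - t)).
by rewrite derive1E; exact: DeriveDef.
Qed.

Lemma derive1n_reflect phi (x : R) : smooth phi -> forall n,
  derive1n n (fun t => phi (x - t)) =
  (-1) ^+ n \*: (fun t => derive1n n phi (x - t)).
Proof.
move=> sphi; elim=> [|n ih].
  by apply/funext => t /=; rewrite expr0 scale1r.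
rewrite derive1nS ih; apply/funext => t /=.
have h := is_derive_reflect (sphi n (x - t)).
rewrite derive1E deriveZ; last exact: ex_derive.
by rewrite derive_val exprS /GRing.scale/= mulN1r mulNr mulrN.
Qed.

Lemma test_reflect_subproof (x : R) (phi : testfun) :
  (fun t => phi (x - t)) \in test_function.
Proof.
rewrite inE; split.
  move=> n y; rewrite derive1n_reflect; last exact: testfun_smooth.
  apply: derivableZ; have h := is_derive_reflect (@testfun_smooth phi n (x - y)).
  exact: ex_derive.
have cr : compact ((fun t => x - t) @` supp phi).
  apply: continuous_compact; last exact: testfun_compact.
  by apply: continuous_subspaceT => t; apply: cvgB; [exact: cvg_cst|exact: cvg_id].
apply: (subclosed_compact _ cr); first exact: closed_closure.
rewrite [X in _ `<=` X](closure_id _).1; last first.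
  by apply: compact_closed cr; exact: Rhausdorff.
apply: closure_subset => t /= phit; exists (x - t); last by rewrite subKr.
exact: subset_closure.
Qed.

Definition test_reflect (x : R) (phi : testfun) : testfun :=
  TestFun (test_reflect_subproof x phi).

End test_functions.
Arguments testfun : clear implicits.

Section distributions.
Context {R : realType}.
Implicit Types (T : testfun R -> R) (F u : R -> R) (phi : testfun R).

(* Continuity is given by the seminorm estimates on compact sets that
   characterise the dual of the usual LF topology on test functions. *)
Definition schwartz_distribution : set (testfun R -> R) :=
  [set T | scalar T /\
    forall K : set R, compact K -> exists (N : nat) (C : R),
      forall phi, supp phi `<=` K ->
        `|T phi| <= C * \sum_(i < N.+1)
                          sup (range (fun x => `|derive1n i phi x|))].

(* Only used for continuous u, so that the integrand is continuous with compact
   support. *)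
Definition dfun u : testfun R -> R :=
  fun phi => \int[lebesgue_measure]_x (u x * phi x).

Definition dderive T : testfun R -> R := fun phi => - T (test_derive phi).

(* T \o r_x with r_x t = x - t; the change of variables has Jacobian 1 in
   absolute value and r_x is its own inverse. *)
Definition dreflect (x : R) T : testfun R -> R :=
  fun phi => T (test_reflect x phi).

End distributions.

Section stieltjes.
Context {R : realType}.
Implicit Types (F g : R -> R) (a b : R).

(* x_0 = a < x_1 < ... < x_n = b, tagged by t_i in [x_i, x_(i+1)] *)
Definition tagged_partition a b (s : seq R) (t : nat -> R) :=
  itv_partition a b s /\
  forall i, (i < size s)%N -> nth b (a :: s) i <= t i <= nth b (a :: s) i.+1.

Definition mesh_lt a b (s : seq R) (d : R) :=
  forall i, (i < size s)%N -> nth b (a :: s) i.+1 - nth b (a :: s) i < d.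

Definition RS_sum F g a b (s : seq R) (t : nat -> R) : R :=
  \sum_(0 <= i < size s)
    F (t i) * (g (nth b (a :: s) i.+1) - g (nth b (a :: s) i)).

Definition is_RS_integral F g a b (I : R) :=
  forall e, 0 < e -> exists2 d, 0 < d &
    forall s t, tagged_partition a b s t -> mesh_lt a b s d ->
      `|RS_sum F g a b s t - I| < e.

Definition RS_integral F g a b : R := xget 0 [set I | is_RS_integral F g a b I].

End stieltjes.

Section torus.
Context {R : realType}.
Implicit Types (f h : testfun R -> R) (F g : R -> R).

Definition Bc : set (R -> R) :=
  [set F : R -> R | [/\ continuous F, F (- pi) = 0 &
    forall (n : int) y, - pi <= y < pi ->
      F (y + 2 * n%:~R * pi) = F y + n%:~R * F pi]].

Definition is_primitive f F := Bc F /\ f = dderive (dfun F).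

Definition Ac : set (testfun R -> R) :=
  [set f | schwartz_distribution f /\ exists F, is_primitive f F].

Definition primitive f : R -> R := xget (cst 0) [set F | is_primitive f F].

Definition cp_integral f (a b : R) : R := primitive f b - primitive f a.

Definition Alexiewicz f : R :=
  sup [set r | exists a b, a <= b <= a + 2 * pi /\ r = `|cp_integral f a b|].

Definition BVT : set (R -> R) :=
  [set g | periodic g (2 * pi) /\ bounded_variation (- pi) pi g].

Definition cp_integral_mul f g : R :=
  primitive f pi * g pi - RS_integral (primitive f) g (- pi) pi.

Definition convBV f g : R -> R := fun x => cp_integral_mul (dreflect x f) g.

(* The completed measure is used because lebesgue_measure is only defined on
   Borel sets. *)
Definition L1T : set (R -> R) :=
  [set g | periodic g (2 * pi) /\
    forall K : set R, compact K ->
      completed_lebesgue_measure.-integrable K (EFin \o g)].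

Definition L1norm g : \bar R :=
  (\int[completed_lebesgue_measure]_(x in `[(- pi)%R, pi]) `|g x|%:E)%E.

Definition is_convL1 h g f :=
  Ac f /\
  forall gk : nat -> R -> R, (forall k, BVT (gk k)) ->
    L1norm (gk k - g) @[k --> \oo] --> (0 : \bar R)%E ->
    Alexiewicz (dfun (convBV h (gk k)) - f) @[k --> \oo] --> (0 : R).

(* The default value is not linear, hence not in Ac: convL1 h g belongs to Ac
   exactly when the defining property of h * g has a unique solution. *)
Definition convL1 h g : testfun R -> R :=
  xget (cst 1) [set f | unique (is_convL1 h g) f].

End torus.

(* Main.v *)
Require Import Defs.
From mathcomp Require Import all_boot all_order all_algebra.
From mathcomp Require Import all_classical all_reals all_analysis.
From mathcomp Require Import measurable_realfun.
From mathcomp Require Import ring lra.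

Set Implicit Arguments.
Unset Strict Implicit.
Unset Printing Implicit Defensive.

Import Order.TTheory GRing.Theory Num.Theory.
Import numFieldNormedType.Exports.

Local Open Scope classical_set_scope.
Local Open Scope ring_scope.

(** Let h be an integrable distribution on the torus with primitive H and let
    g be in L1. Everything is read on primitives: h * g must be the derivative
    of the continuous function

      P(x) = int_{-pi}^{pi} (H(x - t) - H(-pi - t)) g(t) dt   (conv_primitive).

    When g has bounded variation, difference quotients of P are, by integration
    by parts, Riemann-Stieltjes integrals against g of difference quotients of
    a primitive of H; these converge uniformly to H, so P is differentiable and
    its derivative is the function h * g of the definition (dfun_convBV). The
    increments of P are at most the increments of H times the L1 norm of g
    (Alexiewicz_convBV), so the derivative of P has the property that defines
    h * g for all g in L1. It is the only one, because functions of bounded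
    variation are dense in L1 (integrable_BV_approximable) and the Alexiewicz
    norm separates distributions, which rests on the du Bois-Reymond lemma
    (du_Bois_Reymond). Hence h * g exists and has primitive P (convL1E), which
    is the first half of the theorem.

    For the second half, subtracting a linear function from the primitive of f,
    which convolution with a kernel of mass one preserves, leaves a continuous
    periodic function F. It must be factored as the convolution of a continuous
    periodic y with a kernel of mass one. This is Cohen's factorization,
    in a form where everything is explicit. Let R_a u be the periodic solution
    y of y' = a (u - y); it is the convolution of u with the periodized
    exponential density of parameter a. The average (1 + R_a) / 2 is inverted by
    2 - R_{2a} (resolvent_double). Since R_a u tends to u as a grows, one can
    choose a_0, a_1, ... growing so fast that y_0 = F,
    y_{m+1} = 2 y_m - R_{2 a_m} y_m moves by at most 2^-m at each step, hence
    converges uniformly to some y. Moreover F is the image of y_m under the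
    product of the averages (1 + R_{a_k}) / 2 for k < m. The resolvent identity
    expands this product into

      2^-m + sum_{k < m} c_k R_{a_k},

    and if the parameters grow fast enough the coefficients are nonnegative and
    increase with m (factorization_step). Their sum is 1 - 2^-m, so that the
    kernels increase to an integrable function g of mass one
    (kernel_limit_integral), and letting m tend to infinity yields F = g * y
    (kernel_limit_conv). *)

(** * Antiderivatives of continuous functions *)

Section calculus.
Context {R : realType}.
Implicit Types (f g u v F U V : R -> R) (a b c x : R).
Notation mu := (@lebesgue_measure R).

Lemma is_derive_addf f g x a b : is_derive x 1 f a -> is_derive x 1 g b ->
  is_derive x 1 (fun t => f t + g t) (a + b).
Proof. by move=> ? ?; exact: is_deriveD. Qed.

Lemma is_derive_subf f g x a b : is_derive x 1 f a -> is_derive x 1 g b ->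
  is_derive x 1 (fun t => f t - g t) (a - b).
Proof. by move=> ? ?; exact: is_deriveB. Qed.

Lemma is_derive_mulf f g x a b : is_derive x 1 f a -> is_derive x 1 g b ->
  is_derive x 1 (fun t => f t * g t) (f x * b + g x * a).
Proof. by move=> ? ?; exact: is_deriveM. Qed.

Lemma is_derive_scalef f x a c : is_derive x 1 f a ->
  is_derive x 1 (fun t => c * f t) (c * a).
Proof. by move=> ?; exact: is_deriveZ. Qed.

Lemma is_derive_affine f x a c b : is_derive (c * x + b) 1 f a ->
  is_derive x 1 (fun t => f (c * t + b)) (c * a).
Proof.
move=> fa.
have H : is_derive x (1 : R) (fun t => c * t + b) c.
  rewrite -[X in is_derive _ _ _ X]addr0; apply: is_derive_addf.
  by rewrite -[X in is_derive _ _ _ X]mulr1; apply: is_derive_scalef.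
have := @is_derive1_comp _ f (fun t => c * t + b) _ _ _ fa H.
by rewrite mulrC.
Qed.

Lemma is_derive_shiftf f x a b : is_derive (x + b) 1 f a ->
  is_derive x 1 (fun t => f (t + b)) a.
Proof.
move=> fa; have := @is_derive_affine f x a 1 b; rewrite !mul1r => /(_ fa).
by under eq_fun do rewrite mul1r.
Qed.

Lemma is_derive_reflectf f x a b : is_derive (b - x) 1 f a ->
  is_derive x 1 (fun t => f (b - t)) (- a).
Proof.
move=> fa; have := @is_derive_affine f x a (-1) b.
rewrite !mulN1r addrC => /(_ fa).
by under eq_fun do rewrite mulN1r addrC.
Qed.

Lemma is_derive_continuous f x a : is_derive x 1 f a -> {for x, continuous f}.
Proof. by move=> [df _]; apply: differentiable_continuous; exact/derivable1_diffP. Qed.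

Lemma is_derive_eq_constant f : (forall x, is_derive x 1 f 0) ->
  forall x y, f x = f y.
Proof.
move=> df x y; exact: (@is_derive_0_is_cst _ f).
Qed.

Lemma Rintegral_FTC u U a b : a <= b -> continuous u ->
  (forall x, is_derive x 1 U (u x)) ->
  \int[mu]_(x in `[a, b]) u x = U b - U a.
Proof.
rewrite le_eqVlt => /predU1P[<- _ _|ab cu dU].
  by rewrite set_itv1 Rintegral_set1 subrr.
have cU : continuous U by move=> x; exact: is_derive_continuous (dU x).
rewrite /Rintegral (@continuous_FTC2 _ u U)//.
- exact: continuous_subspaceT.
- split => //.
  + exact/cvg_at_right_filter/cU.
  + exact/cvg_at_left_filter/cU.
- by move=> x _; rewrite derive1E derive_val.
Qed.

Lemma continuous_integrable_itv u a b : continuous u ->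
  mu.-integrable `[a, b] (EFin \o u).
Proof.
move=> cu; apply: continuous_compact_integrable; first exact: segment_compact.
exact: continuous_subspaceT.
Qed.

(** The integral over a segment only gives an antiderivative to the right of
    its origin; a far enough origin, moving with the point, covers the line. *)
Lemma antiderivative_exists u : continuous u ->
  exists U, forall x, is_derive x 1 U (u x).
Proof.
move=> cu.
pose A a x := \int[mu]_(t in `[a, x]) u t.
have dA a x : a < x -> is_derive x 1 (A a) (u x).
  move=> ax; have x1 : x < x + 1 by rewrite ltrDl.
  have [] := continuous_FTC1_closed x1 (continuous_integrable_itv _ _ cu) ax (cu x).
  by rewrite derive1E => dF <-; exact/derivableP.
have AB a b x : a <= b -> b <= x -> A a x - A a b = A b x.
  move=> ab bx; rewrite /A Rintegral_itvB ?bnd_simp//; last exact: continuous_integrable_itv.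
  rewrite Rintegral_itv_obnd_cbnd//.
  apply: (integrableS _ _ _ (continuous_integrable_itv b x cu)) => //.
  exact: subset_itv_oc_cc.
(* An origin to the left of both 0 and x. *)
pose U x := A (- (`|x| + 1)) x - A (- (`|x| + 1)) 0.
exists U => x.
pose a : R := - (`|x| + 2).
have ax : a < x by rewrite /a; have := ler_norm (- x); rewrite normrN; lra.
apply: (@near_eq_is_derive _ _ _ (fun y => A a y - A a 0)).
- near=> y.
  have yx : `|x - y| < 1.
    near: y; apply: (@cvgr_dist_lt _ _ _ _ _ id) => //.
  pose b : R := - (`|y| + 1).
  have nn : `|y| <= `|x| + `|x - y| .
    by rewrite -{1}(subrKC x y) -opprB (le_trans (ler_normB _ _))// normrN.
  have ab : a <= b by rewrite /a /b; lra.
  have by' : b <= y by rewrite /b; have := ler_norm (- y); rewrite normrN; lra.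
  have b0 : b <= 0 by rewrite /b; have := normr_ge0 y; lra.
  by rewrite /U -/b -(AB _ _ _ ab by') -(AB _ _ _ ab b0); ring.
- rewrite -[X in is_derive _ _ _ X]subr0.
  by apply: is_derive_subf; exact: dA.
Unshelve. all: by end_near. Qed.

End calculus.

(** * Smooth functions with compact support *)

Section deriv_eps.
Context {R : realType}.

Lemma is_derive_eps (f : R -> R) (x a : R) :
  (forall e, 0 < e -> exists2 d, 0 < d & forall h, `|h| < d -> h != 0 ->
     `|f (x + h) - f x - h * a| <= e * `|h|) -> is_derive x 1 f a.
Proof.
move=> H.
have cv : h^-1 *: ((f \o shift x) (h *: (1:R)) - f x) @[h --> 0^'] --> a.
  apply/cvgrPdist_le => e e0; have [d d0 Hd] := H e e0.
  near=> h.
  have h0 : h != 0 by near: h; exact: nbhs_dnbhs_neq.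
  have hd : `|h| < d by near: h; exact: dnbhs0_lt.
  have hp : 0 < `|h| by rewrite normr_gt0.
  rewrite /shift/= /GRing.scale/= mulr1 (addrC h x).
  have -> : a - h^-1 * (f (x + h) - f x) = - (h^-1 * (f (x + h) - f x - h * a)).
    by field.
  by rewrite normrN normrM normfV mulrC ler_pdivrMr//; exact: Hd.
by apply: DeriveDef; [apply/cvg_ex; exists a | exact: cvg_lim cv].
Unshelve. all: by end_near. Qed.

End deriv_eps.

Section bump.
Context {R : realType}.
Implicit Types (p q : {poly R}) (x y a b : R) (f : R -> R).

(** The functions p(1/x) exp(-1/x), flat at the origin, are closed under
    differentiation when p ranges over polynomials. *)
Definition flat_exp p x : R := if 0 < x then p.[x^-1] * expR (- x^-1) else 0.

(** Bound each monomial by the term of the same degree of the exponential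
    series. *)
Lemma poly_le_expR q : exists2 C, 0 <= C & forall y, 0 <= y -> `|q.[y]| <= C * expR y.
Proof.
exists (\sum_(i < size q) `|q`_i| * i`!%:R) => [|y y0].
  by apply: sumr_ge0 => i _; rewrite mulr_ge0.
rewrite horner_coef (le_trans (ler_norm_sum _ _ _))// mulr_suml ler_sum// => i _.
rewrite normrM -mulrA ler_wpM2l// normrX ger0_norm//.
have fi : (0 : R) < i`!%:R by rewrite ltr0n fact_gt0.
rewrite mulrC -ler_pdivrMr//; case: (nat_of_ord i) => [|k].
  by rewrite expr0 fact0 divr1 -expR0 ler_expR.
by apply: le_trans (expR_ge1Dxn k y0); rewrite lerDr.
Qed.

Lemma is_derive_flat_exp p x :
  is_derive x 1 (flat_exp p) (flat_exp ('X^2 * (p - p^`())) x).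
Proof.
have [x0|x0|<-] := ltgtP 0 x.
- rewrite /flat_exp x0.
  have dV : is_derive x 1 (fun t => t^-1) (- (x^-1) ^+ 2).
    have := @is_deriveV R id x 1 1 (lt0r_neq0 x0) (is_derive_id _ _).
    by rewrite /GRing.scale/= mulr1 exprVn.
  have dp : is_derive x 1 (fun t => p.[t^-1]) (p^`().[x^-1] * - (x^-1) ^+ 2).
    by have := @is_derive1_comp _ (horner p) (fun t => t^-1) _ _ _ (is_derive_poly p _) dV.
  have dE : is_derive x 1 (fun t => expR (- t^-1)) (expR (- x^-1) * (x^-1) ^+ 2).
    have dN : is_derive x 1 (fun t => - t^-1) ((x^-1) ^+ 2).
      by rewrite -[X in is_derive _ _ _ X]opprK; exact: is_deriveN.
    by have := @is_derive1_comp _ (@expR R) (fun t => - t^-1) _ _ _ (is_derive_expR _) dN.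
  apply: (@near_eq_is_derive _ _ _ (fun t : R => p.[t^-1] * expR (- t^-1))).
    by near=> t; rewrite ifT//; near: t; exact: lt_nbhsr.
  have := is_derive_mulf dp dE => H.
  apply: is_derive_eq H _.
  by rewrite hornerM hornerXn hornerD hornerN; ring.
- rewrite {2}/flat_exp ltNge (ltW x0)/=.
  apply: (@near_eq_is_derive _ _ _ (cst 0)).
  near=> t; rewrite /flat_exp ltNge ifF//=; apply/negbTE; rewrite negbK ltW//.
  by near: t; exact: lt_nbhsl.
- rewrite {2}/flat_exp ltxx; apply: is_derive_eps => e e0.
  (* The factor X^2 leaves a spare factor h after division by h. *)
  have [C C0 HC] := poly_le_expR ('X^2 * p).
  exists (e / (C + 1)); first by rewrite divr_gt0// ltr_wpDl.
  move=> h hd h0; rewrite add0r mulr0 /flat_exp ltxx !subr0.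
  case: ifPn => [hp|_]; last by rewrite normr0 mulr_ge0// ltW.
  have {}hd : h * (C + 1) < e.
    by rewrite -ltr_pdivlMr ?ltr_wpDl// (le_lt_trans (ler_norm h)).
  have hV : 0 <= h^-1 by rewrite invr_ge0 ltW.
  have := HC _ hV; rewrite hornerM hornerXn normrM ger0_norm ?exprn_ge0// => HC'.
  rewrite normrM (ger0_norm (expR_ge0 _)) expRN (gtr0_norm hp).
  rewrite ler_pdivrMr ?expR_gt0//.
  have -> : `|p.[h^-1]| = h ^+ 2 * (h^-1 ^+ 2 * `|p.[h^-1]|).
    by rewrite mulrA -exprMn divff// expr1n mul1r.
  apply: (@le_trans _ _ (h ^+ 2 * (C * expR h^-1))).
    by rewrite ler_wpM2l// exprn_ge0// ltW.
  rewrite mulrA ler_wpM2r ?expR_ge0// expr2 -mulrA mulrC ler_wpM2r ?(ltW hp)//.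
  by rewrite (le_trans _ (ltW hd))// ler_wpM2l ?(ltW hp)// lerDl.
Unshelve. all: by end_near. Qed.

Lemma flat_expN p x : flat_exp (- p) x = - flat_exp p x.
Proof. by rewrite /flat_exp; case: ifP; rewrite ?oppr0// hornerN mulNr. Qed.

(** Differentiating such a product yields a sum of two of them, so that the
    sums form a family of differentiable functions closed under derivation. *)
Inductive bump_sum a b : (R -> R) -> Prop :=
| bump_prod p q : bump_sum a b (fun t => flat_exp p (t - a) * flat_exp q (b - t))
| bump_add f g : bump_sum a b f -> bump_sum a b g ->
    bump_sum a b (fun t => f t + g t).

Lemma bump_sum_derive a b f : bump_sum a b f ->
  exists2 g, bump_sum a b g & forall x, is_derive x 1 f (g x).
Proof.
elim=> [p q|f1 f2 _ [g1 Hg1 d1] _ [g2 Hg2 d2]]; last first.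
  by exists (fun t => g1 t + g2 t); [exact: bump_add|move=> x; exact: is_derive_addf].
pose p' := 'X^2 * (p - p^`()); pose q' := 'X^2 * (q - q^`()).
exists (fun t => flat_exp p (t - a) * flat_exp (- q') (b - t) +
                 flat_exp p' (t - a) * flat_exp q (b - t)).
  by apply: bump_add; exact: bump_prod.
move=> x.
have d1 := is_derive_shiftf (is_derive_flat_exp p (x + - a)).
have d2 := is_derive_reflectf (is_derive_flat_exp q (b - x)).
apply: is_derive_eq (is_derive_mulf d1 d2) _.
by rewrite flat_expN; ring.
Qed.

(** Smoothness is obtained without computing any iterated derivative: it is
    enough to stay within a class of functions closed under derivation. *)
Lemma smooth_of_closed_class (S : (R -> R) -> Prop) :
  (forall f, S f -> exists2 g, S g & forall x, is_derive x 1 f (g x)) ->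
  forall f, S f -> smooth f.
Proof.
move=> H f Sf n x; suff /H[g _ /(_ x)] : S (derive1n n f) by move=> /@ex_derive.
elim: n => // n /H[g Sg dg]; rewrite derive1nS.
suff -> : derive1 (derive1n n f) = g by [].
by apply/funext => y; rewrite derive1E; have [_ <-] := dg y.
Qed.

Lemma test_function_intro f a b : smooth f ->
  (forall x, x \notin `[a, b] -> f x = 0) -> f \in @test_function R.
Proof.
move=> sf f0; rewrite inE; split => //.
apply: (@subclosed_compact _ _ `[a, b]%classic).
- exact: closed_closure.
- exact: segment_compact.
- rewrite [X in _ `<=` X](closure_id _).1; last exact: interval_closed.
  by apply: closure_subset => x /=; apply: contraNT => /f0 ->.
Qed.

Lemma bump_exists a b : exists phi : testfun R,
  [/\ forall x, 0 <= phi x, forall x, x \in `]a, b[ -> 0 < phi x &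
      forall x, x \notin `]a, b[ -> phi x = 0].
Proof.
pose f t := flat_exp 1 (t - a) * flat_exp 1 (b - t).
have e0 x : 0 <= flat_exp 1 x.
  by rewrite /flat_exp; case: ifP => // _; rewrite hornerC mul1r expR_ge0.
have f0 x : x \notin `]a, b[ -> f x = 0.
  rewrite in_itv/= negb_and -!leNgt => /orP[xa|bx]; rewrite /f /flat_exp.
    by rewrite ltNge subr_le0 xa/= mul0r.
  by rewrite [X in _ * (if X then _ else _)]ltNge subr_le0 bx/= mulr0.
have tf : f \in @test_function R.
  apply: (@test_function_intro _ a b) => [|x xab]; last first.
    apply: f0; apply: contra xab; exact: subset_itv_oo_cc.
  apply: (@smooth_of_closed_class (bump_sum a b)); first exact: bump_sum_derive.
  exact: bump_prod.
exists (TestFun tf); split => //= x.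
- by rewrite mulr_ge0.
- rewrite in_itv/= => /andP[ax xb]; rewrite /f /flat_exp !subr_gt0 ax xb !hornerC.
  by rewrite !mul1r mulr_gt0// expR_gt0.
Qed.

Lemma testfun_derive (phi : testfun R) x : is_derive x 1 phi (test_derive phi x).
Proof.
by apply: DeriveDef; [exact: (@testfun_smooth _ phi 0%N)|rewrite /= derive1E].
Qed.

Lemma testfun_continuous (phi : testfun R) : continuous phi.
Proof. by move=> x; exact: is_derive_continuous (testfun_derive phi x). Qed.

Lemma testfun_bounded_supp (phi : testfun R) : exists2 M, 0 <= M &
  forall x, x \notin `[- M, M] -> phi x = 0.
Proof.
have [M [_ HM]] := compact_bounded (@testfun_compact _ phi).
have M1 : M < `|M| + 1 by rewrite (le_lt_trans (ler_norm _))// ltrDl.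
exists (`|M| + 1) => // x; apply: contraNeq => phix; rewrite in_itv/= -ler_norml.
by apply: (HM _ M1); exact: subset_closure.
Qed.

Lemma test_derive_supp (phi : testfun R) M :
  (forall x, x \notin `[- M, M] -> phi x = 0) ->
  forall x, x \notin `[- M, M] -> test_derive phi x = 0.
Proof.
move=> phi0 x; rewrite in_itv/= -ler_norml -ltNge => Mx /=.
rewrite derive1E (@near_eq_derive _ _ _ _ (cst 0)) ?derive_cst//.
near=> y; apply: phi0; rewrite in_itv/= -ler_norml -ltNge.
near: y; have : `|y| @[y --> x] --> `|x| by apply: cvg_norm; exact: cvg_id.
by move=> /cvgrPdist_lt /(_ (`|x| - M)); rewrite subr_gt0 => /(_ Mx); apply: filterS => y;
  have := ler_norm (`|x| - `|y|); lra.
Unshelve. all: by end_near. Qed.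

End bump.

(** * Integrals of continuous functions with compact support *)

Section symmetric_support.
Context {R : realType}.
Implicit Types (u v F G U V : R -> R) (phi psi : testfun R) (x M c : R).
Notation mu := (@lebesgue_measure R).

(** Supports are tracked by symmetric intervals, so that finitely many of them
    have a common bound by taking the largest radius. *)
Definition vanishes_from M v := forall x, M <= `|x| -> v x = 0.

Lemma vanishes_fromW M N v : M <= N -> vanishes_from M v -> vanishes_from N v.
Proof. by move=> MN vM x Nx; apply: vM; exact: le_trans Nx. Qed.

Lemma vanishes_from_mull M u v : vanishes_from M v ->
  vanishes_from M (fun x => u x * v x).
Proof. by move=> vM x /vM ->; rewrite mulr0. Qed.

Lemma vanishes_from_itv M v x : vanishes_from M v -> x \notin `[- M, M] -> v x = 0.
Proof. by move=> vM; rewrite in_itv/= -ler_norml -ltNge => /ltW/vM. Qed.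

Lemma Rintegral_vanishes M v : vanishes_from M v ->
  \int[mu]_x v x = \int[mu]_(x in `[- M, M]) v x.
Proof.
move=> vM; rewrite [RHS]Rintegral_mkcond; congr (Rintegral _ _).
apply/funext => x; rewrite patchE; case: ifPn => // /negP xM.
by apply: vanishes_from_itv vM _; apply/negP => xM'; apply: xM; rewrite inE.
Qed.

Lemma Rintegral_vanishes_FTC M v V : 0 <= M -> continuous v ->
  (forall x, is_derive x 1 V (v x)) -> vanishes_from M v ->
  \int[mu]_x v x = V M - V (- M).
Proof.
move=> M0 cv dV vM; rewrite (Rintegral_vanishes vM) (Rintegral_FTC _ cv dV)//.
by rewrite (le_trans _ M0)// oppr_le0.
Qed.

Lemma continuous_addf u v : continuous u -> continuous v ->
  continuous (fun x => u x + v x).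
Proof. by move=> cu cv x; apply: cvgD; [exact: cu | exact: cv]. Qed.

Lemma continuous_subf u v : continuous u -> continuous v ->
  continuous (fun x => u x - v x).
Proof. by move=> cu cv x; apply: cvgB; [exact: cu | exact: cv]. Qed.

Lemma continuous_mulf u v : continuous u -> continuous v ->
  continuous (fun x => u x * v x).
Proof. by move=> cu cv x; apply: cvgM; [exact: cu | exact: cv]. Qed.

Lemma continuous_shiftf u c : continuous u -> continuous (fun x => u (x + c)).
Proof.
move=> cu x; apply: (@continuous_comp _ _ _ (fun x => x + c) u); last exact: cu.
by apply: cvgD; [exact: cvg_id | exact: cvg_cst].
Qed.

Lemma continuous_reflectf u c : continuous u -> continuous (fun x => u (c - x)).
Proof.
move=> cu x; apply: (@continuous_comp _ _ _ (fun x => c - x) u); last exact: cu.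
by apply: cvgB; [exact: cvg_cst | exact: cvg_id].
Qed.

Lemma RintegralB_vanishes M u v : continuous u -> continuous v ->
  vanishes_from M u -> vanishes_from M v ->
  \int[mu]_x (u x - v x) = \int[mu]_x u x - \int[mu]_x v x.
Proof.
move=> cu cv uM vM; rewrite (@Rintegral_vanishes M); last first.
  by move=> x Mx; rewrite uM// vM// subrr.
rewrite (Rintegral_vanishes uM) (Rintegral_vanishes vM) RintegralB//;
  exact: continuous_integrable_itv.
Qed.

Lemma RintegralD_vanishes M u v : continuous u -> continuous v ->
  vanishes_from M u -> vanishes_from M v ->
  \int[mu]_x (u x + v x) = \int[mu]_x u x + \int[mu]_x v x.
Proof.
move=> cu cv uM vM; rewrite (@Rintegral_vanishes M); last first.
  by move=> x Mx; rewrite uM// vM// addr0.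
rewrite (Rintegral_vanishes uM) (Rintegral_vanishes vM) RintegralD//;
  exact: continuous_integrable_itv.
Qed.

Lemma RintegralZ_vanishes M u c : continuous u -> vanishes_from M u ->
  \int[mu]_x (c * u x) = c * \int[mu]_x u x.
Proof.
move=> cu uM; rewrite (@Rintegral_vanishes M); last first.
  by move=> x Mx; rewrite uM// mulr0.
by rewrite (Rintegral_vanishes uM) RintegralZl//; exact: continuous_integrable_itv.
Qed.

(** Makes the boundary terms independent of the interval used, so that
    translates and reflections of a function can be integrated over one interval. *)
Lemma antiderivative_const_beyond M v V : (forall x, is_derive x 1 V (v x)) ->
  continuous v -> vanishes_from M v ->
  (forall x, M <= x -> V x = V M) /\ (forall x, x <= - M -> V x = V (- M)).
Proof.
move=> dV cv vM; split => x Mx; apply/eqP; rewrite -subr_eq0.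
  rewrite -(Rintegral_FTC Mx cv dV); apply/eqP.
  rewrite -[RHS](mul0r (fine (mu `[M, x]))) -Rintegral_cst//.
  apply: eq_Rintegral => y; rewrite inE/= in_itv/= => /andP[My _].
  by apply: vM; rewrite (le_trans My)// ler_norm.
rewrite -opprB oppr_eq0 -(Rintegral_FTC Mx cv dV); apply/eqP.
rewrite -[RHS](mul0r (fine (mu `[x, (- M)]))) -Rintegral_cst//.
apply: eq_Rintegral => y; rewrite inE/= in_itv/= => /andP[_ yM].
by apply: vM; rewrite -normrN (le_trans _ (ler_norm _))// lerNr.
Qed.

Lemma Rintegral_shift M v c : continuous v -> vanishes_from M v ->
  \int[mu]_x v (x - c) = \int[mu]_x v x.
Proof.
move=> cv vM; have [V dV] := antiderivative_exists cv.
pose N := `|M| + `|c|.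
have N0 : 0 <= N by rewrite addr_ge0.
have MN : M <= N by rewrite (le_trans (ler_norm _))// lerDl.
have cn := ler_norm c; have cn' := ler_norm (- c); rewrite normrN in cn'.
have mn := ler_norm M.
rewrite (Rintegral_vanishes_FTC N0 cv dV (vanishes_fromW MN vM)).
have dV' x : is_derive x 1 (fun t => V (t - c)) (v (x - c)).
  exact: is_derive_shiftf.
rewrite (Rintegral_vanishes_FTC N0 _ dV') //; last first.
- move=> x Nx; apply: vM; have := ler_normB x c; rewrite /N in Nx.
  have := ler_normD (x - c) c; rewrite subrK; lra.
- exact: continuous_shiftf.
have [cR cL] := antiderivative_const_beyond dV cv vM.
have [] : [/\ M <= N, M <= N - c, - N <= - M & - N - c <= - M] by rewrite /N; split; lra.
by move=> h1 h2 h3 h4; rewrite (cR _ h1) (cR _ h2) (cL _ h3) (cL _ h4).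
Qed.

Lemma Rintegral_reflect M v c : continuous v -> vanishes_from M v ->
  \int[mu]_x v (c - x) = \int[mu]_x v x.
Proof.
move=> cv vM; have [V dV] := antiderivative_exists cv.
pose N := `|M| + `|c|.
have N0 : 0 <= N by rewrite addr_ge0.
have MN : M <= N by rewrite (le_trans (ler_norm _))// lerDl.
have cn := ler_norm c; have cn' := ler_norm (- c); rewrite normrN in cn'.
have mn := ler_norm M.
rewrite (Rintegral_vanishes_FTC N0 cv dV (vanishes_fromW MN vM)).
have dV' x : is_derive x 1 (fun t => - V (c - t)) (v (c - x)).
  rewrite -[X in is_derive _ _ _ X]opprK; apply: is_deriveN.
  exact: is_derive_reflectf.
rewrite (Rintegral_vanishes_FTC N0 _ dV') //; last first.
- move=> x Nx; apply: vM; rewrite /N in Nx.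
  have := ler_normB c (c - x); rewrite subKr; lra.
- exact: continuous_reflectf.
have [cR cL] := antiderivative_const_beyond dV cv vM.
have [] : [/\ M <= N, M <= c - - N, - N <= - M & c - N <= - M] by rewrite /N; split; lra.
by move=> h1 h2 h3 h4; rewrite (cR _ h1) (cR _ h2) (cL _ h3) (cL _ h4) opprK addrC.
Qed.

Lemma testfun_vanishes phi : exists2 M, 0 <= M & vanishes_from M phi.
Proof.
have [M M0 HM] := testfun_bounded_supp phi.
exists (M + 1) => [|x Mx]; first by rewrite addr_ge0.
apply: HM; rewrite in_itv/= -ler_norml -ltNge (lt_le_trans _ Mx)// ltrDl//.
Qed.

Lemma test_derive_vanishes phi M : vanishes_from M phi ->
  vanishes_from (M + 1) (test_derive phi).
Proof.
move=> phiM x Mx; apply: (@test_derive_supp _ phi M); last first.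
  by rewrite in_itv/= -ler_norml -ltNge (lt_le_trans _ Mx)// ltrDl.
by move=> y; exact: vanishes_from_itv.
Qed.

Lemma Rintegral_test_derive phi : \int[mu]_x test_derive phi x = 0.
Proof.
have [M M0 phiM] := testfun_vanishes phi.
have M1 : 0 <= M + 1 by rewrite addr_ge0.
rewrite (Rintegral_vanishes_FTC M1 _ (testfun_derive phi)).
- by rewrite !phiM ?subrr// ?normrN ger0_norm// lerDl.
- exact: testfun_continuous.
- exact: test_derive_vanishes.
Qed.

Lemma test_deriveL (a : R) phi psi :
  test_derive (a *: phi + psi) = a *: test_derive phi + test_derive psi.
Proof.
apply/val_inj/funext => x.
change (test_derive (a *: phi + psi) x = a * test_derive phi x + test_derive psi x).
have [_ <-] := testfun_derive (a *: phi + psi) x.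
have [_ <-] : is_derive x 1 (test_val (a *: phi + psi))
   (a * test_derive phi x + test_derive psi x).
  apply: (@is_derive_addf _ (fun x => a * phi x)); last exact: testfun_derive.
  by apply: is_derive_scalef; exact: testfun_derive.
by [].
Qed.

Lemma test_derive_reflect phi (c : R) x :
  test_derive (test_reflect c phi) x = - test_derive phi (c - x).
Proof.
have [_ <-] := testfun_derive (test_reflect c phi) x.
have := is_derive_reflectf (testfun_derive phi (c - x)).
by case=> _.
Qed.

Lemma testfun_le_sup phi : exists2 B, 0 <= B & forall x, `|phi x| <= B.
Proof.
have [M M0 phiM] := testfun_vanishes phi.
have : compact (phi @` `[- M, M]).
  apply: continuous_compact; last exact: segment_compact.
  by apply: continuous_subspaceT; exact: testfun_continuous.
move=> /compact_bounded[B [_ HB]]; have B1 : B < `|B| + 1.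
  by rewrite (le_lt_trans (ler_norm _))// ltrDl.
exists (`|B| + 1) => [|x]; first by rewrite addr_ge0.
have [xM|/(vanishes_from_itv phiM) ->] := boolP (x \in `[- M, M]).
  by apply: (HB _ B1); exists x.
by rewrite normr0 addr_ge0.
Qed.

End symmetric_support.

(** * Distributional derivatives of continuous functions *)

Section distributions.
Context {R : realType}.
Implicit Types (u v F G U V : R -> R) (phi psi : testfun R) (x y M c : R).
Notation mu := (@lebesgue_measure R).

Lemma dderive_dfunE F phi :
  dderive (dfun F) phi = - \int[mu]_x (F x * test_derive phi x).
Proof. by []. Qed.

Lemma dderive_dfunB F G : continuous F -> continuous G ->
  dderive (dfun F) - dderive (dfun G) = dderive (dfun (fun x => F x - G x)).
Proof.
move=> cF cG; apply/funext => phi; rewrite fctE !dderive_dfunE.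
have [M _ phiM] := testfun_vanishes phi.
have phi'M := test_derive_vanishes phiM.
have cphi : continuous (test_derive phi) by exact: testfun_continuous.
under [in RHS]eq_Rintegral do rewrite mulrBl.
rewrite (@RintegralB_vanishes _ (M + 1)); first by rewrite opprB opprK addrC.
- exact: continuous_mulf.
- exact: continuous_mulf.
- exact: vanishes_from_mull.
- exact: vanishes_from_mull.
Qed.

(** The du Bois-Reymond lemma: if u were smaller near y than near x, then the
    difference of two translates of a bump, which has integral zero and so is
    the derivative of a test function, would detect it. *)
Lemma du_Bois_Reymond u : continuous u ->
  (forall phi, \int[mu]_x (u x * test_derive phi x) = 0) ->
  forall x y, u x = u y.
Proof.
move=> cu u0.
suff H x y : u x <= u y by move=> x y; apply/eqP; rewrite eq_le !H.
rewrite leNgt; apply/negP => uyx.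
pose w s := u (s + x) - u (s + y).
have cw : continuous w by apply: continuous_subf; exact: continuous_shiftf.
have w0 : 0 < w 0 by rewrite /w !add0r subr_gt0.
have [e e0 we] : exists2 e : R, 0 < e & forall s, `|s| < e -> 0 < w s.
  have := cw 0 => /cvgrPdist_lt /(_ _ w0)/nbhs_ballP[e /= e0 He].
  exists e => // s se; have := He s; rewrite /ball/= sub0r normrN => /(_ se).
  by have := ler_norm (w 0 - w s); lra.
have [B [B0 Bpos Bout]] := bump_exists (- e) e.
have cB : continuous B by exact: testfun_continuous.
have Be : vanishes_from e B.
  by move=> s se; apply: Bout; rewrite in_itv/= -ltr_norml -leNgt.
have [V dV] := antiderivative_exists cB.
(* Two reflections compose to the translation by c. *)
pose tr (c : R) := test_reflect c (test_reflect 0 B).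
have trE c t : tr c t = B (t - c) by rewrite /= sub0r opprB.
pose psi : testfun R := tr x - tr y.
have psiE t : psi t = B (t - x) - B (t - y) by rewrite -!trE.
pose Phi (t : R) : R := V (t - x) - V (t - y).
have dPhi (t : R) : is_derive t (1 : R) Phi (psi t).
  by rewrite psiE; apply: is_derive_subf; apply: is_derive_shiftf; exact: dV.
have [VR VL] := antiderivative_const_beyond dV cB Be.
pose N : R := e + `|x| + `|y|.
have nx := ler_norm x; have nx' := ler_norm (- x); rewrite normrN in nx'.
have ny := ler_norm y; have ny' := ler_norm (- y); rewrite normrN in ny'.
have Phi0 (t : R) : t \notin `[- N, N] -> Phi t = 0.
  rewrite in_itv/= negb_and -!ltNge /Phi => /orP[tN|Nt].
    by rewrite !VL ?subrr//; rewrite /N in tN; lra.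
  by rewrite !VR ?subrr//; rewrite /N in Nt; lra.
have Phi' : derive1 Phi = psi.
  by apply/funext => t; rewrite derive1E; have [_ <-] := dPhi t.
have sPhi : smooth Phi.
  case=> [|n] t; first by have [] := dPhi t.
  by rewrite derive1Sn Phi'; exact: testfun_smooth.
pose phi := TestFun (test_function_intro sPhi Phi0).
have := u0 phi.
have -> : \int[mu]_t (u t * test_derive phi t) =
    \int[mu]_t (u t * B (t - x) - u t * B (t - y)).
  by apply: eq_Rintegral => t _; rewrite /= Phi' psiE mulrBr.
have vtr c : `|c| <= `|x| + `|y| -> vanishes_from N (fun t => u t * B (t - c)).
  move=> cN t Nt; rewrite Be ?mulr0//.
  by have := ler_normD (t - c) c; rewrite subrK /N in Nt *; lra.
have ctr c : continuous (fun t => u t * B (t - c)).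
  by apply: continuous_mulf => //; exact: continuous_shiftf.
rewrite (@RintegralB_vanishes _ N)//; last 2 first.
- by apply: vtr; lra.
- by apply: vtr; lra.
have sh c : \int[mu]_t (u t * B (t - c)) = \int[mu]_s (u (s + c) * B s).
  rewrite -[RHS](@Rintegral_shift _ e _ c).
  - by apply: eq_Rintegral => t _; rewrite subrK.
  - by apply: continuous_mulf => //; exact: continuous_shiftf.
  - exact: vanishes_from_mull.
rewrite !sh -(@RintegralB_vanishes _ e).
- under eq_Rintegral do rewrite -mulrBl.
  have cwB : continuous (fun s => w s * B s) by exact: continuous_mulf.
  have [W dW] := antiderivative_exists cwB.
  rewrite (Rintegral_vanishes_FTC (ltW e0) cwB dW); last exact: vanishes_from_mull.
  have ee : - e < e by lra.
  have [|c ce ->] := MVT ee (fun t _ => dW t).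
    by apply: continuous_subspaceT => t; exact: is_derive_continuous (dW t).
  move/eqP; apply/negP; rewrite gt_eqF// mulr_gt0//; last by lra.
  rewrite mulr_gt0//; last exact: Bpos.
  by apply: we; rewrite ltr_norml; move: ce; rewrite in_itv.
- by apply: continuous_mulf => //; exact: continuous_shiftf.
- by apply: continuous_mulf => //; exact: continuous_shiftf.
- exact: vanishes_from_mull.
- exact: vanishes_from_mull.
Qed.

Lemma dderive_dfun_inj F G : continuous F -> continuous G ->
  dderive (dfun F) = dderive (dfun G) -> forall x y, F x - G x = F y - G y.
Proof.
move=> cF cG FG; apply: du_Bois_Reymond; first exact: continuous_subf.
move=> phi; have := dderive_dfunB cF cG; rewrite FG subrr.
move=> /(congr1 (fun T => - T phi)); rewrite dderive_dfunE opprK => <-.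
exact: oppr0.
Qed.

(** Integration by parts: the integral of the derivative of U phi vanishes. *)
Lemma dfun_antiderivative u U : continuous u ->
  (forall x, is_derive x 1 U (u x)) -> dfun u = dderive (dfun U).
Proof.
move=> cu dU; apply/funext => phi; rewrite dderive_dfunE /dfun.
have [M M0 phiM] := testfun_vanishes phi.
have M1 : 0 <= M + 1 by rewrite addr_ge0.
have phi'M := test_derive_vanishes phiM.
have {}phiM : vanishes_from (M + 1) phi by apply: vanishes_fromW phiM; rewrite lerDl.
have cphi : continuous phi by exact: testfun_continuous.
have cphi' : continuous (test_derive phi) by exact: testfun_continuous.
have cU : continuous U by move=> x; exact: is_derive_continuous (dU x).
apply/eqP; rewrite -addr_eq0 -(@RintegralD_vanishes _ (M + 1)).
- have dUphi x : is_derive x 1 (fun x => U x * phi x) (u x * phi x + U x * test_derive phi x).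
    by apply: is_derive_eq (is_derive_mulf (dU x) (testfun_derive phi x)) _; ring.
  rewrite (Rintegral_vanishes_FTC M1 _ dUphi).
  + by rewrite !phiM ?mulr0 ?subrr// ?normrN ger0_norm.
  + by apply: continuous_addf; exact: continuous_mulf.
  + by move=> x Mx; rewrite phiM// phi'M// !mulr0 addr0.
- exact: continuous_mulf.
- exact: continuous_mulf.
- exact: vanishes_from_mull.
- exact: vanishes_from_mull.
Qed.

(** The chain rule for a reflection; the constant c is free because test
    functions have derivatives of integral zero. *)
Lemma dreflect_dderive_dfun F x c : continuous F ->
  dreflect x (dderive (dfun F)) = dderive (dfun (fun t => c - F (x - t))).
Proof.
move=> cF; apply/funext => phi; rewrite /dreflect !dderive_dfunE.
have [M M0 phiM] := testfun_vanishes phi.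
have phi'N := test_derive_vanishes phiM.
have cphi' : continuous (test_derive phi) by exact: testfun_continuous.
apply/eqP; rewrite eqr_opp; apply/eqP.
pose w t := F (x - t) * - test_derive phi t.
have cw : continuous w.
  apply: continuous_mulf; first exact: continuous_reflectf.
  by move=> t; apply: cvgN; exact: cphi'.
have wN : vanishes_from (M + 1) w by move=> t Nt; rewrite /w phi'N// oppr0 mulr0.
transitivity (\int[mu]_t w t).
  rewrite -(Rintegral_reflect x cw wN); apply: eq_Rintegral => t _.
  by rewrite test_derive_reflect /w subKr.
rewrite -[LHS]add0r -(mulr0 c) -(Rintegral_test_derive phi).
rewrite -(RintegralZ_vanishes _ cphi' phi'N) -(@RintegralD_vanishes _ (M + 1))//.
- by apply: eq_Rintegral => t _; rewrite /w; ring.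
- by apply: continuous_mulf => // ?; exact: cvg_cst.
- exact: vanishes_from_mull.
Qed.

(** An order one estimate: on a compact set the constant is the integral of the
    absolute value of F over a slightly larger interval. *)
Lemma schwartz_dderive_dfun F : continuous F ->
  schwartz_distribution (dderive (dfun F)).
Proof.
move=> cF; split.
  move=> a phi psi; rewrite !dderive_dfunE test_deriveL.
  have [M1 M10 phiM1] := testfun_vanishes (test_derive phi).
  have [M2 M20 psiM2] := testfun_vanishes (test_derive psi).
  have phiM : vanishes_from (M1 + M2) (test_derive phi).
    by apply: vanishes_fromW phiM1; rewrite lerDl.
  have psiM : vanishes_from (M1 + M2) (test_derive psi).
    by apply: vanishes_fromW psiM2; rewrite lerDr.
  have cphi : continuous (test_derive phi) by exact: testfun_continuous.
  have cpsi : continuous (test_derive psi) by exact: testfun_continuous.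
  rewrite /GRing.scale/= mulrN -opprD; congr (- _).
  rewrite -(RintegralZ_vanishes a _ (vanishes_from_mull F phiM)); last exact: continuous_mulf.
  rewrite -(@RintegralD_vanishes _ (M1 + M2)).
  - by apply: eq_Rintegral => x _; rewrite mulrDr mulrCA.
  - by apply: continuous_mulf => [? |]; [exact: cvg_cst|exact: continuous_mulf].
  - exact: continuous_mulf.
  - by apply: vanishes_from_mull; exact: vanishes_from_mull.
  - exact: vanishes_from_mull.
move=> K /compact_bounded[M [_ HM]]; pose N := `|M| + 1.
have N0 : 0 <= N by rewrite addr_ge0.
have KN x : K x -> `|x| <= N.
  by apply: HM; rewrite (le_lt_trans (ler_norm _))// ltrDl.
have NN1 : - (N + 1) <= N + 1 by lra.
exists 1%N, (\int[mu]_(x in `[- (N + 1), (N + 1)]) `|F x|) => phi phiK.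
have phiN : vanishes_from (N + 1) (test_derive phi).
  move=> x Nx; apply: (@test_derive_supp _ phi N); last first.
    by rewrite in_itv/= -ler_norml -ltNge (lt_le_trans _ Nx)// ltrDl.
  move=> y; rewrite in_itv/= -ler_norml; apply: contraNeq => phiy.
  by apply: KN; apply: phiK; exact: subset_closure.
set S := \sum_(i < 2) _.
have sup_ub (psi : testfun R) x : `|psi x| <= sup (range (fun x => `|psi x|)).
  have [B _ HB] := testfun_le_sup psi.
  apply: ub_le_sup; last by exists x.
  by exists B => _ [y _ <-].
have S1 x : `|test_derive phi x| <= S.
  rewrite /S big_ord_recl big_ord1/= (le_trans (sup_ub (test_derive phi) x))// lerDr.
  by rewrite (le_trans _ (sup_ub phi 0)).
have cF' : continuous (fun x => F x * test_derive phi x).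
  by apply: continuous_mulf => //; exact: testfun_continuous.
have cnF : continuous (fun x => `|F x|) by move=> x; apply: cvg_norm; exact: cF.
rewrite dderive_dfunE normrN (Rintegral_vanishes (vanishes_from_mull F phiN)).
apply: (le_trans (le_normr_Rintegral _ _)) => //.
  exact: continuous_integrable_itv.
rewrite -RintegralZr//; last exact: continuous_integrable_itv.
apply: le_Rintegral => //.
- by apply: continuous_integrable_itv => x; apply: cvg_norm; exact: cF'.
- apply: continuous_integrable_itv; apply: continuous_mulf => // x; exact: cvg_cst.
- by move=> x _; rewrite normrM ler_wpM2l.
Qed.

End distributions.

(** * Primitives on the torus and the Alexiewicz norm *)

Section torus_primitives.
Context {R : realType}.
Implicit Types (F G H : R -> R) (f h : testfun R -> R) (x y a b : R).

Lemma reduce_mod_2pi x : exists n : int, - pi <= x - 2 * n%:~R * pi < pi.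
Proof.
have pi0 := pi_gt0 R.
pose n := Num.floor ((x + pi) / (2 * pi)); exists n.
have p2 : (0 : R) < 2 * pi by rewrite mulr_gt0.
have := Num.Theory.floor_itv ((x + pi) / (2 * pi)); rewrite -/n.
rewrite ler_pdivlMr// ltr_pdivrMr// intrD mulrDl mul1r => /andP[h1 h2].
by apply/andP; split; lra.
Qed.

Lemma continuous_bounded_itv F a b : continuous F ->
  exists2 C, 0 <= C & forall x, a <= x <= b -> `|F x| <= C.
Proof.
move=> cF; have : compact (F @` `[a, b]).
  apply: continuous_compact; last exact: segment_compact.
  exact: continuous_subspaceT.
move=> /compact_bounded[B [_ HB]]; have B1 : B < `|B| + 1.
  by rewrite (le_lt_trans (ler_norm _))// ltrDl.
exists (`|B| + 1) => [|x xab]; first by rewrite addr_ge0.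
by apply: (HB _ B1); exists x => //=; rewrite in_itv.
Qed.

Lemma Bc_add2pi F x : Bc F -> F (x + 2 * pi) = F x + F pi.
Proof.
move=> [_ _ FE]; have [n /FE E] := reduce_mod_2pi x.
have := E n; rewrite subrK => ->; have := E (n + 1); rewrite intrD.
have -> : x - 2 * n%:~R * pi + 2 * (n%:~R + 1%:~R) * pi = x + 2 * pi by ring.
by move=> ->; ring.
Qed.

(** A single translation by one period determines all of them. *)
Lemma add2pi_int F c : (forall x, F (x + 2 * pi) = F x + c) ->
  forall (n : int) x, F (x + 2 * n%:~R * pi) = F x + n%:~R * c.
Proof.
move=> FE; have nat_case (n : nat) x : F (x + 2 * n%:R * pi) = F x + n%:R * c.
  elim: n => [|n ih]; first by rewrite mulr0 !mul0r !addr0.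
  have -> : x + 2 * n.+1%:R * pi = x + 2 * n%:R * pi + 2 * pi by rewrite -natr1; ring.
  by rewrite FE ih -natr1; ring.
case=> n x; first exact: nat_case.
rewrite NegzE mulrNz.
have := nat_case n.+1 (x + 2 * - n.+1%:~R * pi).
have -> : x + 2 * - n.+1%:~R * pi + 2 * n.+1%:R * pi = x by rewrite -[n.+1%:~R]/(n.+1%:R); ring.
by move=> ->; rewrite -[n.+1%:~R]/(n.+1%:R); ring.
Qed.

Lemma Bc_intro F : continuous F -> F (- pi) = 0 ->
  (forall x, F (x + 2 * pi) = F x + F pi) -> Bc F.
Proof. by move=> cF F0 FE; split => // n y _; exact: add2pi_int. Qed.

Lemma Bc_continuous F : Bc F -> continuous F.
Proof. by case. Qed.

Lemma Bc_reflect F x : Bc F -> Bc (fun t => F (x + pi) - F (x - t)).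
Proof.
move=> BF; have cF := Bc_continuous BF; apply: Bc_intro.
- by apply: continuous_subf; [move=> ?; exact: cvg_cst|exact: continuous_reflectf].
- by rewrite opprK subrr.
- move=> y; have := Bc_add2pi (x - pi) BF; have := Bc_add2pi (x - (y + 2 * pi)) BF.
  have -> : x - pi + 2 * pi = x + pi by ring.
  have -> : x - (y + 2 * pi) + 2 * pi = x - y by ring.
  by move=> -> ->; ring.
Qed.

Lemma Bc_sub F G : Bc F -> Bc G -> Bc (fun t => F t - G t).
Proof.
move=> BF BG; apply: Bc_intro.
- by apply: continuous_subf; exact: Bc_continuous.
- by case: BF BG => _ -> _ [_ -> _]; rewrite subrr.
- by move=> x; rewrite !Bc_add2pi//; ring.
Qed.

(** Increments over at most one period are invariant under translation by a
    period, so that those starting in one compact interval suffice; this is what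
    makes the supremum in the Alexiewicz norm finite. *)
Lemma Bc_increment_bounded F : Bc F -> exists2 C, 0 <= C &
  forall a b, a <= b <= a + 2 * pi -> `|F b - F a| <= C.
Proof.
move=> BF; have pi0 := pi_gt0 R.
have [C C0 HC] := continuous_bounded_itv (- pi) (3 * pi) (Bc_continuous BF).
exists (C + C) => [|a b /andP[ab ba]]; first by rewrite addr_ge0.
have [n /andP[n1 n2]] := reduce_mod_2pi a.
pose d : R := 2 * n%:~R * pi.
have FE := add2pi_int (fun x => Bc_add2pi x BF) n.
have -> : F b - F a = F (b - d) - F (a - d).
  have := FE (b - d); have := FE (a - d); rewrite /d !subrK => -> ->.
  by ring.
by rewrite (le_trans (ler_normB _ _))// lerD// HC//; rewrite /d; apply/andP; split; lra.
Qed.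

Lemma Ac_dderive_dfun F : Bc F -> Ac (dderive (dfun F)).
Proof.
move=> BF; split; first by apply: schwartz_dderive_dfun; exact: Bc_continuous.
by exists F.
Qed.

Lemma AcP f : Ac f -> exists2 F, Bc F & f = dderive (dfun F).
Proof. by move=> [_ [F [BF ->]]]; exists F. Qed.

(** Two primitives differ by a constant, which the normalization at -pi kills. *)
Lemma primitive_dderive_dfun F : Bc F -> primitive (dderive (dfun F)) = F.
Proof.
move=> BF; rewrite /primitive; case: xgetP => [G _ [BG FG]|/(_ F) []//].
apply/funext => x.
have := dderive_dfun_inj (Bc_continuous BF) (Bc_continuous BG) FG x (- pi).
case: BF BG => _ -> _ [_ -> _]; rewrite subrr => /eqP.
by rewrite subr_eq0 => /eqP ->.
Qed.

Lemma primitive_dreflect F x : Bc F ->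
  primitive (dreflect x (dderive (dfun F))) = fun t => F (x + pi) - F (x - t).
Proof.
move=> BF; rewrite (dreflect_dderive_dfun x (F (x + pi)))//; last exact: Bc_continuous.
by rewrite primitive_dderive_dfun//; exact: Bc_reflect.
Qed.

Lemma Alexiewicz_le F e : Bc F ->
  (forall a b, a <= b <= a + 2 * pi -> `|F b - F a| <= e) ->
  Alexiewicz (dderive (dfun F)) <= e.
Proof.
move=> BF He; apply: ge_sup; last first.
  move=> r [a [b [ab ->]]].
  by rewrite /cp_integral primitive_dderive_dfun//; exact: He.
exists 0, 0, 0; rewrite /cp_integral subrr normr0 lexx add0r mulr_ge0//.
exact: pi_ge0.
Qed.

Lemma le_Alexiewicz F a b : Bc F -> a <= b <= a + 2 * pi ->
  `|F b - F a| <= Alexiewicz (dderive (dfun F)).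
Proof.
move=> BF ab; apply: ub_le_sup; last first.
  by exists a, b; rewrite /cp_integral primitive_dderive_dfun.
have [C _ HC] := Bc_increment_bounded BF; exists C => r [c [d [cd ->]]].
by rewrite /cp_integral primitive_dderive_dfun//; exact: HC.
Qed.

Lemma Alexiewicz_ge0 F : Bc F -> 0 <= Alexiewicz (dderive (dfun F)).
Proof.
move=> BF; apply: le_trans (@le_Alexiewicz F 0 0 BF _); first by [].
by rewrite lexx add0r mulr_ge0// pi_ge0.
Qed.

End torus_primitives.

(** * Borel functions and the completed Lebesgue measure *)

Section completed_transfer.
Context {R : realType}.
Notation mu := (@lebesgue_measure R).
Notation cmu := (@completed_lebesgue_measure R).
Local Notation BT := (measurableTypeR R).
Local Notation CT := (caratheodory_type (wlength (@idfun R))^*%mu).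

Lemma borel_measurable_completed (D : set R) :
  measurable (D : set BT) -> measurable (D : set CT).
Proof. by move=> mD; exact: sub_caratheodory. Qed.

Lemma measurable_fun_completed (D : set R) d (T : measurableType d) (f : R -> T) :
  measurable (D : set BT) ->
  @measurable_fun _ _ BT T D f -> @measurable_fun _ _ CT T D f.
Proof.
by move=> mD mf _ A mA; apply: borel_measurable_completed; exact: mf.
Qed.

(** The Lebesgue measure is the image of its completion under the identity, seen
    as a measurable map from the completed to the Borel sigma-algebra. *)
Lemma integral_completed (D : set R) (f : R -> \bar R) :
  measurable (D : set BT) -> @measurable_fun _ _ BT (\bar R) D f ->
  (\int[cmu]_(x in D) f x = \int[mu]_(x in D) f x)%E.
Proof.
move=> mD.
have mid : @measurable_fun _ _ CT BT setT idfun.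
  by apply: measurable_fun_completed => //; exact: measurable_id.
have ge0_case (g : R -> \bar R) : @measurable_fun _ _ BT (\bar R) D g ->
    (forall x, (0 <= g x)%E) -> (\int[cmu]_(x in D) g x = \int[mu]_(x in D) g x)%E.
  move=> mg g0.
  transitivity (\int[pushforward cmu (idfun : CT -> BT)]_(x in D) g x)%E; last first.
    exact: eq_measure_integral.
  by rewrite (@ge0_integral_pushforward _ _ CT BT _ idfun mid cmu D g).
move=> mf; rewrite integralE [RHS]integralE; congr (_ - _)%E; apply: ge0_case => //.
- exact: measurable_funepos.
- exact: measurable_funeneg.
Qed.

Lemma Rintegral_completed (D : set R) (f : R -> R) :
  measurable (D : set BT) -> @measurable_fun _ _ BT R D f ->
  \int[cmu]_(x in D) f x = \int[mu]_(x in D) f x.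
Proof.
move=> mD mf; rewrite /Rintegral integral_completed//.
exact/measurable_EFinP.
Qed.

Lemma integrable_completed (D : set R) (f : R -> R) :
  measurable (D : set BT) -> mu.-integrable D (EFin \o f) ->
  cmu.-integrable D (EFin \o f).
Proof.
move=> mD /integrableP[mf fi]; apply/integrableP; split.
  exact: measurable_fun_completed.
by rewrite integral_completed//; exact: measurableT_comp.
Qed.

End completed_transfer.

(** * Riemann-Stieltjes integrals against functions of bounded variation *)

Section dominated_increments.
Context {R : realType}.
Implicit Types (F g T : R -> R) (a b x y e d L : R) (s : seq R) (t : nat -> R).

(** All that is used of a function of bounded variation: its increments are
    bounded by those of a monotone function, and the latter telescope along any
    partition. *)
Definition dominated_increments g T a b :=
  forall x y, a <= x -> x <= y -> y <= b -> `|g y - g x| <= T y - T x.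

Lemma dominated_incrementsS g T a b c : a <= c ->
  dominated_increments g T a b -> dominated_increments g T c b.
Proof. by move=> ac H x y cx; apply: H; exact: le_trans cx. Qed.

Lemma dominated_increments_le g T a b x y : dominated_increments g T a b ->
  a <= x -> x <= y -> y <= b -> T x <= T y.
Proof. by move=> gT ax xy yb; rewrite -subr_ge0 (le_trans _ (gT _ _ ax xy yb)). Qed.

(** The total variation from the left endpoint dominates. *)
Lemma bounded_variation_dominated g a b : a <= b -> bounded_variation a b g ->
  exists T, dominated_increments g T a b.
Proof.
move=> ab BVg; exists (fun x => fine (total_variation a x g)) => x y ax xy yb /=.
have ay := le_trans ax xy.
have fy : total_variation a y g \is a fin_num.
  by apply/(bounded_variationP _ ay); exact: bounded_variationl BVg.
have fx : total_variation a x g \is a fin_num.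
  apply/(bounded_variationP _ ax).
  by apply: bounded_variationl BVg => //; exact: le_trans yb.
have := total_variationD g ax xy.
have [fxy|nfxy] := boolP (total_variation x y g \is a fin_num).
  move=> /(congr1 fine); rewrite fineD// => ->; rewrite addrAC subrr add0r.
  by rewrite -lee_fin fineK//; exact: total_variation_ge.
have := total_variation_ge0 g xy; move: nfxy fx fy.
by case: (total_variation x y g) => //; case: (total_variation a x g) => // r _ _ + _ E;
  rewrite E.
Qed.

Definition clamp a b x := Num.max a (Num.min b x).

Lemma clamp_itv a b x : a <= b -> a <= clamp a b x <= b.
Proof. by move=> ab; rewrite /clamp le_max lexx/= ge_max ab ge_min lexx. Qed.

Lemma clamp_id a b x : a <= x <= b -> clamp a b x = x.
Proof. by move=> /andP[ax xb]; rewrite /clamp (min_idPr xb) (max_idPr ax). Qed.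

Lemma clamp_le a b x y : x <= y -> clamp a b x <= clamp a b y.
Proof.
move=> xy; rewrite /clamp ge_max !le_max lexx/=.
by rewrite [X in _ || X](_ : _ = true) ?orbT//; apply: le_min2.
Qed.

(** Both T and T - g are nondecreasing on the interval, and become monotone on
    the line after clamping the argument. *)
Lemma dominated_measurable g T a b : a <= b -> dominated_increments g T a b ->
  @measurable_fun _ _ (measurableTypeR R) R `[a, b] g.
Proof.
move=> ab gT.
pose U1 x := T (clamp a b x); pose U2 x := T (clamp a b x) - g (clamp a b x).
have m1 : measurable_fun [set: measurableTypeR R] U1.
  apply: nondecreasing_measurable => // x y xy; apply: (dominated_increments_le gT).
  - by case/andP: (clamp_itv x ab).
  - exact: clamp_le.
  - by case/andP: (clamp_itv y ab).
have m2 : measurable_fun [set: measurableTypeR R] U2.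
  apply: nondecreasing_measurable => // x y xy.
  have [/andP[ax _] /andP[_ yb]] := (clamp_itv x ab, clamp_itv y ab).
  have := gT _ _ ax (clamp_le a b xy) yb.
  have := ler_norm (g (clamp a b y) - g (clamp a b x)); rewrite /U2; lra.
apply: (@eq_measurable_fun _ _ _ _ _ (fun x => U1 x - U2 x)).
  move=> x; rewrite inE/= in_itv/= => xab.
  by rewrite /U1 /U2 clamp_id// opprB addrC subrK.
by apply: measurable_funTS; exact: measurable_funB.
Qed.

Lemma dominated_bounded g T a b x : dominated_increments g T a b ->
  a <= x <= b -> `|g x| <= `|g a| + (T b - T a).
Proof.
move=> gT /andP[ax xb]; have := gT _ _ (lexx a) ax xb.
have := dominated_increments_le gT ax xb (lexx b).
have := ler_normD (g x - g a) (g a); rewrite subrK; lra.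
Qed.

Lemma RS_sum_cons F g a b h s t :
  RS_sum F g a b (h :: s) t = F (t 0%N) * (g h - g a) + RS_sum F g h b s (t \o S).
Proof. by rewrite /RS_sum /= big_nat_recl. Qed.

Lemma tagged_partition_cons a b h s t : tagged_partition a b (h :: s) t ->
  [/\ a < h, h <= b, a <= t 0%N <= h & tagged_partition h b s (t \o S)].
Proof.
move=> [abs Ht]; have hbs := itv_partition_cons abs; split.
- by case: abs => /= /andP[].
- exact: itv_partition_le hbs.
- exact: (Ht 0%N).
- by split => // i si; exact: (Ht i.+1).
Qed.

Lemma mesh_lt_cons a b h s d : mesh_lt a b (h :: s) d -> h - a < d /\ mesh_lt h b s d.
Proof. by move=> H; split; [exact: (H 0%N)|move=> i si; exact: (H i.+1)]. Qed.

Lemma RS_sum_le F g T a b e s t : dominated_increments g T a b ->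
  (forall x, a <= x <= b -> `|F x| <= e) -> tagged_partition a b s t ->
  `|RS_sum F g a b s t| <= e * (T b - T a).
Proof.
elim: s a t => [|h s ih] a t gT Fe.
  by move=> [/itv_partition_nil -> _]; rewrite /RS_sum big_nil normr0 subrr mulr0.
move=> /tagged_partition_cons[ah hb /andP[at0 t0h] hbs].
have gTh := dominated_incrementsS (ltW ah) gT.
have Feh x : h <= x <= b -> `|F x| <= e.
  by move=> /andP[hx xb]; apply: Fe; rewrite xb (le_trans (ltW ah)).
have := ih h _ gTh Feh hbs; rewrite RS_sum_cons => H.
rewrite (le_trans (ler_normD _ _))// normrM.
have -> : e * (T b - T a) = e * (T h - T a) + e * (T b - T h) by ring.
apply: lerD => //; apply: ler_pM => //.
  by apply: Fe; rewrite at0 (le_trans t0h).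
exact: gT (lexx a) (ltW ah) hb.
Qed.

Lemma RS_sumB F G g a b s t :
  RS_sum F g a b s t - RS_sum G g a b s t = RS_sum (fun x => F x - G x) g a b s t.
Proof. by rewrite /RS_sum -sumrB; apply: eq_bigr => i _; rewrite mulrBl. Qed.

(** Without partitions of arbitrarily small mesh every number would be a
    Riemann-Stieltjes integral, so this is what makes the integral unique. *)
Lemma fine_partition_exists a b d : a <= b -> 0 < d ->
  exists s t, tagged_partition a b s t /\ mesh_lt a b s d.
Proof.
move=> ab d0.
suff [s [abs ms]] : exists s, itv_partition a b s /\ mesh_lt a b s d.
  exists s, (fun i => nth b (a :: s) i); split => //; split => // i si.
  rewrite lexx/=; have [sa _] := abs.
  have sa' : sorted <%R (a :: s) by [].
  have E : (nth b (a :: s) i <= nth b (a :: s) i.+1) = (i <= i.+1)%N.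
    by apply: lt_sorted_leq_nth => //; rewrite inE/= ltnS// ltnW.
  by rewrite leqnSn in E; exact: E.
have [n] : exists n : nat, b - a <= n%:R * (d / 2).
  exists (Num.bound ((b - a) / (d / 2))).
  by rewrite -ler_pdivrMr ?divr_gt0// ltW// archi_boundP// divr_ge0 ?divr_ge0 ?subr_ge0// ltW.
elim: n a ab => [a ab|n ih a ab].
  rewrite mul0r subr_le0 => ba; have -> : a = b by apply/eqP; rewrite eq_le ab.
  by exists [::]; split => //; split => //=.
have [bd|bd] := leP (b - a) (d / 2).
  move=> _; have [->|ab'] := eqVneq a b.
    by exists [::]; split => //; split => //=.
  have {}ab' : a < b by rewrite lt_neqAle ab'.
  exists [:: b]; split; first exact: itv_partition1.
  by case=> //= _; rewrite (le_lt_trans bd)// ltr_pdivrMr// ltr_pMr// ltr1n.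
rewrite -natr1 => H; have d2 : 0 < d / 2 by rewrite divr_gt0.
have [||s [hbs ms]] := ih (a + d / 2); [by lra|by lra|].
exists (a + d / 2 :: s); split.
  by case: hbs => hs lb; split => //=; rewrite ltrDl d2.
by case=> [_|i si]; [rewrite /= addrAC subrr add0r; lra|exact: ms].
Qed.

Lemma is_RS_integral_dist F G g T a b e I J : a <= b ->
  dominated_increments g T a b ->
  (forall x, a <= x <= b -> `|F x - G x| <= e) ->
  is_RS_integral F g a b I -> is_RS_integral G g a b J ->
  `|I - J| <= e * (T b - T a).
Proof.
move=> ab gT FG HI HJ; apply/ler_addgt0Pr => z z0.
have z2 : 0 < z / 2 by rewrite divr_gt0.
have [d1 d10 H1] := HI _ z2; have [d2 d20 H2] := HJ _ z2.
have d0 : 0 < Num.min d1 d2 by rewrite lt_min d10.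
have [s [t [abs ms]]] := fine_partition_exists ab d0.
have m1 : mesh_lt a b s d1 by move=> i /ms; rewrite lt_min => /andP[].
have m2 : mesh_lt a b s d2 by move=> i /ms; rewrite lt_min => /andP[].
have := H1 _ _ abs m1; have := H2 _ _ abs m2.
have := RS_sum_le gT FG abs; rewrite -RS_sumB.
set SF := RS_sum F _ _ _ _ _; set SG := RS_sum G _ _ _ _ _ => h1 h2 h3.
have := ler_normD (I - SF) (SF - SG); have := ler_normD (I - SG) (SG - J).
rewrite !subrKA (distrC I SF); lra.
Qed.

Lemma is_RS_integral_unique F g T a b I J : a <= b ->
  dominated_increments g T a b ->
  is_RS_integral F g a b I -> is_RS_integral F g a b J -> I = J.
Proof.
move=> ab gT HI HJ; apply/eqP; rewrite -subr_eq0 -normr_le0.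
rewrite -(mul0r (T b - T a)); apply: is_RS_integral_dist HI HJ => // x _.
by rewrite subrr normr0.
Qed.

Lemma RS_integralE F g T a b I : a <= b -> dominated_increments g T a b ->
  is_RS_integral F g a b I -> RS_integral F g a b = I.
Proof.
move=> ab gT HI; rewrite /RS_integral; case: xgetP => [J _ HJ|/(_ I)//].
exact: is_RS_integral_unique ab gT HJ HI.
Qed.

(** Each approximation G within e, with integral J, confines the integral to
    the interval of center J and radius e times the variation. The supremum of
    the left ends of these intervals lies in all of them. *)
Lemma is_RS_integral_uniform_limit F g T a b : a <= b ->
  dominated_increments g T a b ->
  (forall e, 0 < e -> exists G J, (forall x, a <= x <= b -> `|F x - G x| <= e) /\
     is_RS_integral G g a b J) ->
  exists I, is_RS_integral F g a b I.
Proof.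
move=> ab gT H; pose V := T b - T a.
have V0 : 0 <= V by rewrite subr_ge0; exact: dominated_increments_le gT (lexx a) ab (lexx b).
(* The lower bounds for the integral. *)
pose A := [set r | exists e G J, [/\ 0 < e,
   forall x, a <= x <= b -> `|F x - G x| <= e, is_RS_integral G g a b J &
   r = J - e * V]].
have ubA e G J : 0 < e -> (forall x, a <= x <= b -> `|F x - G x| <= e) ->
    is_RS_integral G g a b J -> ubound A (J + e * V).
  move=> e0 FG HJ r [e' [G' [J' [e'0 FG' HJ' ->]]]].
  have GG x : a <= x <= b -> `|G' x - G x| <= e + e'.
    move=> xab; have := FG _ xab; have := FG' _ xab.
    have := ler_normD (G' x - F x) (F x - G x); rewrite subrKA (distrC (G' x) (F x)); lra.
  have := is_RS_integral_dist ab gT GG HJ' HJ; rewrite -/V mulrDl.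
  by have := ler_norm (J' - J); lra.
have [G1 [J1 [FG1 HJ1]]] := H 1 ltr01.
have A0 : A !=set0 by exists (J1 - 1 * V), 1, G1, J1.
have uA : has_ubound A by exists (J1 + 1 * V); exact: ubA ltr01 FG1 HJ1.
exists (sup A) => z z0.
pose e := z / (2 * (1 + 2 * V)).
have V12 : 0 < 1 + 2 * V by rewrite ltr_pwDl// mulr_ge0.
have e0 : 0 < e by rewrite divr_gt0// mulr_gt0.
have ez : e * (1 + 2 * V) = z / 2.
  by rewrite /e; field; rewrite gt_eqF.
have [G [J [FG HJ]]] := H _ e0; have [d d0 Hd] := HJ _ e0; exists d => // s t abs ms.
have h1 : J - e * V <= sup A by apply: ub_le_sup => //; exists e, G, J.
have h2 : sup A <= J + e * V by apply: ge_sup => //; exact: ubA e0 FG HJ.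
have h3 := Hd _ _ abs ms.
have h4 := RS_sum_le gT FG abs; rewrite -RS_sumB -/V in h4.
set SF := RS_sum F _ _ _ _ _ in h4 *; set SG := RS_sum G _ _ _ _ _ in h3 h4.
have h5 : `|J - sup A| <= e * V by rewrite ler_norml; apply/andP; split; lra.
have := ler_normD (SF - SG) (SG - J); have := ler_normD (SF - J) (J - sup A).
rewrite !subrKA => h6 h7.
have : e + 2 * (e * V) = z / 2 by rewrite -ez; ring.
lra.
Qed.

End dominated_increments.

(** * Integration by parts for Riemann-Stieltjes integrals *)

Section RS_continuously_differentiable.
Context {R : realType}.
Implicit Types (F f g T : R -> R) (a b c x y e d L w : R) (s : seq R) (t : nat -> R).
Notation mu := (@lebesgue_measure R).
Notation cmu := (@completed_lebesgue_measure R).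
Local Notation BT := (measurableTypeR R).
Local Notation CT := (caratheodory_type (wlength (@idfun R))^*%mu).

Lemma measurable_itv_completed (i : interval R) : measurable ([set` i] : set CT).
Proof. by apply: borel_measurable_completed; exact: measurable_itv. Qed.

Lemma completed_measure_itv x y : x <= y -> cmu `]x, y] = (y - x)%:E.
Proof.
move=> xy; rewrite [LHS](lebesgue_measure_itv `]x, y])/= lte_fin.
by move: xy; rewrite le_eqVlt => /predU1P[->|->//]; rewrite ltxx subrr.
Qed.

Lemma Rintegral_completed_obnd_cbnd a b f : a <= b -> cmu.-integrable `[a, b] (EFin \o f) ->
  \int[cmu]_(x in `[a, b]) f x = \int[cmu]_(x in `]a, b]) f x.
Proof.
move=> ab fi; have E : [set` `[a, b]] = [set` `[a, a]] `|` [set` `]a, b]].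
  by rewrite -itv_bndbnd_setU// bnd_simp.
rewrite E Rintegral_setU//=.
- rewrite {1}/Rintegral null_set_integral ?add0r//.
  + exact: measurable_itv_completed.
  + apply: (measurable_funS _ _ (measurable_int _ fi)).
      exact: measurable_itv_completed.
    by apply: subset_itvl; rewrite bnd_simp.
  + by rewrite set_itv1; exact: (lebesgue_measure_set1 a).
- exact: measurable_itv_completed.
- exact: measurable_itv_completed.
- by rewrite -E.
- apply/disj_setPS => y [/=]; rewrite !in_itv/= => /andP[_ ya] /andP[].
  by rewrite ltNge ya.
Qed.

Lemma Rintegral_completed_split a b c f : a <= b -> b <= c ->
  cmu.-integrable `]a, c] (EFin \o f) ->
  \int[cmu]_(x in `]a, c]) f x =
  \int[cmu]_(x in `]a, b]) f x + \int[cmu]_(x in `]b, c]) f x.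
Proof.
move=> ab bc fi; have E : [set` `]a, c]] = [set` `]a, b]] `|` [set` `]b, c]].
  by rewrite -itv_bndbnd_setU// bnd_simp.
rewrite E Rintegral_setU//=.
- exact: measurable_itv_completed.
- exact: measurable_itv_completed.
- by rewrite -E.
- apply/disj_setPS => y [/=]; rewrite !in_itv/= => /andP[_ ya] /andP[].
  by rewrite ltNge ya.
Qed.

Lemma continuous_integrable_completed a b f : continuous f ->
  cmu.-integrable `[a, b] (EFin \o f).
Proof.
by move=> cf; apply: integrable_completed => //; exact: continuous_integrable_itv.
Qed.

Lemma integrable_completedS a b x y (bx by' : bool) f : a <= x -> y <= b ->
  cmu.-integrable `[a, b] (EFin \o f) ->
  cmu.-integrable [set` Interval (BSide bx x) (BSide by' y)] (EFin \o f).
Proof.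
move=> ax yb; apply: integrableS.
- exact: measurable_itv_completed.
- exact: measurable_itv_completed.
- apply: subset_itv; rewrite bnd_simp//; by case: bx by' => -[].
Qed.

Lemma completed_FTC F f a b : a <= b -> continuous f ->
  (forall x, is_derive x 1 F (f x)) -> \int[cmu]_(x in `]a, b]) f x = F b - F a.
Proof.
move=> ab cf dF; rewrite -Rintegral_completed_obnd_cbnd//; last first.
  exact: continuous_integrable_completed.
rewrite Rintegral_completed//; first exact: Rintegral_FTC.
exact: measurable_funTS (continuous_measurable_fun cf).
Qed.

Lemma dominated_mul_integrable f g T a b : a <= b -> continuous f ->
  dominated_increments g T a b ->
  cmu.-integrable `[a, b] (EFin \o (fun x => f x * g x)).
Proof.
move=> ab cf gT; apply: integrable_completed => //.
have mfg : @measurable_fun _ _ BT R `[a, b] (fun x => f x * g x).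
  apply: measurable_funM; last exact: dominated_measurable gT.
  exact: measurable_funTS (continuous_measurable_fun cf).
apply: measurable_bounded_integrable => //.
  by apply: compact_finite_measure; exact: segment_compact.
have [C C0 HC] := continuous_bounded_itv a b cf.
exists (C * (`|g a| + (T b - T a))); split; first exact: num_real.
move=> M HM x; rewrite /= in_itv/= => xab; apply: le_trans (ltW HM).
rewrite normrM; apply: ler_pM => //; first exact: HC.
exact: dominated_bounded gT xab.
Qed.

Lemma FTC_mul_error F f g a b x y c L w : a <= x -> x <= y -> y <= b ->
  continuous f -> (forall x, is_derive x 1 F (f x)) ->
  cmu.-integrable `[a, b] (EFin \o (fun x => f x * g x)) ->
  (forall z, x <= z <= y -> `|f z| <= L) ->
  (forall z, x <= z <= y -> `|c - g z| <= w) ->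
  `|(F y - F x) * c - \int[cmu]_(z in `]x, y]) (f z * g z)| <= L * w * (y - x).
Proof.
move=> ax xy yb cf dF fgi fL gw.
have mxy : measurable ([set` `]x, y]] : set CT) by exact: measurable_itv_completed.
have fi : cmu.-integrable `]x, y] (EFin \o f).
  apply: (@integrable_completedS a b) => //; exact: continuous_integrable_completed.
have fgi' : cmu.-integrable `]x, y] (EFin \o (fun z => f z * g z)).
  exact: (@integrable_completedS a b).
have fci : cmu.-integrable `]x, y] (EFin \o (fun z => f z * c)).
  apply: (@integrable_completedS a b) => //; apply: continuous_integrable_completed.
  by apply: continuous_mulf => // ?; exact: cvg_cst.
rewrite -(completed_FTC xy cf dF) -RintegralZr// -RintegralB//.
have di : cmu.-integrable `]x, y] (EFin \o (fun z => f z * c - f z * g z)).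
  by have := integrableB mxy fci fgi'; apply: eq_integrable.
rewrite (le_trans (le_normr_Rintegral _ _))//.
have -> : L * w * (y - x) = \int[cmu]_(z in `]x, y]) (L * w).
  rewrite Rintegral_cst//; congr (_ * _).
  exact/esym/(congr1 fine (completed_measure_itv xy)).
apply: le_Rintegral => //.
- exact: integrable_norm di.
- apply: (@integrable_completedS a b) => //; apply: continuous_integrable_completed.
  by move=> ?; exact: cvg_cst.
- move=> z; rewrite /= in_itv/= => /andP[xz zy].
  have xsy : x <= z <= y by rewrite (ltW xz).
  by rewrite -mulrBr normrM ler_pM// ?fL ?gw.
Qed.

(** On each piece of the partition, split at its tag, the integral of f g differs
    from an increment of F times an end value of g by at most the oscillation of
    g on the piece, which T bounds. *)
Lemma RS_sum_differentiable_error F f g T a b L d s t :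
  continuous f -> (forall x, is_derive x 1 F (f x)) ->
  dominated_increments g T a b -> 0 <= d ->
  (forall x, a <= x <= b -> `|f x| <= L) ->
  tagged_partition a b s t -> mesh_lt a b s d ->
  `|F b * g b - F a * g a - \int[cmu]_(x in `]a, b]) (f x * g x)
    - RS_sum F g a b s t| <= L * d * (T b - T a).
Proof.
move=> cf dF + d0; elim: s a t => [|h s ih] a t gT fL.
  move=> [/itv_partition_nil -> _] _; rewrite /RS_sum big_nil !subrr mulr0 set_itvoc0.
  by rewrite Rintegral_set0 !subr0 normr0.
move=> /[dup] abs0 /tagged_partition_cons[ah hb /andP[at0 t0h] hbs].
move=> /mesh_lt_cons[had ms].
have ab := le_trans (ltW ah) hb.
have fgi := dominated_mul_integrable ab cf gT.
have gTh := dominated_incrementsS (ltW ah) gT.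
have fLh x : h <= x <= b -> `|f x| <= L.
  by move=> /andP[hx xb]; apply: fL; rewrite xb (le_trans (ltW ah)).
have := ih h _ gTh fLh hbs ms; rewrite RS_sum_cons.
have fgi' : cmu.-integrable `]a, b] (EFin \o (fun x => f x * g x)).
  exact: (@integrable_completedS a b).
rewrite (Rintegral_completed_split (ltW ah) hb fgi').
rewrite (@Rintegral_completed_split a (t 0%N) h)//; last first.
  exact: (@integrable_completedS a b).
have L0 : 0 <= L by rewrite (le_trans _ (fL a _)) ?lexx.
have Tah : 0 <= T h - T a by rewrite subr_ge0 (dominated_increments_le gT (lexx a) (ltW ah) hb).
have e1 : `|(F (t 0%N) - F a) * g a - \int[cmu]_(x in `]a, (t 0%N)]) (f x * g x)|
    <= L * (T h - T a) * (t 0%N - a).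
  apply: (@FTC_mul_error F f g a b) => //; first exact: le_trans hb.
  - by move=> x /andP[ax xt]; apply: fL; rewrite ax (le_trans xt)// (le_trans t0h).
  - move=> x /andP[ax xt]; rewrite distrC.
    have xh := le_trans xt t0h.
    rewrite (le_trans (gT _ _ (lexx a) ax (le_trans xh hb)))// lerB//.
    exact: dominated_increments_le gT ax xh hb.
have e2 : `|(F h - F (t 0%N)) * g h - \int[cmu]_(x in `](t 0%N), h]) (f x * g x)|
    <= L * (T h - T a) * (h - t 0%N).
  apply: (@FTC_mul_error F f g a b) => //.
  - by move=> x /andP[ax xt]; apply: fL; rewrite (le_trans at0 ax) (le_trans xt).
  - move=> x /andP[tx xh].
    rewrite (le_trans (gT _ _ (le_trans at0 tx) xh hb))// lerB//.
    exact: dominated_increments_le gT (lexx a) (le_trans at0 tx) (le_trans xh hb).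
set I1 := \int[cmu]_(x in `]a, t 0%N]) _ in e1 *.
set I2 := \int[cmu]_(x in `]t 0%N, h]) _ in e2 *.
set I3 := \int[cmu]_(x in `]h, b]) _; set S' := RS_sum _ _ _ _ _ _ => e3.
have -> : F b * g b - F a * g a - (I1 + I2 + I3) - (F (t 0%N) * (g h - g a) + S') =
  ((F (t 0%N) - F a) * g a - I1) + ((F h - F (t 0%N)) * g h - I2) +
  (F b * g b - F h * g h - I3 - S') by ring.
rewrite (le_trans (ler_normD _ _))//.
have -> : L * d * (T b - T a) = L * d * (T h - T a) + L * d * (T b - T h) by ring.
apply: lerD => //; rewrite (le_trans (ler_normD _ _))// (le_trans (lerD e1 e2))//.
have -> : L * (T h - T a) * (t 0%N - a) + L * (T h - T a) * (h - t 0%N) =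
  L * (h - a) * (T h - T a) by ring.
by rewrite ler_wpM2r// ler_wpM2l// ltW.
Qed.

(** Riemann-Stieltjes sums of a continuously differentiable integrand converge
    by a direct estimate on each piece, with no common refinement of partitions. *)
Lemma is_RS_integral_differentiable F f g T a b : a <= b ->
  continuous f -> (forall x, is_derive x 1 F (f x)) ->
  dominated_increments g T a b ->
  is_RS_integral F g a b
    (F b * g b - F a * g a - \int[cmu]_(x in `[a, b]) (f x * g x)).
Proof.
move=> ab cf dF gT e e0.
have fgi := dominated_mul_integrable ab cf gT.
rewrite (Rintegral_completed_obnd_cbnd ab fgi).
have [L L0 fL] := continuous_bounded_itv a b cf.
have V0 : 0 <= T b - T a.
  by rewrite subr_ge0 (dominated_increments_le gT (lexx a) ab (lexx b)).
have LV : 0 < L * (T b - T a) + 1 by rewrite ltr_wpDl// mulr_ge0.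
exists (e / (L * (T b - T a) + 1)); first by rewrite divr_gt0.
move=> s t abs ms.
have := RS_sum_differentiable_error cf dF gT _ fL abs ms.
move=> /(_ (ltW (divr_gt0 e0 LV))); rewrite distrC => /le_lt_trans; apply.
rewrite mulrAC mulrA ltr_pdivrMr// mulrC ltr_pM2l// ltrDl//.
Qed.

End RS_continuously_differentiable.

(** * The primitive of a convolution *)

Section uniform_continuity.
Context {R : realType}.
Implicit Types (H K : R -> R) (a b c x y e d : R).

(** Stated with one point in the compact interval and the other anywhere, the
    form that the reduction modulo a period needs. *)
Lemma heine_cantor H a b e : continuous H -> 0 < e ->
  exists2 d, 0 < d & forall x y, a <= x <= b -> `|y - x| < d -> `|H y - H x| <= e.
Proof.
move=> cH e0.
pose P d x := forall y, `|y - x| < d -> `|H y - H x| <= e.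
have cov : near_covering `[a, b]%classic.
  by apply/compact_near_coveringP; exact: segment_compact.
have key : \forall d \near 0^'+, `[a, b]%classic `<=` P d.
  apply: cov => x _.
  have e2 : 0 < e / 2 by rewrite divr_gt0.
  have /cvgrPdist_lt/(_ _ e2)/nbhs_ballP[d /= d0 Hd] := cH x.
  have d2 : 0 < d / 2 by rewrite divr_gt0.
  exists (ball x (d / 2), [set r | 0 < r < d / 2]) => /=.
    split; first by exists (d / 2).
    near=> r; apply/andP; split; near: r; first exact: nbhs_right_gt.
    exact: nbhs_right_lt.
  move=> [x' r] /= [x'x /andP[r0 rd]] y yx'.
  rewrite /ball/= in x'x.
  have h1 := Hd x'; rewrite /ball/= in h1.
  have h2 := Hd y; rewrite /ball/= in h2.
  have x'd : `|x - x'| < d by lra.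
  have yd : `|x - y| < d.
    have := ler_normD (x - x') (x' - y); rewrite subrKA (distrC x' y); lra.
  have := h1 x'd; have := h2 yd.
  have := ler_normD (H y - H x) (H x - H x'); rewrite subrKA (distrC (H y) (H x)).
  lra.
near (0:R)^'+ => d; exists d; first by near: d; exact: nbhs_right_gt.
move=> x y xab yx; have Pd : `[a, b]%classic `<=` P d by near: d.
by apply: (Pd x) => //=; rewrite in_itv.
Unshelve. all: by end_near. Qed.

Lemma quasiperiodic_unif_continuous H c e : continuous H ->
  (forall x, H (x + 2 * pi) = H x + c) -> 0 < e ->
  exists2 d, 0 < d & forall x y, `|y - x| < d -> `|H y - H x| <= e.
Proof.
move=> cH HE e0; have [d d0 Hd] := heine_cantor (- pi) pi cH e0.
exists d => // x y yx; have [n /andP[n1 n2]] := reduce_mod_2pi x.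
pose p : R := 2 * n%:~R * pi.
have E z : H z = H (z - p) + n%:~R * c by rewrite -(add2pi_int HE) subrK.
have -> : H y - H x = H (y - p) - H (x - p) by rewrite (E y) (E x); ring.
apply: Hd; first by rewrite n1 ltW.
by rewrite (_ : y - p - (x - p) = y - x)//; ring.
Qed.

(** The mean value theorem for K minus the linear function of slope c. *)
Lemma increment_le_derivative K H c e x h : (forall x, is_derive x 1 K (H x)) ->
  (forall y, `|y - x| <= `|h| -> `|H y - c| <= e) ->
  `|K (x + h) - K x - h * c| <= e * `|h|.
Proof.
move=> dK He; pose Q (z : R) : R := K z - z * c.
have dQ (z : R) : is_derive z (1 : R) Q (H z - c).
  have d2 : is_derive z (1 : R) (fun t : R => t * c) c.
    under eq_fun do rewrite mulrC.
    rewrite -[X in is_derive _ _ _ X]mulr1; apply: is_derive_scalef.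
  exact: is_derive_subf.
have cQ a b : {within `[a, b], continuous Q}.
  by apply: continuous_subspaceT => z; exact: is_derive_continuous (dQ z).
have -> : K (x + h) - K x - h * c = Q (x + h) - Q x by rewrite /Q; ring.
have [h0|h0|<-] := ltgtP 0 h; last by rewrite addr0 subrr !normr0 mulr0.
- have xh : x < x + h by rewrite ltrDl.
  have [z] := MVT xh (fun z _ => dQ z) (cQ _ _).
  rewrite in_itv/= => /andP[xz zh] ->; rewrite normrM addrAC subrr add0r.
  apply: ler_wpM2r => //; apply: He.
  by rewrite !ger0_norm; lra.
- have xh : x + h < x by rewrite gtrDl.
  have [z] := MVT xh (fun z _ => dQ z) (cQ _ _).
  rewrite in_itv/= => /andP[xz zh]; rewrite distrC => ->; rewrite normrM opprD addrA subrr sub0r normrN.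
  apply: ler_wpM2r => //; apply: He.
  by rewrite ler0_norm ?ltr0_norm; lra.
Qed.

End uniform_continuity.

Section convolution_primitive.
Context {R : realType}.
Implicit Types (H K g f : R -> R) (a b c x y e d : R).
Notation cmu := (@completed_lebesgue_measure R).
Local Notation BT := (measurableTypeR R).
Local Notation CT := (caratheodory_type (wlength (@idfun R))^*%mu).

Definition integrable_period g := cmu.-integrable `[(- pi), pi] (EFin \o g).

(** The primitive, vanishing at -pi, of the convolution of the derivative of H
    with g. *)
Definition conv_primitive H g x :=
  \int[cmu]_(t in `[(- pi), pi]) ((H (x - t) - H (- pi - t)) * g t).

Lemma measurable_period : measurable (`[(- pi), pi] : set CT).
Proof. exact: measurable_itv_completed. Qed.
Hint Resolve measurable_period : core.

Lemma continuous_mul_integrable f g : continuous f -> integrable_period g ->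
  integrable_period (fun t => f t * g t).
Proof.
move=> cf gi; have := @integrableMr _ CT R cmu _ measurable_period f (EFin \o g).
move=> H; apply: H => //.
  apply: measurable_fun_completed => //.
  exact: measurable_funTS (continuous_measurable_fun cf).
have [C C0 HC] := continuous_bounded_itv (- pi) pi cf.
exists C; split; first exact: num_real.
by move=> M CM x; rewrite /= in_itv/= => /HC/le_trans; apply; exact: ltW.
Qed.

(** The case p = 1 of the Hoelder inequality behind all norm estimates for
    convolutions. *)
Lemma Rintegral_mul_le f g C : continuous f -> integrable_period g ->
  (forall t, - pi <= t <= pi -> `|f t| <= C) ->
  `|\int[cmu]_(t in `[(- pi), pi]) (f t * g t)| <=
    C * \int[cmu]_(t in `[(- pi), pi]) `|g t|.
Proof.
move=> cf gi fC; have fgi := continuous_mul_integrable cf gi.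
have ni := integrable_norm gi.
rewrite (le_trans (le_normr_Rintegral _ _))// -RintegralZl//.
apply: le_Rintegral => //.
- exact: integrable_norm fgi.
- have := @integrableZl _ CT R cmu _ measurable_period C _ ni.
  by apply: eq_integrable.
- by move=> t; rewrite /= in_itv/= => tp; rewrite normrM ler_wpM2r// fC.
Qed.

Lemma continuous_kernel H x y : continuous H -> continuous (fun t => H (x - t) - H (y - t)).
Proof. by move=> cH; apply: continuous_subf; exact: continuous_reflectf. Qed.

Lemma conv_primitiveB H g x y : continuous H -> integrable_period g ->
  conv_primitive H g y - conv_primitive H g x =
  \int[cmu]_(t in `[(- pi), pi]) ((H (y - t) - H (x - t)) * g t).
Proof.
move=> cH gi; rewrite /conv_primitive -RintegralB//.
- by apply: eq_Rintegral => t _; ring.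
- by apply: continuous_mul_integrable => //; exact: continuous_kernel.
- by apply: continuous_mul_integrable => //; exact: continuous_kernel.
Qed.

Lemma conv_primitive_subr H g g' x : continuous H ->
  integrable_period g -> integrable_period g' ->
  conv_primitive H g x - conv_primitive H g' x =
  conv_primitive H (fun t => g t - g' t) x.
Proof.
move=> cH gi gi'; rewrite /conv_primitive -RintegralB//.
- by apply: eq_Rintegral => t _; ring.
- by apply: continuous_mul_integrable => //; exact: continuous_kernel.
- by apply: continuous_mul_integrable => //; exact: continuous_kernel.
Qed.

(** Continuity comes from the uniform continuity of H. Translating by a period
    adds the same constant to all values of H, hence a constant to the integral. *)
Lemma Bc_conv_primitive H g : Bc H -> integrable_period g ->
  Bc (conv_primitive H g).
Proof.
move=> BH gi; have cH := Bc_continuous BH.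
pose N := \int[cmu]_(t in `[(- pi), pi]) `|g t|.
have N0 : 0 <= N by exact: Rintegral_ge0.
apply: Bc_intro.
- move=> x; apply/cvgrPdist_le => e e0.
  have N1 : 0 < N + 1 by rewrite ltr_wpDl.
  have [d d0 Hd] := quasiperiodic_unif_continuous cH (fun x => Bc_add2pi x BH) (divr_gt0 e0 N1).
  apply/nbhs_ballP; exists d => // y; rewrite /ball/= => yx.
  rewrite conv_primitiveB//.
  apply: le_trans (Rintegral_mul_le (C := e / (N + 1)) _ gi _) _.
  + exact: continuous_kernel.
  + by move=> t _; apply: Hd; rewrite opprB addrA subrK.
  + by rewrite -/N mulrAC ler_pdivrMr// ler_wpM2l ?(ltW e0)// lerDl.
- rewrite /conv_primitive -[RHS](mul0r (fine (cmu `[(- pi), pi]))) -Rintegral_cst//.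
  by apply: eq_Rintegral => t _; rewrite subrr mul0r.
- move=> x; apply: (addIr (- conv_primitive H g x)).
  rewrite [RHS]addrAC subrr add0r.
  rewrite conv_primitiveB//; apply: eq_Rintegral => t _; congr (_ * _).
  have := Bc_add2pi (x - t) BH; have := Bc_add2pi (- pi - t) BH.
  have -> : x - t + 2 * pi = x + 2 * pi - t by ring.
  have -> : - pi - t + 2 * pi = pi - t by ring.
  by move=> -> ->; ring.
Qed.

End convolution_primitive.

(** * Convolution with a function of bounded variation *)

Section convolution_with_BV.
Context {R : realType}.
Implicit Types (H K g f T : R -> R) (a b c x y e d I J : R).
Notation cmu := (@completed_lebesgue_measure R).
Local Notation CT := (caratheodory_type (wlength (@idfun R))^*%mu).

Lemma Npi_le_pi : - pi <= pi :> R.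
Proof. by have := pi_ge0 R; lra. Qed.

Lemma BVT_dominated g : BVT g -> exists T, dominated_increments g T (- pi) pi.
Proof. by move=> [_ bg]; apply: bounded_variation_dominated => //; exact: Npi_le_pi. Qed.

Lemma BVT_endpoints g : BVT g -> g (- pi) = g pi.
Proof. by move=> [pg _]; rewrite -[LHS]pg; congr g; ring. Qed.

Lemma BVT_integrable g : BVT g -> integrable_period g.
Proof.
move=> /BVT_dominated[T gT]; have c1 : continuous (fun _ : R => 1 : R).
  by move=> ?; exact: cvg_cst.
have := dominated_mul_integrable Npi_le_pi c1 gT.
by apply: eq_integrable => [|x _]; [exact: measurable_itv_completed|rewrite /= mul1r].
Qed.

Lemma is_RS_integralB f F g a b I J :
  is_RS_integral f g a b I -> is_RS_integral F g a b J ->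
  is_RS_integral (fun t => f t - F t) g a b (I - J).
Proof.
move=> HI HJ e e0; have e2 : 0 < e / 2 by rewrite divr_gt0.
have [d1 d10 H1] := HI _ e2; have [d2 d20 H2] := HJ _ e2.
exists (Num.min d1 d2); first by rewrite lt_min d10.
move=> s t abs ms.
have m1 : mesh_lt a b s d1 by move=> i /ms; rewrite lt_min => /andP[].
have m2 : mesh_lt a b s d2 by move=> i /ms; rewrite lt_min => /andP[].
have := H1 _ _ abs m1; have := H2 _ _ abs m2; rewrite -RS_sumB.
set SF := RS_sum _ _ _ _ _ _; set SG := RS_sum _ _ _ _ _ _ => h1 h2.
have -> : SG - SF - (I - J) = (SG - I) - (SF - J) by ring.
by have := ler_normB (SG - I) (SF - J); lra.
Qed.

(** Here K is a primitive of H, so that the integrand is continuously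
    differentiable and integration by parts turns the integral against dg into a
    difference quotient of conv_primitive. *)
Lemma difference_quotient_RS H K g T y h :
  continuous H -> (forall x, is_derive x 1 K (H x)) -> BVT g ->
  dominated_increments g T (- pi) pi ->
  let F t := h^-1 * (K (y + h - t) - K (y - t)) in
  is_RS_integral F g (- pi) pi
   ((F pi - F (- pi)) * g pi + h^-1 * (conv_primitive H g (y + h) - conv_primitive H g y)).
Proof.
move=> cH dK Bg gT F.
pose f t := h^-1 * (- H (y + h - t) - - H (y - t)).
have dF x : is_derive x 1 F (f x).
  by apply: is_derive_scalef; apply: is_derive_subf; exact: is_derive_reflectf.
have cf : continuous f.
  apply: continuous_mulf; first by move=> ?; exact: cvg_cst.
  by apply: continuous_subf => x; apply: cvgN; exact: continuous_reflectf.
have := is_RS_integral_differentiable Npi_le_pi cf dF gT.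
rewrite (BVT_endpoints Bg) conv_primitiveB//; last exact: BVT_integrable.
set A := (X in is_RS_integral _ _ _ _ X -> _); set B := (X in _ -> is_RS_integral _ _ _ _ X).
suff -> : A = B by [].
rewrite /A /B mulrBl; congr (_ + _); rewrite -RintegralZl//.
- rewrite -[LHS]mulN1r -RintegralZl//.
  + by apply: eq_Rintegral => t _; rewrite /f; ring.
  + exact: measurable_itv_completed.
  + by apply: continuous_mul_integrable => //; exact: BVT_integrable.
- exact: measurable_itv_completed.
- apply: continuous_mul_integrable; last exact: BVT_integrable.
  exact: continuous_kernel.
Qed.

(** The difference quotients of a primitive of H converge to H uniformly on the
    line. In one direction this gives the Riemann-Stieltjes integral of a merely
    continuous integrand, in the other the derivative of conv_primitive. *)
Lemma RS_translate_limit H g T y : Bc H -> BVT g ->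
  dominated_increments g T (- pi) pi ->
  exists2 I, is_RS_integral (fun t => H (y - t)) g (- pi) pi I &
    is_derive y 1 (conv_primitive H g) (H pi * g pi + I).
Proof.
move=> BH Bg gT; have cH := Bc_continuous BH.
have [K dK] := antiderivative_exists cH.
pose F h t := h^-1 * (K (y + h - t) - K (y - t)).
have near_F e : 0 < e -> exists2 d, 0 < d & forall h, `|h| < d -> h != 0 ->
    forall t, `|H (y - t) - F h t| <= e.
  move=> e0; have [d d0 Hd] := quasiperiodic_unif_continuous cH (fun x => Bc_add2pi x BH) e0.
  exists d => // h hd h0 t.
  have := @increment_le_derivative R K H (H (y - t)) e (y - t) h dK.
  have -> : y - t + h = y + h - t by ring.
  move=> /(_ _)H1; rewrite distrC /F.
  have -> : h^-1 * (K (y + h - t) - K (y - t)) - H (y - t) =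
     h^-1 * (K (y + h - t) - K (y - t) - h * H (y - t)) by field.
  rewrite normrM normfV mulrC ler_pdivrMr ?normr_gt0//; apply: H1.
  by move=> z zh; apply: Hd; exact: le_lt_trans hd.
have [I HI] : exists I, is_RS_integral (fun t => H (y - t)) g (- pi) pi I.
  apply: (is_RS_integral_uniform_limit Npi_le_pi gT) => e e0.
  have [d d0 Hd] := near_F e e0.
  have d2 : 0 < d / 2 by rewrite divr_gt0.
  exists (F (d / 2)); eexists; split.
    move=> t _; apply: Hd; last by rewrite gt_eqF.
    by rewrite gtr0_norm//; lra.
  exact: difference_quotient_RS gT.
exists I => //; apply: is_derive_eps => e e0.
pose V := T pi - T (- pi).
have V0 : 0 <= V by rewrite subr_ge0 (dominated_increments_le gT (lexx _) Npi_le_pi (lexx _)).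
have D0 : 0 < V + 2 * `|g pi| + 1 by rewrite ltr_wpDl// addr_ge0// mulr_ge0.
pose e' := e / (V + 2 * `|g pi| + 1).
have e'0 : 0 < e' by rewrite divr_gt0.
have [d d0 Hd] := near_F e' e'0; exists d => // h hd h0.
have FH := Hd h hd h0.
have HJ := difference_quotient_RS y h cH dK Bg gT; rewrite -/(F h) in HJ.
have := is_RS_integral_dist Npi_le_pi gT (fun t _ => FH t) HI HJ; rewrite -/V.
set DP := conv_primitive H g (y + h) - _ => IJ.
have H2 : H (y - - pi) = H (y - pi) + H pi.
  by rewrite -(Bc_add2pi _ BH); congr H; ring.
have F1 := FH pi; have F2 := FH (- pi); rewrite H2 in F2.
(* The boundary terms tend to - H pi = H (y - pi) - H (y + pi). *)
pose X := F h pi - F h (- pi) + H pi.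
have X2 : `|X| <= 2 * e'.
  have -> : X = - (H (y - pi) - F h pi) + (H (y - pi) + H pi - F h (- pi)) by rewrite /X; ring.
  rewrite (le_trans (ler_normD _ _))// normrN; lra.
have -> : DP - h * (H pi * g pi + I) =
  h * ((F h pi - F h (- pi)) * g pi + h^-1 * DP - I - X * g pi) by rewrite /X; field.
rewrite normrM mulrC ler_wpM2r//.
rewrite (le_trans (ler_normB _ _))// normrM (distrC _ I).
have H3 : `|X| * `|g pi| <= 2 * e' * `|g pi| by rewrite ler_wpM2r.
have H4 : e' * (V + 2 * `|g pi| + 1) = e by rewrite /e' mulfVK// gt_eqF.
rewrite (le_trans (lerD IJ H3))// -H4; have := e'0; nra.
Qed.

(** The primitive of the reflected distribution is a constant minus a reflection
    of H, and constants integrate to zero against a periodic g. *)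
Lemma convBV_eq H g T y I : Bc H -> BVT g -> dominated_increments g T (- pi) pi ->
  is_RS_integral (fun t => H (y - t)) g (- pi) pi I ->
  convBV (dderive (dfun H)) g y = H pi * g pi + I.
Proof.
move=> BH Bg gT HI; rewrite /convBV /cp_integral_mul primitive_dreflect//.
have cc : continuous (fun _ : R => 0 : R) by move=> ?; exact: cvg_cst.
have := is_RS_integral_differentiable (F := fun=> H (y + pi)) Npi_le_pi cc
  (fun x => is_derive_cst _ _ _) gT.
move=> /is_RS_integralB/(_ HI)/(RS_integralE Npi_le_pi gT) ->.
rewrite (BVT_endpoints Bg) subrr.
under eq_Rintegral do rewrite mul0r.
rewrite Rintegral_cst; last exact: measurable_itv_completed.
have -> : y + pi = y - pi + 2 * pi by ring.
by rewrite Bc_add2pi//; ring.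
Qed.

Lemma is_derive_conv_primitive H g y : Bc H -> BVT g ->
  is_derive y 1 (conv_primitive H g) (convBV (dderive (dfun H)) g y).
Proof.
move=> BH Bg; have [T gT] := BVT_dominated Bg.
have [I HI] := RS_translate_limit y BH Bg gT.
by rewrite (convBV_eq BH Bg gT HI).
Qed.

Lemma continuous_convBV H g : Bc H -> BVT g -> continuous (convBV (dderive (dfun H)) g).
Proof.
move=> BH Bg; have [T gT] := BVT_dominated Bg; have cH := Bc_continuous BH.
pose V := T pi - T (- pi).
have V0 : 0 <= V by rewrite subr_ge0 (dominated_increments_le gT (lexx _) Npi_le_pi (lexx _)).
move=> y; apply/cvgrPdist_le => e e0.
have V1 : 0 < V + 1 by rewrite ltr_wpDl.
have [d d0 Hd] := quasiperiodic_unif_continuous cH (fun x => Bc_add2pi x BH) (divr_gt0 e0 V1).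
apply/nbhs_ballP; exists d => // z; rewrite /ball/= => yz.
have [I HI _] := RS_translate_limit y BH Bg gT.
have [J HJ _] := RS_translate_limit z BH Bg gT.
rewrite (convBV_eq BH Bg gT HI) (convBV_eq BH Bg gT HJ) opprD addrACA subrr add0r.
apply: le_trans (is_RS_integral_dist Npi_le_pi gT (e := e / (V + 1)) _ HI HJ) _.
  by move=> t _; apply: Hd; rewrite opprB addrA subrK.
by rewrite -/V mulrAC ler_pdivrMr// ler_wpM2l ?(ltW e0)// lerDl.
Qed.

(** The function of the definition of h * g is continuous and is the derivative
    of conv_primitive at every point. *)
Lemma dfun_convBV H g : Bc H -> BVT g ->
  dfun (convBV (dderive (dfun H)) g) = dderive (dfun (conv_primitive H g)).
Proof.
move=> BH Bg; apply: dfun_antiderivative; first exact: continuous_convBV.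
by move=> y; exact: is_derive_conv_primitive.
Qed.

(** Young's inequality, the first factor being measured by the increments of its
    primitive. *)
Lemma Alexiewicz_convBV H : Bc H -> exists2 C, 0 <= C &
  forall g g', BVT g -> integrable_period g' ->
  Alexiewicz (dfun (convBV (dderive (dfun H)) g) - dderive (dfun (conv_primitive H g')))
   <= C * \int[cmu]_(t in `[(- pi), pi]) `|g t - g' t|.
Proof.
move=> BH; have [C C0 HC] := Bc_increment_bounded BH; exists C => // g g' Bg ig'.
have ig := BVT_integrable Bg; have cH := Bc_continuous BH.
have BP := Bc_conv_primitive BH ig; have BP' := Bc_conv_primitive BH ig'.
rewrite dfun_convBV// dderive_dfunB; [|exact: Bc_continuous|exact: Bc_continuous].
have igg : integrable_period (fun t => g t - g' t).
  have := integrableB (measurable_itv_completed `[(- pi), pi]) ig ig'.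
  by apply: eq_integrable => //; exact: measurable_itv_completed.
apply: Alexiewicz_le; first exact: Bc_sub.
move=> a b /andP[ab ba]; rewrite !conv_primitive_subr// conv_primitiveB//.
apply: Rintegral_mul_le => //; first exact: continuous_kernel.
by move=> t _; apply: HC; apply/andP; split; lra.
Qed.

End convolution_with_BV.

(** * Periodic functions of bounded variation *)

Section periodization.
Context {R : realType}.
Implicit Types (q g : R -> R) (a b x : R).

(** The values on the half-open period from -pi (excluded) to pi are kept; this
    matches the half-open intervals on which integrals are additive. *)
Definition periodize q x := q (x - 2 * (Num.ceil ((x - pi) / (2 * pi)))%:~R * pi).

Lemma periodize_periodic q : periodic (periodize q) (2 * pi).
Proof.
have p0 : (0 : R) < 2 * pi by rewrite mulr_gt0// pi_gt0.
move=> x; rewrite /periodize.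
have -> : (x + 2 * pi - pi) / (2 * pi) = (x - pi) / (2 * pi) + 1.
  move: (lt0r_neq0 (pi_gt0 R)); move: (pi : R) => p p_neq0; by field.
rewrite ceilDrz//.
by rewrite ceil1 intrD; congr q; ring.
Qed.

Lemma periodize_shift q (n : int) x : (2 * n%:~R - 1) * pi < x <= (2 * n%:~R + 1) * pi ->
  periodize q x = q (x - 2 * n%:~R * pi).
Proof.
move=> /andP[nx xn]; rewrite /periodize; congr (q (x - 2 * _%:~R * pi)).
have p0 : (0 : R) < 2 * pi by rewrite mulr_gt0// pi_gt0.
apply: ceil_def; rewrite ltr_pdivlMr// ler_pdivrMr// intrB.
by apply/andP; split; lra.
Qed.

Lemma periodize_id q x : - pi < x <= pi -> periodize q x = q x.
Proof.
move=> xpi; rewrite (@periodize_shift _ 0) ?mulr0 ?mul0r ?subr0//.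
by rewrite sub0r add0r mulN1r mul1r.
Qed.

Lemma periodize_Npi q : periodize q (- pi) = q pi.
Proof.
rewrite -periodize_periodic periodize_id; first by congr q; ring.
by have := pi_gt0 R; move=> ?; apply/andP; split; lra.
Qed.

Lemma eq_bounded_variation f g a b : (forall x, a <= x <= b -> f x = g x) ->
  bounded_variation a b f -> bounded_variation a b g.
Proof.
move=> fg [M HM]; exists M => _ [s abs <-].
suff -> : variation a b g s = variation a b f s by apply: HM; exists s.
apply: eq_big_nat => i /andP[_ si].
have E k : (k <= size s)%N -> f (nth b (a :: s) k) = g (nth b (a :: s) k).
  move=> ks; apply: fg.
  by rewrite itv_partition_nth_ge//= itv_partition_nth_le.
by rewrite /= !(E i.+1) ?(E i)// ltnW.
Qed.

(** A function with derivative bounded by L is a difference of monotone functions,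
    L x + q(x) and L x. *)
Lemma differentiable_bounded_variation q f a b : continuous f ->
  (forall x, is_derive x 1 q (f x)) -> a < b -> bounded_variation a b q.
Proof.
move=> cf dq ab; have [L L0 HL] := continuous_bounded_itv a b cf.
have nd (s : R) : (s == 1) || (s == -1) ->
    {in `[a, b] &, {homo (fun x => L * x + s * q x) : x y / x <= y}}.
  move=> s1 x y; rewrite !in_itv/= => /andP[ax xb] /andP[ay yb].
  rewrite le_eqVlt => /predU1P[-> //|xy].
  have [z] := MVT xy (fun z _ => dq z) (continuous_subspaceT (fun z => is_derive_continuous (dq z)) ).
  rewrite in_itv/= => /andP[xz zy] E.
  have := HL z; rewrite (le_trans ax (ltW xz)) (le_trans (ltW zy) yb) => /(_ isT).
  rewrite ler_norml => /andP[L1 L2].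
  rewrite -subr_ge0 (_ : _ - _ = L * (y - x) + s * (q y - q x)); last by ring.
  have xy' : 0 < y - x by rewrite subr_gt0.
  by rewrite E; case/orP: s1 => /eqP ->; nra.
have h1 : bounded_variation a b (fun x => L * x + 1 * q x).
  by apply: nondecreasing_bounded_variation; apply: nd; rewrite eqxx.
have h2 : bounded_variation a b (fun x => - (L * x + 0 * q x)).
  apply: bounded_variationN; apply: nondecreasing_bounded_variation.
  by move=> x y _ _ xy; rewrite !mul0r !addr0 ler_wpM2l.
have := bounded_variationD ab h1 h2; apply: eq_bounded_variation => x _ /=.
by ring.
Qed.

(** On the closed period the periodization differs from q at -pi only, and a
    function with one nonzero value, at the left end, is monotone. *)
Lemma periodize_BVT q : bounded_variation (- pi) pi q -> BVT (periodize q).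
Proof.
move=> bq; split; first exact: periodize_periodic.
have ab : - pi < pi :> R by have := pi_gt0 R; lra.
pose c := q pi - q (- pi).
pose d (x : R) := if x == - pi then c else 0.
apply: (@eq_bounded_variation (fun x => q x + d x)).
  move=> x /andP[ax xb]; rewrite /d; have [->|xpi] := eqVneq x (- pi).
    by rewrite periodize_Npi /c; ring.
  by rewrite addr0 periodize_id// lt_neqAle eq_sym xpi ax.
apply: bounded_variationD => //.
have nonincr (e : R) : 0 <= e ->
    bounded_variation (- pi) pi (fun x => - (if x == - pi then e else 0)).
  move=> e0; apply: nondecreasing_bounded_variation => x y.
  rewrite !in_itv/= => /andP[ax _] /andP[ay _] xy.
  have [yp|yp] := eqVneq y (- pi).
    suff -> : x = - pi by rewrite eqxx.
    by apply/eqP; rewrite eq_le ax -yp xy.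
  by rewrite oppr0; case: ifP => _; rewrite ?oppr0// oppr_le0.
have [c0|c0] := leP 0 c.
  have := bounded_variationN (nonincr c c0); apply: eq_bounded_variation => x _ /=.
  by rewrite opprK.
have := nonincr (- c); rewrite oppr_ge0 => /(_ (ltW c0)).
apply: eq_bounded_variation => x _ /=; rewrite /d.
by case: ifP => _; rewrite ?opprK ?oppr0.
Qed.

End periodization.

(** * Density of functions of bounded variation *)

Section BV_density.
Context {R : realType}.
Implicit Types (f g u v b : R -> R) (c e x : R).
Notation mu := (@lebesgue_measure R).
Notation cmu := (@completed_lebesgue_measure R).
Local Notation BT := (measurableTypeR R).
Local Notation CT := (caratheodory_type (wlength (@idfun R))^*%mu).
Local Notation I0 := (`[(- pi)%R, pi%R]%classic : set R).

Definition L1dist u v := \int[cmu]_(t in I0) `|u t - v t|.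

Definition BV_approximable u := integrable_period u /\
  forall e, 0 < e -> exists2 b, BVT b & L1dist b u <= e.

Hint Resolve measurable_period : core.

Lemma integrable_periodB u v : integrable_period u -> integrable_period v ->
  integrable_period (fun t => u t - v t).
Proof. by move=> iu iv; have := integrableB measurable_period iu iv; apply: eq_integrable. Qed.

Lemma integrable_periodD u v : integrable_period u -> integrable_period v ->
  integrable_period (fun t => u t + v t).
Proof. by move=> iu iv; have := integrableD measurable_period iu iv; apply: eq_integrable. Qed.

Lemma L1dist_triangle u v w : integrable_period u -> integrable_period v ->
  integrable_period w -> L1dist u w <= L1dist u v + L1dist v w.
Proof.
move=> iu iv iw.
have n1 := integrable_norm (integrable_periodB iu iv).
have n2 := integrable_norm (integrable_periodB iv iw).
have n3 := integrable_norm (integrable_periodB iu iw).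
rewrite /L1dist -RintegralD//; apply: le_Rintegral => //.
  by have := integrableD measurable_period n1 n2; apply: eq_integrable.
move=> t _ /=; have := ler_normD (u t - v t) (v t - w t).
by rewrite subrKA.
Qed.

Lemma BV_approximable_limit u : integrable_period u ->
  (forall e, 0 < e -> exists2 v, BV_approximable v & L1dist v u <= e) ->
  BV_approximable u.
Proof.
move=> iu H; split => // e e0; have e2 : 0 < e / 2 by rewrite divr_gt0.
have [v [iv /(_ _ e2)[b Bb bv]] vu] := H _ e2; exists b => //.
have := L1dist_triangle (BVT_integrable Bb) iv iu; lra.
Qed.

Lemma BV_approximableD u v : BV_approximable u -> BV_approximable v ->
  BV_approximable (fun t => u t + v t).
Proof.
move=> [iu Hu] [iv Hv]; split; first exact: integrable_periodD.
move=> e e0; have e2 : 0 < e / 2 by rewrite divr_gt0.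
have [b Bb bu] := Hu _ e2; have [c Bc cv] := Hv _ e2.
exists (fun t => b t + c t).
  case: Bb Bc => pb vb [pc vc]; split; first by move=> x; rewrite pb pc.
  by apply: bounded_variationD => //; have := pi_gt0 R; lra.
have ib := integrable_periodB (BVT_integrable Bb) iu.
have ic := integrable_periodB (BVT_integrable Bc) iv.
apply: (@le_trans _ _ (L1dist b u + L1dist c v)); last by lra.
rewrite /L1dist -RintegralD//; [|exact: integrable_norm ib|exact: integrable_norm ic].
apply: le_Rintegral => //.
- have := integrable_norm (integrable_periodD ib ic); apply: eq_integrable => // t _ /=.
  by rewrite opprD addrACA.
- have := integrableD measurable_period (integrable_norm ib) (integrable_norm ic).
  by apply: eq_integrable.
- by move=> t _ /=; rewrite opprD addrACA ler_normD.
Qed.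

Lemma eq_BV_approximable u v : u = v -> BV_approximable u -> BV_approximable v.
Proof. by move=> ->. Qed.

Lemma continuous_integrable_period f : continuous f -> integrable_period f.
Proof. exact: continuous_integrable_completed. Qed.

(** A difference quotient of a primitive of f is uniformly close to f and has a
    continuous derivative. *)
Lemma BV_approximable_continuous f : continuous f -> BV_approximable f.
Proof.
move=> cf; have fi := continuous_integrable_period cf; split => // e e0.
have [K dK] := antiderivative_exists cf.
have p0 := pi_gt0 R.
have e'0 : 0 < e / (2 * pi) by rewrite divr_gt0// mulr_gt0.
have [d d0 Hd] := heine_cantor (- pi) pi cf e'0.
(* The difference quotient of step h samples f within distance d. *)
pose h := d / 2; have h0 : 0 < h by rewrite divr_gt0.
pose q x := h^-1 * (K (x + h) - K x).
have dq x : is_derive x 1 q (h^-1 * (f (x + h) - f x)).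
  by apply: is_derive_scalef; apply: is_derive_subf; exact: is_derive_shiftf.
have cq' : continuous (fun x => h^-1 * (f (x + h) - f x)).
  apply: continuous_mulf; first by move=> ?; exact: cvg_cst.
  by apply: continuous_subf => //; exact: continuous_shiftf.
have cq : continuous q by move=> x; exact: is_derive_continuous (dq x).
have pp : - pi < pi :> R by lra.
have Bq := periodize_BVT (differentiable_bounded_variation cq' dq pp).
exists (periodize q) => //.
have qf x : - pi <= x <= pi -> `|q x - f x| <= e / (2 * pi).
  move=> xp; have := @increment_le_derivative R K f (f x) (e / (2 * pi)) x h dK => Hh.
  have -> : q x - f x = h^-1 * (K (x + h) - K x - h * f x) by rewrite /q; field; rewrite gt_eqF.
  rewrite normrM normfV [leLHS]mulrC ler_pdivrMr ?normr_gt0 ?gt_eqF//; apply: Hh.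
  by move=> y yx; apply: Hd => //; rewrite (le_lt_trans yx)// gtr0_norm// /h; lra.
have ni := integrable_norm (integrable_periodB (BVT_integrable Bq) fi).
rewrite /L1dist Rintegral_completed_obnd_cbnd//; last exact: ltW.
have -> : e = \int[cmu]_(t in `](- pi), pi]) (e / (2 * pi)).
  rewrite Rintegral_cst; last exact: measurable_itv_completed.
  have := congr1 fine (completed_measure_itv (ltW pp)) => /= ->.
  move: p0; move: (pi : R) => p p0; field; lra.
apply: le_Rintegral.
- exact: measurable_itv_completed.
- exact: integrable_completedS ni.
- apply: (@integrable_completedS R (- pi) pi) => //.
  by apply: continuous_integrable_completed => ?; exact: cvg_cst.
- move=> t; rewrite /= in_itv/= => /andP[pt tp].
  by rewrite periodize_id ?pt// qf// tp ltW.
Qed.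

Lemma BV_approximable_borel f : mu.-integrable I0 (EFin \o f) -> BV_approximable f.
Proof.
move=> fi; apply: BV_approximable_limit; first exact: integrable_completed.
move=> e e0.
have fin : (mu I0 < +oo)%E by apply: compact_finite_measure; exact: segment_compact.
have mB : measurable (I0 : set BT) by exact: measurable_itv.
have [c [cc ci]] := approximation_continuous_integrable mB fin fi.
move=> /fine_cvgP[_] /cvgrPdist_lt/(_ _ e0)[N _ /(_ N (leqnn N))]/= HN.
exists (c N); first exact: BV_approximable_continuous.
apply: ltW; apply: le_lt_trans HN; rewrite sub0r normrN.
apply: le_trans (ler_norm _).
rewrite /L1dist Rintegral_completed//.
- rewrite /Rintegral le_eqVlt; apply/orP; left; apply/eqP; congr fine.
  by apply: eq_integral => t _ /=; rewrite distrC.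
- apply: measurableT_comp => //; apply: measurable_funB.
    exact: measurable_funTS (continuous_measurable_fun (cc N)).
  by have /integrableP[/measurable_EFinP] := fi.
Qed.

Lemma scaled_indic_integrable d (T : measurableType d)
    (m : {measure set T -> \bar R}) (D A : set T) c :
  measurable D -> (m D < +oo)%E -> measurable A ->
  m.-integrable D (EFin \o (fun t => c * \1_A t)).
Proof.
move=> mD finD mA; apply: measurable_bounded_integrable => //.
  by apply: measurable_funM; [exact: measurable_cst|exact: measurable_indic].
exists `|c|; split; first exact: num_real.
move=> M cM t _ /=; apply: le_trans (ltW cM); rewrite normrM ler_piMr//.
by rewrite indicE; case: (_ \in _); rewrite ?normr1 ?normr0.
Qed.

(** A measurable set for the completed measure is a Borel set up to a null set. *)
Lemma BV_approximable_indic (A : set R) c : measurable (A : set CT) ->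
  BV_approximable (fun t => c * \1_A t).
Proof.
move=> mA.
have fin : (mu I0 < +oo)%E by apply: compact_finite_measure; exact: segment_compact.
have iA : integrable_period (fun t => c * \1_A t).
  exact: (@scaled_indic_integrable _ CT cmu I0 A c measurable_period fin mA).
apply: (BV_approximable_limit iA) => e e0.
have : (completed_algebra_gen mu).-sigma.-measurable A.
  by rewrite completed_caratheodory_measurable.
rewrite g_sigma_completed_algebra_genE => -[B mB [N negN BN]].
exists (fun t => c * \1_B t).
  apply: BV_approximable_borel.
  by apply: (@scaled_indic_integrable _ BT mu I0 B c) => //; exact: measurable_itv.
rewrite /L1dist /Rintegral.
suff -> : (\int[cmu]_(x in I0) `|c * \1_B x - c * \1_A x|%:E = 0)%E by rewrite ltW.
have mcB : measurable (B : set CT) by exact: borel_measurable_completed.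
have mf : @measurable_fun _ _ CT R I0 (fun x => c * \1_B x - c * \1_A x).
  apply: measurable_funB.
    by apply: measurable_funM; [exact: measurable_cst|exact: measurable_indic].
  by apply: measurable_funM; [exact: measurable_cst|exact: measurable_indic].
have /measurable_EFinP mfE := mf.
apply/(@ae_eq_integral_abs _ CT R cmu I0 measurable_period _ mfE).
case: negN => Z [mZ Z0 NZ]; exists Z; split; [exact: borel_measurable_completed|exact: Z0|].
move=> t /= nt; apply: NZ; apply: contrapT => Nt; apply: nt => _.
suff -> : \1_B t = \1_A t :> R by rewrite subrr.
rewrite !indicE; congr ((nat_of_bool _)%:R); apply/idP/idP; rewrite !inE -BN; first by left.
by case.
Qed.

Import HBSimple.

Lemma BV_approximable_simple (s : {sfun CT >-> R}) : BV_approximable s.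
Proof.
pose levels : seq R := finmap.enum_fset (fset_set (range s)).
have E : (fun x => \sum_(y <- levels) (y * \1_(s @^-1` [set y]) x)) = s.
  by apply/funext => x; rewrite fimfunE fsbig_finite.
apply: eq_BV_approximable E _.
elim: levels => [|y r ih].
  apply: (@eq_BV_approximable (fun _ => 0)).
    by apply/funext => x; rewrite big_nil.
  by apply: BV_approximable_continuous => ?; exact: cvg_cst.
apply: (@eq_BV_approximable (fun x => y * \1_(s @^-1` [set y]) x +
    \sum_(z <- r) (z * \1_(s @^-1` [set z]) x))).
  by apply/funext => x; rewrite big_cons.
apply: BV_approximableD => //; apply: BV_approximable_indic.
exact: measurable_sfunP.
Qed.

(** Simple functions are dense in L1 and are combinations of indicators. *)
Lemma integrable_BV_approximable g : integrable_period g -> BV_approximable g.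
Proof.
move=> gi; apply: BV_approximable_limit => // e e0.
have [s [si _]] := approximation_sfun_integrable measurable_period gi.
move=> /fine_cvgP[_] /cvgrPdist_lt/(_ _ e0)[N _ /(_ N (leqnn N))]/= HN.
exists (s N); first exact: BV_approximable_simple.
apply: ltW; apply: le_lt_trans HN; rewrite sub0r normrN.
apply: le_trans (ler_norm _).
rewrite /L1dist /Rintegral le_eqVlt; apply/orP; left; apply/eqP; congr fine.
by apply: eq_integral => t _ /=; rewrite distrC.
Qed.

End BV_density.

(** * Existence and uniqueness of the convolution *)

Section convolution_L1.
Context {R : realType}.
Implicit Types (F G H g u : R -> R) (f h : testfun R -> R) (c e x : R).
Notation cmu := (@completed_lebesgue_measure R).

Lemma L1T_integrable_period g : L1T g -> integrable_period g.
Proof. by move=> [_]; apply; exact: segment_compact. Qed.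

Lemma L1normE g b : integrable_period b -> integrable_period g ->
  L1norm (b - g) = (L1dist b g)%:E.
Proof.
move=> ib ig; have n := integrable_norm (integrable_periodB ib ig).
rewrite /L1dist /Rintegral fineK; first by [].
by apply: integrable_fin_num n; exact: measurable_period.
Qed.

Lemma Bc_eq F G : Bc F -> Bc G -> (forall x, - pi <= x <= pi -> F x = G x) -> F = G.
Proof.
move=> BF BG FG; apply/funext => x; have [n /andP[n1 n2]] := reduce_mod_2pi x.
have EF := add2pi_int (fun x => Bc_add2pi x BF) n (x - 2 * n%:~R * pi).
have EG := add2pi_int (fun x => Bc_add2pi x BG) n (x - 2 * n%:~R * pi).
rewrite subrK in EF; rewrite subrK in EG.
rewrite EF EG (FG (x - _)) ?n1 ?(ltW n2)// (FG pi)//.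
by have := pi_gt0 R; move=> p0; apply/andP; split; lra.
Qed.

Lemma BVT_sequence g : integrable_period g ->
  exists b : nat -> R -> R, (forall k, BVT (b k)) /\ L1dist (b k) g @[k --> \oo] --> (0 : R).
Proof.
move=> /integrable_BV_approximable[_ Hg].
have /choice[b Hb] : forall k : nat, exists b, BVT b /\ L1dist b g <= k.+1%:R^-1.
  by move=> k; have [|b ? ?] := Hg (k.+1%:R^-1); [rewrite invr_gt0|exists b].
exists b; split; first by move=> k; have [] := Hb k.
apply: (@squeeze_cvgr _ _ _ _ (fun=> 0) (fun k => k.+1%:R^-1)).
- near=> k; have [_ ->] := Hb k; rewrite andbT.
  by apply: Rintegral_ge0 => t _.
- exact: cvg_cst.
- exact: cvg_harmonic.
Unshelve. all: by end_near. Qed.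

Lemma is_convL1_conv_primitive H g : Bc H -> integrable_period g ->
  is_convL1 (dderive (dfun H)) g (dderive (dfun (conv_primitive H g))).
Proof.
move=> BH ig; have BP := Bc_conv_primitive BH ig.
split; first exact: Ac_dderive_dfun.
move=> b Bb cb; have [C C0 HC] := Alexiewicz_convBV BH.
have cd : C * L1dist (b k) g @[k --> \oo] --> (0 : R).
  rewrite -(mulr0 C); apply: cvgM; first exact: cvg_cst.
  move: cb; under eq_fun do rewrite (L1normE (BVT_integrable (Bb _)) ig).
  by move=> /fine_cvgP[].
apply: (@squeeze_cvgr _ _ _ _ (fun=> 0) (fun k => C * L1dist (b k) g)) => //.
- near=> k; apply/andP; split; last exact: HC.
  rewrite dfun_convBV//; have BPk := Bc_conv_primitive BH (BVT_integrable (Bb k)).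
  rewrite dderive_dfunB; [|exact: Bc_continuous|exact: Bc_continuous].
  by apply: Alexiewicz_ge0; exact: Bc_sub.
- exact: cvg_cst.
Unshelve. all: by end_near. Qed.

(** Both candidates are limits, in the Alexiewicz norm, of the convolutions with
    one sequence of functions of bounded variation approaching g. *)
Lemma is_convL1_unique h g f f' : Ac h -> integrable_period g ->
  is_convL1 h g f -> is_convL1 h g f' -> f = f'.
Proof.
move=> /AcP[H BH ->] ig [/AcP[F BF ->] cf] [/AcP[G BG ->] cg].
congr (dderive (dfun _)); apply: Bc_eq => // x xpi.
have [b [Bb bg]] := BVT_sequence ig.
have cb : L1norm (b k - g) @[k --> \oo] --> (0 : \bar R)%E.
  under eq_fun do rewrite (L1normE (BVT_integrable (Bb _)) ig).
  by apply/fine_cvgP; split => //; near=> k.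
have := cf b Bb cb; have := cg b Bb cb.
have BP k := Bc_conv_primitive BH (BVT_integrable (Bb k)).
have cP k := Bc_continuous (BP k).
have cF := Bc_continuous BF; have cG := Bc_continuous BG.
have px : - pi <= x <= - pi + 2 * pi by move: xpi => /andP[-> /= xp]; lra.
have bound k (Q : R -> R) : Bc Q ->
    `|conv_primitive H (b k) x - Q x| <=
    Alexiewicz (dfun (convBV (dderive (dfun H)) (b k)) - dderive (dfun Q)).
  move=> BQ; rewrite dfun_convBV// dderive_dfunB//; last exact: Bc_continuous.
  have := le_Alexiewicz (Bc_sub (BP k) BQ) px.
  by have [_ -> _] := BP k; have [_ -> _] := BQ; rewrite !subr0.
move=> /cvgrPdist_le cG' /cvgrPdist_le cF'.
apply/eqP; rewrite -subr_eq0 -normr_le0; apply/ler_addgt0Pr => e e0; rewrite add0r.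
have e2 : 0 < e / 2 by rewrite divr_gt0.
have [k [/= h1 h2]] := filter_ex (filterI (cF' _ e2) (cG' _ e2)).
move: (bound k F BF) (bound k G BG) h1 h2.
move: (Alexiewicz _) => A1; move: (Alexiewicz _) => A2.
move: (conv_primitive H (b k) x) (F x) (G x) => p y z pA1 pA2.
rewrite !sub0r !normrN => h1 h2.
have -> : y - z = (p - z) - (p - y) by ring.
have := ler_norm A1; have := ler_norm A2; have := ler_normB (p - z) (p - y); lra.
Unshelve. all: by end_near. Qed.

Lemma convL1E H g : Bc H -> integrable_period g ->
  convL1 (dderive (dfun H)) g = dderive (dfun (conv_primitive H g)).
Proof.
move=> BH ig; have AH := Ac_dderive_dfun BH.
have cP := is_convL1_conv_primitive BH ig.
rewrite /convL1; case: xgetP => [f _ [cf _]|]; first exact: is_convL1_unique cf cP.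
move=> /(_ (dderive (dfun (conv_primitive H g))))[]; split => // f cf.
exact: is_convL1_unique cP cf.
Qed.

End convolution_L1.

(** * Resolvents of differentiation on periodic functions *)

Section resolvent.
Context {R : realType}.
Implicit Types (u v w y V : R -> R) (a b c e x t s z M : R).
Notation mu := (@lebesgue_measure R).

Definition periodic_continuous u := continuous u /\ forall x, u (x + 2 * pi) = u x.

(** The 2pi-periodic solution y of y' = a (u - y) is the convolution of u with the
    periodization of the exponential density of parameter a. On one period that
    density is an exponential; the translation by pi puts its jump at the ends of
    the interval from -pi to pi. *)
Definition exp_kernel a t : R :=
  a / (1 - expR (- (a * (2 * pi)))) * expR (- (a * (t + pi))).

Definition resolvent a u x :=
  \int[mu]_(t in `[(- pi), pi]) (exp_kernel a t * u (x - pi - t)).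

Lemma exp_kernel_den_gt0 a : 0 < a -> 0 < 1 - expR (- (a * (2 * pi))).
Proof.
by move=> a0; rewrite subr_gt0 expR_lt1 oppr_lt0 !mulr_gt0// pi_gt0.
Qed.

Lemma exp_kernel_ge0 a t : 0 < a -> 0 <= exp_kernel a t.
Proof.
by move=> a0; rewrite mulr_ge0 ?expR_ge0// divr_ge0 ?ltW// exp_kernel_den_gt0.
Qed.

Lemma is_derive_expRM c b x :
  is_derive x 1 (fun t => expR (c * t + b)) (c * expR (c * x + b)).
Proof. exact: is_derive_affine (is_derive_expR _). Qed.

Lemma is_derive_exp_kernel a x :
  is_derive x 1 (exp_kernel a) (- a * exp_kernel a x).
Proof.
have E t : exp_kernel a t = a / (1 - expR (- (a * (2 * pi)))) * expR ((- a) * t + - (a * pi)).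
  by rewrite /exp_kernel; congr (_ * expR _); ring.
rewrite (_ : exp_kernel a = fun t => a / (1 - expR (- (a * (2 * pi)))) * expR ((- a) * t + - (a * pi))); last exact/funext.
apply: is_derive_eq (is_derive_scalef _ (is_derive_expRM (- a) (- (a * pi)) x)) _.
by ring.
Qed.

Lemma continuous_exp_kernel a : continuous (exp_kernel a).
Proof. by move=> x; exact: is_derive_continuous (is_derive_exp_kernel a x). Qed.

Lemma Npi_lt_pi : - pi < pi :> R.
Proof. by have := pi_gt0 R; lra. Qed.

Lemma exp_kernel_endpoints a : 0 < a ->
  exp_kernel a (- pi) - exp_kernel a pi = a.
Proof.
move=> a0; have := lt0r_neq0 (exp_kernel_den_gt0 a0).
rewrite /exp_kernel addNr mulr0 oppr0 expR0.
have -> : a * (pi + pi) = a * (2 * pi) by ring.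
by move: (expR _) => E E0; field.
Qed.

Lemma Rintegral_exp_kernel a c : 0 < a ->
  \int[mu]_(t in `[(c - pi), (c + pi)]) exp_kernel a (t - c) = 1.
Proof.
move=> a0; have an0 := lt0r_neq0 a0.
have dk x : is_derive x 1 (fun t => - a^-1 * exp_kernel a (t - c)) (exp_kernel a (x - c)).
  apply: is_derive_eq (is_derive_scalef _ (is_derive_shiftf (is_derive_exp_kernel a (x + - c)))) _.
  by field.
rewrite (Rintegral_FTC _ _ dk).
- rewrite -(mulVf an0) -[X in _ = _ * X](exp_kernel_endpoints a0).
  have -> : c + pi - c = pi by ring.
  have -> : c - pi - c = - pi by ring.
  by ring.
- by have := Npi_lt_pi; lra.
- by apply: continuous_shiftf; exact: continuous_exp_kernel.
Qed.

Lemma Rintegral_exp_kernel_period a : 0 < a ->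
  \int[mu]_(t in `[(- pi), pi]) exp_kernel a t = 1.
Proof.
move=> a0; rewrite -[RHS](Rintegral_exp_kernel 0 a0) sub0r add0r.
by apply: eq_Rintegral => t _; rewrite subr0.
Qed.

(** The substitution s = x - pi - t turns the convolution into an integral of
    exp(a s) u(s) over the period that ends at x. *)
Lemma resolvent_formula a u V x : continuous u ->
  (forall s, is_derive s 1 V (expR (a * s) * u s)) ->
  resolvent a u x = a / (1 - expR (- (a * (2 * pi)))) *
    (expR (- a * x) * (V x - V (x - 2 * pi))).
Proof.
move=> cu dV; set k := a / _.
have dW t : is_derive t 1 (fun t => - (k * expR (- a * x)) * V (x - pi - t))
    (exp_kernel a t * u (x - pi - t)).
  apply: is_derive_eq (is_derive_scalef _ (is_derive_reflectf (dV (x - pi - t)))) _.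
  rewrite mulNr mulrN opprK mulrA; congr (_ * _).
  rewrite -mulrA -expRD /exp_kernel -/k; congr (_ * expR _); ring.
rewrite /resolvent (Rintegral_FTC _ _ dW).
- have -> : x - pi - pi = x - 2 * pi by ring.
  have -> : x - pi - - pi = x by ring.
  by ring.
- exact/ltW/Npi_lt_pi.
- apply: continuous_mulf; first exact: continuous_exp_kernel.
  exact: continuous_reflectf.
Qed.

Lemma is_derive_resolvent a u x : 0 < a -> periodic_continuous u ->
  is_derive x 1 (resolvent a u) (a * (u x - resolvent a u x)).
Proof.
move=> a0 [cu pu].
have ceu : continuous (fun s => expR (a * s) * u s).
  apply: continuous_mulf => // s.
  apply: (@is_derive_continuous _ _ _ (a * expR (a * s))).
  by have := is_derive_expRM a 0 s; rewrite addr0; under eq_fun do rewrite addr0.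
have [V dV] := antiderivative_exists ceu.
rewrite (resolvent_formula x cu dV); set k := a / _.
have -> : resolvent a u = fun x => k * (expR (- a * x) * (V x - V (x - 2 * pi))).
  by apply/funext => z; exact: resolvent_formula.
have dE : is_derive x 1 (fun t => expR (- a * t)) (- a * expR (- a * x)).
  by have := is_derive_expRM (- a) 0 x; rewrite addr0; under eq_fun do rewrite addr0.
have dD := is_derive_subf (dV x) (is_derive_shiftf (dV (x + - (2 * pi)))).
apply: is_derive_eq (is_derive_scalef k (is_derive_mulf dE dD)) _.
have -> : u (x + - (2 * pi)) = u x by rewrite -[LHS]pu subrK.
have -> : expR (a * (x + - (2 * pi))) = expR (a * x) * expR (- (a * (2 * pi))).
  by rewrite -expRD; congr expR; ring.
have : expR (- a * x) * expR (a * x) = 1.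
  by rewrite -expRD -mulrDl addNr mul0r expR0.
have : k * (1 - expR (- (a * (2 * pi)))) = a.
  by rewrite /k divfK// lt0r_neq0// exp_kernel_den_gt0.
move: (expR (- a * x)) (expR (a * x)) (expR _) (V x - _) (u x) => E1 E2 Ep D U H1 H2.
have -> : k * (E1 * (E2 * U - E2 * Ep * U) + D * (- a * E1)) =
  (E1 * E2) * U * (k * (1 - Ep)) - a * (k * (E1 * D)) by ring.
by rewrite H1 H2; ring.
Qed.

Lemma periodic_continuous_resolvent a u : 0 < a -> periodic_continuous u ->
  periodic_continuous (resolvent a u).
Proof.
move=> a0 pu; split; first by move=> x; exact: is_derive_continuous (is_derive_resolvent x a0 pu).
move=> x; apply: eq_Rintegral => t _; congr (_ * _).
by rewrite -[RHS](pu.2); congr u; ring.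
Qed.

(** The difference w of two solutions satisfies w' = - a w; only the zero multiple
    of an exponential is periodic. *)
Lemma resolvent_unique a u y : 0 < a -> periodic_continuous u ->
  periodic_continuous y -> (forall x, is_derive x 1 y (a * (u x - y x))) ->
  resolvent a u = y.
Proof.
move=> a0 pu [_ py] dy; have [_ pr] := periodic_continuous_resolvent a0 pu.
pose w x := expR (a * x) * (resolvent a u x - y x).
have dw x : is_derive x 1 w 0.
  have dE : is_derive x 1 (fun t => expR (a * t)) (a * expR (a * x)).
    by have := is_derive_expRM a 0 x; rewrite addr0; under eq_fun do rewrite addr0.
  have := is_derive_mulf dE (is_derive_subf (is_derive_resolvent x a0 pu) (dy x)).
  by move=> H; apply: is_derive_eq H _; ring.
apply/funext => x; apply/eqP; rewrite -subr_eq0.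
have := is_derive_eq_constant dw (x + 2 * pi) x; rewrite /w pr py => /eqP.
rewrite -subr_eq0 -mulrBl mulf_eq0 => /orP[|//].
move=> /eqP/subr0_eq E; have {}E := expR_inj E; move/eqP: E.
rewrite -subr_eq0 -mulrBr addrAC subrr add0r !mulf_eq0 (gt_eqF a0)/=.
by rewrite (gt_eqF (pi_gt0 R)) pnatr_eq0.
Qed.

Lemma periodic_continuous_comb c b u v : periodic_continuous u -> periodic_continuous v ->
  periodic_continuous (fun x => c * u x + b * v x).
Proof.
move=> [cu pu] [cv pv]; split; last by move=> x; rewrite pu pv.
by apply: continuous_addf; apply: continuous_mulf => // ?; exact: cvg_cst.
Qed.

(** Both sides are periodic and solve the same differential equation. *)
Lemma resolvent_identity a b u : 0 < a -> 0 < b -> a != b -> periodic_continuous u ->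
  forall x, resolvent a (resolvent b u) x =
    b / (b - a) * resolvent a u x + (- a / (b - a)) * resolvent b u x.
Proof.
move=> a0 b0 ab pu x.
have pa := periodic_continuous_resolvent a0 pu.
have pb := periodic_continuous_resolvent b0 pu.
have ba : b - a != 0 by rewrite subr_eq0 eq_sym.
pose y z := b / (b - a) * resolvent a u z + (- a / (b - a)) * resolvent b u z.
suff -> : resolvent a (resolvent b u) = y by [].
apply: (resolvent_unique a0 pb); first exact: periodic_continuous_comb.
move=> z.
apply: is_derive_eq (is_derive_addf (is_derive_scalef _ (is_derive_resolvent z a0 pu))
  (is_derive_scalef _ (is_derive_resolvent z b0 pu))) _.
by rewrite /y; field.
Qed.

Lemma resolvent_comb a c b u v : 0 < a -> periodic_continuous u -> periodic_continuous v ->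
  forall x, resolvent a (fun x => c * u x + b * v x) x =
    c * resolvent a u x + b * resolvent a v x.
Proof.
move=> a0 pu pv x.
have pa := periodic_continuous_resolvent a0 pu.
have pb := periodic_continuous_resolvent a0 pv.
pose y z := c * resolvent a u z + b * resolvent a v z.
suff -> : resolvent a (fun x => c * u x + b * v x) = y by [].
apply: resolvent_unique => //; [exact: periodic_continuous_comb| |].
  exact: periodic_continuous_comb.
move=> z.
apply: is_derive_eq (is_derive_addf (is_derive_scalef c (is_derive_resolvent z a0 pu))
  (is_derive_scalef b (is_derive_resolvent z a0 pv))) _.
by rewrite /y; ring.
Qed.

(** The operator 2 - resolvent (2a) inverts the average of the identity and
    of resolvent a. *)
Lemma resolvent_double a u : 0 < a -> periodic_continuous u ->
  forall x, resolvent a (fun x => 2 * u x + (- 1) * resolvent (2 * a) u x) x =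
    resolvent (2 * a) u x.
Proof.
move=> a0 pu x; have a20 : 0 < 2 * a by rewrite mulr_gt0.
have p2 := periodic_continuous_resolvent a20 pu.
suff -> : resolvent a (fun x => 2 * u x + (- 1) * resolvent (2 * a) u x) =
  resolvent (2 * a) u by [].
apply: resolvent_unique => //; first exact: periodic_continuous_comb.
move=> z.
by apply: is_derive_eq (is_derive_resolvent z a20 pu) _; ring.
Qed.

Lemma Rintegral_exp_kernel_mul_le a u M : 0 < a -> continuous u ->
  (forall x, `|u x| <= M) ->
  `|\int[mu]_(t in `[(- pi), pi]) (exp_kernel a t * u t)| <= M.
Proof.
move=> a0 cu uM; have ck := @continuous_exp_kernel a.
have cku := continuous_mulf ck cu.
apply: (le_trans (le_normr_Rintegral _ (continuous_integrable_itv _ _ cku))) => //.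
rewrite -[leRHS]mul1r -(Rintegral_exp_kernel_period a0) -RintegralZr//; last first.
  exact: continuous_integrable_itv.
apply: le_Rintegral => //.
- by apply: continuous_integrable_itv => x; apply: cvg_norm; exact: cku.
- apply: continuous_integrable_itv; apply: continuous_mulf => // ?; exact: cvg_cst.
- by move=> t _; rewrite normrM ger0_norm ?exp_kernel_ge0// ler_wpM2l// exp_kernel_ge0.
Qed.

Lemma resolvent_le a u M : 0 < a -> continuous u -> (forall x, `|u x| <= M) ->
  forall x, `|resolvent a u x| <= M.
Proof.
move=> a0 cu uM x; apply: Rintegral_exp_kernel_mul_le => //.
exact: continuous_reflectf.
Qed.

(** Bounds the displacement of u by the resolvent, since t + pi is the distance
    to the point where the kernel concentrates. *)
Lemma exp_kernel_first_moment a : 0 < a ->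
  \int[mu]_(t in `[(- pi), pi]) (exp_kernel a t * (t + pi)) <= a^-1.
Proof.
move=> a0; have an0 := lt0r_neq0 a0; have ck := @continuous_exp_kernel a.
have dt (x : R) : is_derive x (1 : R) (fun t : R => t + (pi + a^-1)) 1.
  by rewrite -[X in is_derive _ _ _ X]addr0; apply: is_derive_addf.
have dk x : is_derive x 1 (fun t => - a^-1 * (exp_kernel a t * (t + (pi + a^-1))))
    (exp_kernel a x * (x + pi)).
  apply: is_derive_eq (is_derive_scalef _ (is_derive_mulf (is_derive_exp_kernel a x) (dt x))) _.
  by field.
rewrite (Rintegral_FTC _ _ dk); last 2 first.
- exact/ltW/Npi_lt_pi.
- apply: continuous_mulf => // x; apply: cvgD; [exact: cvg_id|exact: cvg_cst].
have := exp_kernel_endpoints a0; have := exp_kernel_ge0 pi a0.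
have := pi_gt0 R; move: (exp_kernel a pi) (exp_kernel a (- pi)) => k1 k2 p0 k10 E.
have -> : k2 = a + k1 by rewrite -E; ring.
have -> : - a^-1 * (k1 * (pi + (pi + a^-1))) - - a^-1 * ((a + k1) * (- pi + (pi + a^-1))) =
  a^-1 - a^-1 * (k1 * (2 * pi)).
  by move: (pi : R) => p; field.
by rewrite gerBl mulr_ge0 ?invr_ge0 ?(ltW a0)// mulr_ge0// mulr_ge0// ltW.
Qed.

(** Uniform continuity and boundedness give the bound e / 2 + L s for an increment
    of length s, and the first moment of the kernel is at most 1 / a. *)
Lemma resolvent_approx u e : periodic_continuous u -> 0 < e ->
  exists2 A, 0 < A & forall a, A <= a -> forall x, `|u x - resolvent a u x| <= e.
Proof.
move=> [cu pu] e0; have e2 : 0 < e / 2 by rewrite divr_gt0.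
have [d d0 Hd] := @quasiperiodic_unif_continuous R u 0 (e / 2) cu (fun x => etrans (pu x) (esym (addr0 _))) e2.
have [M M0 HM] := continuous_bounded_itv (- pi) pi cu.
have uM x : `|u x| <= M.
  have [n /andP[n1 n2]] := reduce_mod_2pi x.
  have := @add2pi_int R u 0 (fun x => etrans (pu x) (esym (addr0 _))) n (x - 2 * n%:~R * pi).
  rewrite subrK mulr0 addr0 => ->; apply: HM; rewrite n1 ltW//.
pose L := 2 * M / d.
have L0 : 0 <= L by rewrite divr_ge0 ?mulr_ge0// ltW.
have uL x s : 0 <= s -> `|u x - u (x - s)| <= e / 2 + L * s.
  move=> s0; have [sd|ds] := ltP s d.
    apply: (@le_trans _ _ (e / 2)); last by rewrite lerDl mulr_ge0.
    by apply: Hd; rewrite opprB addrC subrK ger0_norm.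
  apply: (@le_trans _ _ (L * s)); last by rewrite lerDr ltW.
  rewrite (le_trans (ler_normB _ _))// (le_trans (lerD (uM _) (uM _)))//.
  by rewrite /L mulrAC ler_pdivlMr//; nra.
exists (2 * (L + 1) / e); first by rewrite divr_gt0// mulr_gt0// ltr_wpDl.
move=> a Aa x; have a0 : 0 < a.
  by apply: lt_le_trans Aa; rewrite divr_gt0// mulr_gt0// ltr_wpDl.
have ck := @continuous_exp_kernel a.
have c1 : continuous (fun t => exp_kernel a t * u x) by apply: continuous_mulf => // ?; exact: cvg_cst.
have c2 : continuous (fun t => exp_kernel a t * u (x - pi - t)).
  by apply: continuous_mulf => //; exact: continuous_reflectf.
have c3 : continuous (fun t : R => t + pi).
  by move=> z; apply: cvgD; [exact: cvg_id|exact: cvg_cst].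
have c4 : continuous (fun t => exp_kernel a t * (t + pi)) by exact: continuous_mulf.
have c5 : continuous (fun t => exp_kernel a t * (e / 2)) by apply: continuous_mulf => // ?; exact: cvg_cst.
have c6 : continuous (fun t => L * (exp_kernel a t * (t + pi))) by apply: continuous_mulf => // ?; exact: cvg_cst.
have -> : u x - resolvent a u x =
    \int[mu]_(t in `[(- pi), pi]) (exp_kernel a t * u x - exp_kernel a t * u (x - pi - t)).
  rewrite RintegralB//; [|exact: continuous_integrable_itv|exact: continuous_integrable_itv].
  by rewrite RintegralZr//; [rewrite Rintegral_exp_kernel_period// mul1r|exact: continuous_integrable_itv].
apply: le_trans (le_normr_Rintegral _ (continuous_integrable_itv _ _ (continuous_subf c1 c2))) _ => //.
apply: (@le_trans _ _ (\int[mu]_(t in `[(- pi), pi])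
   (exp_kernel a t * (e / 2) + L * (exp_kernel a t * (t + pi))))).
  apply: le_Rintegral => //.
  - by apply: continuous_integrable_itv => z; apply: cvg_norm; exact: (continuous_subf c1 c2).
  - by apply: continuous_integrable_itv; exact: continuous_addf.
  - move=> t; rewrite /= in_itv/= => /andP[pt _].
    rewrite -mulrBr normrM ger0_norm ?exp_kernel_ge0// (mulrCA L) -mulrDr.
    rewrite ler_wpM2l ?exp_kernel_ge0//.
    have -> : x - pi - t = x - (t + pi) by ring.
    by apply: uL; lra.
rewrite RintegralD//; [|exact: continuous_integrable_itv|exact: continuous_integrable_itv].
rewrite RintegralZr//; last exact: continuous_integrable_itv.
rewrite [X in _ + X]RintegralZl//; last exact: (continuous_integrable_itv _ _ c4).
rewrite Rintegral_exp_kernel_period// mul1r.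
have h : L * \int[mu]_(t in `[(- pi), pi]) (exp_kernel a t * (t + pi)) <= L * a^-1.
  by rewrite ler_wpM2l// exp_kernel_first_moment.
have h2 : L * a^-1 <= e / 2.
  rewrite ler_pdivrMr//; rewrite ler_pdivrMr// in Aa; lra.
lra.
Qed.

End resolvent.

(** * Products of averages of resolvents *)

Section product_of_averages.
Context {R : realType}.
Implicit Types (u v w y F : R -> R) (a b c d e x t M : R) (l : seq (R * R)).

(** A finite combination of resolvents is a list of pairs of a coefficient and
    a parameter; the parameters are kept at least 1, which bounds the kernels
    away from their concentration point. *)
Definition mass l : R := \sum_(p <- l) p.1.
Definition kernel_sum l t : R := \sum_(p <- l) p.1 * exp_kernel p.2 t.
Definition resolvent_sum l u x : R := \sum_(p <- l) p.1 * resolvent p.2 u x.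

Definition admissible l := forall p, p \in l -> 0 <= p.1 /\ 1 <= p.2.

(** The list of the composition of d + resolvent_sum l with the average of the
    identity and of resolvent a, expanded by the resolvent identity. *)
Definition refine d a l : seq (R * R) :=
  (d / 2 - 2^-1 * \sum_(p <- l) p.1 * (p.2 / (a - p.2)), a) ::
  [seq (p.1 * (2^-1 + 2^-1 * (a / (a - p.2))), p.2) | p <- l].

Lemma refine_mass d a l : (forall p, p \in l -> p.2 < a) ->
  mass (refine d a l) = d / 2 + mass l.
Proof.
move=> la; rewrite /mass /refine big_cons/= big_map/= mulr_sumr -addrA; congr (_ + _).
rewrite -sumrN -big_split/= !big_seq; apply: eq_bigr => p /la pa.
by field; rewrite gt_eqF// subr_gt0.
Qed.

Lemma refine_operator d a l v : 0 < a -> admissible l ->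
  (forall p, p \in l -> p.2 < a) -> periodic_continuous v -> forall x,
  d / 2 * v x + resolvent_sum (refine d a l) v x =
  d * (2^-1 * v x + 2^-1 * resolvent a v x) +
  resolvent_sum l (fun x => 2^-1 * v x + 2^-1 * resolvent a v x) x.
Proof.
move=> a0 adm la pv x; rewrite /resolvent_sum /refine big_cons/= big_map/=.
have pa := periodic_continuous_resolvent a0 pv.
have -> : \sum_(p <- l) p.1 * resolvent p.2 (fun x => 2^-1 * v x + 2^-1 * resolvent a v x) x =
  \sum_(p <- l) (p.1 * (2^-1 + 2^-1 * (a / (a - p.2))) * resolvent p.2 v x -
    (2^-1 * (p.1 * (p.2 / (a - p.2)))) * resolvent a v x).
  rewrite !big_seq; apply: eq_bigr => p pl.
  have [_ p1] := adm _ pl; have pa' := la _ pl.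
  have p0 : 0 < p.2 by rewrite (lt_le_trans _ p1).
  have pna : p.2 != a by rewrite lt_eqF.
  rewrite resolvent_comb// resolvent_identity//.
  by field; rewrite gt_eqF// subr_gt0.
rewrite [in RHS]big_split/= sumrN -mulr_suml -mulr_sumr.
by move: (\sum_(p <- l) _) (\sum_(p <- l) _) => S1 S2; field.
Qed.

Lemma refine_double d a l u : 0 < a -> admissible l ->
  (forall p, p \in l -> p.2 < a) -> periodic_continuous u -> forall x,
  let v x := 2 * u x + (- 1) * resolvent (2 * a) u x in
  d / 2 * v x + resolvent_sum (refine d a l) v x = d * u x + resolvent_sum l u x.
Proof.
move=> a0 adm la pu x v; have a20 : 0 < 2 * a by rewrite mulr_gt0.
have pv : periodic_continuous v.
  by apply: periodic_continuous_comb => //; exact: periodic_continuous_resolvent.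
rewrite refine_operator//.
(* The average undoes v = 2 u - resolvent (2 a) u. *)
have E : (fun x => 2^-1 * v x + 2^-1 * resolvent a v x) = u.
  apply/funext => z; rewrite resolvent_double// /v.
  by move: (u z) (resolvent _ u z) => U W; field.
by rewrite E; congr (_ * _ + _); rewrite -[RHS](congr1 (fun f => f x) E).
Qed.

(** A fast growing parameter makes the subtracted sum in the new coefficient at
    most d times the mass. *)
Lemma refine_admissible d a l : 0 < d -> 1 <= a -> admissible l -> mass l <= 1 ->
  (forall p, p \in l -> p.2 * (1 + d^-1) <= a) -> admissible (refine d a l).
Proof.
move=> d0 a1 adm ml la p; rewrite inE => /predU1P[->/=|/mapP[q ql ->]/=].
  split => //; rewrite [d / 2]mulrC -mulrBr mulr_ge0// subr_ge0.
  apply: (@le_trans _ _ (\sum_(p <- l) p.1 * d)); last first.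
    by rewrite -mulr_suml ler_piMl// ltW.
  rewrite !big_seq; apply: ler_sum => q ql; have [q1 q2] := adm _ ql.
  rewrite ler_wpM2l//; have := la _ ql; rewrite mulrDr mulr1.
  have q0 : 0 < q.2 by rewrite (lt_le_trans _ q2).
  have qd : 0 < q.2 * d^-1 by rewrite mulr_gt0// invr_gt0.
  move=> H; rewrite ler_pdivrMr; last by lra.
  rewrite -ler_pdivrMl// mulrC; lra.
have [q1 q2] := adm _ ql; split => //; rewrite mulr_ge0// addr_ge0// mulr_ge0//.
have q0 : 0 < q.2 by rewrite (lt_le_trans _ q2).
have qd : 0 < q.2 * d^-1 by rewrite mulr_gt0// invr_gt0.
have := la _ ql; rewrite mulrDr mulr1 => H.
by rewrite divr_ge0//; lra.
Qed.

Lemma kernel_sum_ge0 l t : admissible l -> 0 <= kernel_sum l t.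
Proof.
move=> adm; rewrite /kernel_sum big_seq; apply: sumr_ge0 => p /adm[p1 p2].
by rewrite mulr_ge0// exp_kernel_ge0// (lt_le_trans _ p2).
Qed.

(** The old coefficients are multiplied by numbers that are at least 1. *)
Lemma kernel_sum_refine d a l t : 0 < a -> admissible l ->
  (forall p, p \in l -> p.2 < a) -> admissible (refine d a l) ->
  kernel_sum l t <= kernel_sum (refine d a l) t.
Proof.
move=> a0 adm la adm'; rewrite /kernel_sum /refine big_cons big_map/=.
have [h1 h2] := adm' _ (mem_head _ _).
apply: ler_wpDl; first by rewrite mulr_ge0 ?exp_kernel_ge0.
rewrite !big_seq; apply: ler_sum => p pl; have [p1 p2] := adm _ pl.
have p0 : 0 < p.2 by rewrite (lt_le_trans _ p2).
rewrite ler_wpM2r ?exp_kernel_ge0// ler_peMr//.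
have pa := la _ pl.
have : 1 <= a / (a - p.2) by rewrite ler_pdivlMr; lra.
by move=> H; lra.
Qed.

(** F is the image of y under d + resolvent_sum l; the masses d and 1 - d show
    that this operator is convolution with a probability measure having an atom
    of mass d. *)
Definition factorization F d y l := [/\ periodic_continuous y, admissible l,
  mass l = 1 - d & forall x, F x = d * y x + resolvent_sum l y x].

(** The operator 2 - resolvent (2 a) is applied to y, and the average that it
    inverts is absorbed by the list; for large a the function moves by at most d
    and the new coefficient is nonnegative. *)
Lemma factorization_step F d y l : 0 < d -> factorization F d y l ->
  exists y' l', [/\ factorization F (d / 2) y' l',
    forall x, `|y' x - y x| <= d & forall t, kernel_sum l t <= kernel_sum l' t].
Proof.
move=> d0 [py adm ml FE]; have [A A0 HA] := resolvent_approx py d0.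
pose S : R := \sum_(p <- l) p.2 * (1 + d^-1).
have dd : 0 < 1 + d^-1 by rewrite addr_gt0// invr_gt0.
have pS p : p \in l -> p.2 * (1 + d^-1) <= S.
  move=> pl; rewrite /S (big_rem _ pl)/= lerDl big_seq; apply: sumr_ge0 => q.
  move=> /mem_rem/adm[_ q1]; rewrite mulr_ge0 ?(ltW dd)//.
  by rewrite (le_trans _ q1).
have S0 : 0 <= S.
  rewrite /S big_seq; apply: sumr_ge0 => q /adm[_ q1].
  by rewrite mulr_ge0 ?(ltW dd)// (le_trans _ q1).
(* Above A for the approximation, above 1, and above each term of S for the
   positivity of the new coefficient. *)
pose a := A + 1 + S.
have a1 : 1 <= a by rewrite /a; lra.
have a0 : 0 < a by rewrite (lt_le_trans _ a1).
have la p : p \in l -> p.2 * (1 + d^-1) <= a by move=> /pS; rewrite /a; lra.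
have la' p : p \in l -> p.2 < a.
  move=> pl; apply: lt_le_trans (la _ pl); have [_ p1] := adm _ pl.
  by rewrite ltr_pMr ?ltrDl ?invr_gt0// (lt_le_trans _ p1).
have ml1 : mass l <= 1 by rewrite ml; lra.
have adm' := refine_admissible d0 a1 adm ml1 la.
exists (fun x => 2 * y x + (- 1) * resolvent (2 * a) y x), (refine d a l); split.
- split => //.
  + apply: periodic_continuous_comb => //; apply: periodic_continuous_resolvent => //.
    by rewrite mulr_gt0.
  + by rewrite refine_mass// ml; field.
  + by move=> x; rewrite refine_double.
- move=> x.
  have -> : 2 * y x + -1 * resolvent (2 * a) y x - y x = y x - resolvent (2 * a) y x by ring.
  by apply: HA; rewrite /a; lra.
- by move=> t; apply: kernel_sum_refine.
Qed.

Lemma factorization_sequence F : periodic_continuous F ->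
  exists (y : nat -> R -> R) (l : nat -> seq (R * R)), forall m,
    [/\ factorization F (2^-1 ^+ m) (y m) (l m),
        forall x, `|y m.+1 x - y m x| <= 2^-1 ^+ m &
        forall t, kernel_sum (l m) t <= kernel_sum (l m.+1) t].
Proof.
move=> pF.
pose P (s s' : nat * ((R -> R) * seq (R * R))) :=
  factorization F (2^-1 ^+ s.1) s.2.1 s.2.2 ->
  [/\ s'.1 = s.1.+1, factorization F (2^-1 ^+ s'.1) s'.2.1 s'.2.2,
    forall x, `|s'.2.1 x - s.2.1 x| <= 2^-1 ^+ s.1 &
    forall t, kernel_sum s.2.2 t <= kernel_sum s'.2.2 t].
have /choice[f Hf] : forall s, exists s', P s s'.
  move=> [m [y l]]; rewrite /P/=.
  have [fact|nfact] := pselect (factorization F (2^-1 ^+ m) y l); last by exists (m, (y, l)).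
  have d0 : 0 < 2^-1 ^+ m :> R by rewrite exprn_gt0// invr_gt0.
  have [y' [l' [h1 h2 h3]]] := factorization_step d0 fact.
  by exists (m.+1, (y', l')) => _; split => //=; rewrite exprSr.
pose s m := iter m f (0%N, (F, [::])).
have Hs m : (s m).1 = m /\ factorization F (2^-1 ^+ (s m).1) (s m).2.1 (s m).2.2.
  elim: m => [|m [sm fm]]; last by have [-> h _ _] := Hf _ fm; split => //; rewrite sm.
  split => //=; split => //.
  - by rewrite /mass big_nil expr0 subrr.
  - by move=> x; rewrite /resolvent_sum big_nil expr0 mul1r addr0.
exists (fun m => (s m).2.1), (fun m => (s m).2.2) => m.
have [sm fm] := Hs m; have [_ _ h1 h2] := Hf _ fm.
by rewrite sm in fm h1; split.
Qed.

End product_of_averages.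

(** * The limits of the factors *)

Section kernel_limit.
Context {R : realType}.
Implicit Types (u v w y F : R -> R) (a b c d e x t M : R) (k : seq (R * R)).
Notation mu := (@lebesgue_measure R).
Notation cmu := (@completed_lebesgue_measure R).
Local Notation BT := (measurableTypeR R).
Local Notation CT := (caratheodory_type (wlength (@idfun R))^*%mu).

Lemma half_pow_lt e : 0 < e -> exists m : nat, 2^-1 ^+ m < e.
Proof.
move=> e0; have h : `|2^-1 : R| < 1 by rewrite ger0_norm ?invr_ge0// invf_lt1// ltr1n.
have /cvgrPdist_lt/(_ _ e0)[N _ /(_ N (leqnn N))]/= := cvg_expr h.
rewrite sub0r normrN => H; exists N; exact: le_lt_trans (ler_norm _) H.
Qed.

(** The intervals of center y_m x and radius 2 * 2^-m are nested. *)
Lemma geometric_uniform_limit (y : nat -> R -> R) :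
  (forall m, periodic_continuous (y m)) ->
  (forall m x, `|y m.+1 x - y m x| <= 2^-1 ^+ m) ->
  exists2 z, periodic_continuous z & forall m x, `|z x - y m x| <= 2 * 2^-1 ^+ m.
Proof.
move=> py dy; pose q (m : nat) : R := 2 * 2^-1 ^+ m.
have qS m : q m.+1 = q m - 2^-1 ^+ m by rewrite /q exprS; field.
have lo x : nondecreasing_seq (fun m => y m x - q m).
  apply/nondecreasing_seqP => m; have := dy m x; rewrite qS ler_norml => /andP[]; lra.
have hi x : nonincreasing_seq (fun m => y m x + q m).
  apply/nonincreasing_seqP => m; have := dy m x; rewrite qS ler_norml => /andP[]; lra.
have q0 m : 0 < q m by rewrite mulr_gt0// exprn_gt0// invr_gt0.
have lohi m n x : y m x - q m <= y n x + q n.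
  have h1 := lo x _ _ (leq_maxl m n); have h2 := hi x _ _ (leq_maxr m n).
  by have := q0 (maxn m n); lra.
pose z x := sup (range (fun m => y m x - q m)).
have ub x : has_ubound (range (fun m => y m x - q m)).
  by exists (y 0%N x + q 0%N) => _ [m _ <-].
have zy m x : `|z x - y m x| <= q m.
  rewrite ler_norml; apply/andP; split.
    suff : y m x - q m <= z x by lra.
    by apply: ub_le_sup => //; exists m.
  suff : z x <= y m x + q m by lra.
  apply: ge_sup; first by exists (y 0%N x - q 0%N), 0%N.
  by move=> _ [n _ <-].
exists z; last exact: zy.
split; last first.
  move=> x; rewrite /z.
  suff -> : (fun m => y m (x + 2 * pi) - q m) = (fun m => y m x - q m) by [].
  by apply/funext => m; rewrite (py m).2.
move=> x; apply/cvgrPdist_le => e e0; have e8 : 0 < e / 8 by rewrite divr_gt0.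
have [m Hm] := half_pow_lt e8.
have e2 : 0 < e / 2 by rewrite divr_gt0.
have := (py m).1 x => /cvgrPdist_le/(_ _ e2); apply: filterS => t yt.
have := zy m x; have := zy m t; rewrite /q (distrC (z t)) => h1 h2.
have -> : z x - z t = (z x - y m x) + (y m x - y m t) + (y m t - z t) by ring.
have := ler_normD (z x - y m x + (y m x - y m t)) (y m t - z t).
have := ler_normD (z x - y m x) (y m x - y m t); lra.
Qed.

Lemma kernel_sum_continuous k : continuous (kernel_sum k).
Proof.
have -> : kernel_sum k = fun t => \sum_(p <- k) p.1 * exp_kernel p.2 t by [].
elim: k => [|p k ih].
  by under eq_fun do rewrite big_nil; move=> ?; exact: cvg_cst.
under eq_fun do rewrite big_cons.
apply: (@continuous_addf _ (fun t => p.1 * exp_kernel p.2 t)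
  (fun t => \sum_(q <- k) q.1 * exp_kernel q.2 t)); last exact: ih.
apply: (@continuous_mulf _ (fun=> p.1)); last exact: continuous_exp_kernel.
by move=> ?; exact: cvg_cst.
Qed.

Lemma Rintegral_kernel_sum k c : admissible k ->
  \int[mu]_(t in `[(c - pi), (c + pi)]) kernel_sum k (t - c) = mass k.
Proof.
rewrite /mass; elim: k => [|p k ih] adm.
  rewrite big_nil -[RHS](mul0r (fine (mu `[(c - pi), (c + pi)]))) -Rintegral_cst//.
  by apply: eq_Rintegral => t _; rewrite /kernel_sum big_nil.
have [_ p1] := adm p (mem_head _ _).
have p0 : 0 < p.2 by rewrite (lt_le_trans _ p1).
have ak : admissible k by move=> q qk; apply: adm; rewrite inE qk orbT.
have ck : continuous (fun t => kernel_sum k (t - c)).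
  by apply: continuous_shiftf; exact: kernel_sum_continuous.
have cp : continuous (fun t => exp_kernel p.2 (t - c)).
  by apply: continuous_shiftf; exact: continuous_exp_kernel.
have Ep : p.1 = \int[mu]_(t in `[(c - pi), (c + pi)]) (p.1 * exp_kernel p.2 (t - c)).
  rewrite RintegralZl//; last exact: continuous_integrable_itv.
  by rewrite Rintegral_exp_kernel// mulr1.
rewrite big_cons -(ih ak) [X in _ = X + _]Ep.
rewrite -RintegralD//.
- by apply: eq_Rintegral => t _; rewrite /kernel_sum big_cons.
- apply: continuous_integrable_itv; apply: continuous_mulf => //.
  by move=> ?; exact: cvg_cst.
- exact: continuous_integrable_itv.
Qed.

Lemma Rintegral_kernel_sum_conv k u x : admissible k -> continuous u ->
  \int[mu]_(t in `[(- pi), pi]) (kernel_sum k t * u (x - pi - t)) = resolvent_sum k u x.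
Proof.
move=> + cu; rewrite /resolvent_sum; elim: k => [|p k ih] adm.
  rewrite big_nil -[RHS](mul0r (fine (mu `[(- pi), pi]))) -Rintegral_cst//.
  by apply: eq_Rintegral => t _; rewrite /kernel_sum big_nil mul0r.
have ak : admissible k by move=> q qk; apply: adm; rewrite inE qk orbT.
have cr : continuous (fun t => u (x - pi - t)) by exact: continuous_reflectf.
have ck : continuous (fun t => kernel_sum k t * u (x - pi - t)).
  by apply: continuous_mulf => //; exact: kernel_sum_continuous.
have cp : continuous (fun t => exp_kernel p.2 t * u (x - pi - t)).
  by apply: continuous_mulf => //; exact: continuous_exp_kernel.
rewrite big_cons -(ih ak) -RintegralZl//; last exact: continuous_integrable_itv.
rewrite -RintegralD//.
- by apply: eq_Rintegral => t _; rewrite /kernel_sum big_cons mulrDl mulrA.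
- apply: continuous_integrable_itv; apply: continuous_mulf => //.
  by move=> ?; exact: cvg_cst.
- exact: continuous_integrable_itv.
Qed.

(** From a exp(- a s) <= 1 / s, uniformly in the parameter. *)
Lemma exp_kernel_le a t : 1 <= a -> - pi < t -> exp_kernel a t <= 2 / (t + pi).
Proof.
move=> a1 pt; have a0 : 0 < a by rewrite (lt_le_trans _ a1).
have tp : 0 < t + pi by lra.
have den := exp_kernel_den_gt0 a0.
rewrite /exp_kernel.
have hE : expR (- (a * (2 * pi))) <= 2^-1.
  rewrite expRN lef_pV2 ?posrE ?expR_gt0//.
  have := expR_ge1Dx (a * (2 * pi)); have := pi_ge2 R; nra.
have hk : a / (1 - expR (- (a * (2 * pi)))) <= 2 * a.
  by rewrite ler_pdivrMr//; nra.
have he : a * expR (- (a * (t + pi))) <= (t + pi)^-1.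
  rewrite expRN -ler_pdivlMl; last by [].
  rewrite -invfM lef_pV2 ?posrE ?expR_gt0 ?mulr_gt0//.
  by have := expR_ge1Dx (a * (t + pi)); lra.
apply: (@le_trans _ _ (2 * a * expR (- (a * (t + pi))))).
  by rewrite ler_wpM2r ?expR_ge0.
by rewrite -mulrA ler_wpM2l.
Qed.

Lemma kernel_sum_le k t : admissible k -> mass k <= 1 -> - pi < t ->
  kernel_sum k t <= 2 / (t + pi).
Proof.
move=> adm mk pt; apply: (@le_trans _ _ (\sum_(p <- k) p.1 * (2 / (t + pi)))).
  rewrite /kernel_sum !big_seq; apply: ler_sum => p /adm[p1 p2].
  by rewrite ler_wpM2l// exp_kernel_le.
rewrite -mulr_suml ler_piMl// divr_ge0//; lra.
Qed.

Definition kernel_sequence (l : nat -> seq (R * R)) := forall m,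
  [/\ admissible (l m), mass (l m) = 1 - 2^-1 ^+ m &
      forall t, kernel_sum (l m) t <= kernel_sum (l m.+1) t].

(** A pointwise increasing limit, finite away from -pi. *)
Definition kernel_limit (l : nat -> seq (R * R)) t :=
  sup (range (fun m => kernel_sum (l m) t)).

Lemma mass_le1 l m : kernel_sequence l -> mass (l m) <= 1.
Proof.
move=> Hl; have [_ -> _] := Hl m; rewrite gerBl exprn_ge0// invr_ge0//.
Qed.

Lemma kernel_sequence_nondecreasing l t : kernel_sequence l ->
  nondecreasing_seq (fun m => kernel_sum (l m) t).
Proof. by move=> Hl; apply/nondecreasing_seqP => m; have [_ _] := Hl m. Qed.

Lemma kernel_sequence_bounded l t : kernel_sequence l -> - pi < t ->
  has_ubound (range (fun m => kernel_sum (l m) t)).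
Proof.
move=> Hl pt; exists (2 / (t + pi)) => _ [m _ <-].
by apply: kernel_sum_le => //; [have [] := Hl m|exact: mass_le1].
Qed.

Lemma kernel_limit_cvg l t : kernel_sequence l -> - pi < t ->
  kernel_sum (l m) t @[m --> \oo] --> kernel_limit l t.
Proof.
move=> Hl pt; apply: nondecreasing_cvgn.
  exact: kernel_sequence_nondecreasing.
exact: kernel_sequence_bounded.
Qed.

Lemma kernel_sum_le_limit l t m : kernel_sequence l -> - pi < t ->
  kernel_sum (l m) t <= kernel_limit l t.
Proof.
move=> Hl pt; apply: ub_le_sup; last by exists m.
exact: kernel_sequence_bounded.
Qed.

(** Monotone convergence. The center c allows any period, since integrability
    on all compact sets is needed. *)
Lemma kernel_limit_integral l c : kernel_sequence l ->
  let J := `](c - pi), (c + pi)]%classic : set R in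
  mu.-integrable J (fun t => (kernel_limit l (t - c))%:E) /\
  \int[mu]_(t in J) kernel_limit l (t - c) = 1.
Proof.
move=> Hl J; have mJ : measurable (J : set BT) by exact: measurable_itv.
have Jp t : J t -> - pi < t - c by rewrite /J/= in_itv/= => /andP[+ _]; lra.
have cks m : continuous (fun t => kernel_sum (l m) (t - c)).
  by apply: continuous_shiftf; exact: kernel_sum_continuous.
have mks m : @measurable_fun _ _ BT R J (fun t => kernel_sum (l m) (t - c)).
  exact: measurable_funTS (continuous_measurable_fun (cks m)).
have mkl : @measurable_fun _ _ BT R J (fun t => kernel_limit l (t - c)).
  apply: (measurable_fun_cvg (h := fun m t => kernel_sum (l m) (t - c)) mks).
  by move=> t /Jp; exact: kernel_limit_cvg.
have k0 m t : 0 <= kernel_sum (l m) (t - c).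
  by apply: kernel_sum_ge0; have [] := Hl m.
have l0 t : J t -> 0 <= kernel_limit l (t - c).
  by move=> /Jp Jt; rewrite (le_trans (k0 0%N t))// kernel_sum_le_limit.
have iks m : (\int[mu]_(t in J) (kernel_sum (l m) (t - c))%:E)%E = (mass (l m))%:E.
  have [adm _ _] := Hl m; rewrite -(Rintegral_kernel_sum c adm).
  rewrite /J integral_itv_obnd_cbnd; last by apply/measurable_EFinP; exact: mks.
  rewrite /Rintegral fineK//; apply: integrable_fin_num; first by [].
  exact: (continuous_integrable_itv _ _ (cks m)).
have mE m : @measurable_fun _ _ BT (\bar R) J (fun t => (kernel_sum (l m) (t - c))%:E).
  by apply/measurable_EFinP; exact: mks.
have := @cvg_monotone_convergence _ BT R mu J mJ _ mE.
move=> /(_ (fun m t _ => k0 m t)).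
have nd t : J t -> nondecreasing_seq (fun m => (kernel_sum (l m) (t - c))%:E).
  move=> _ m n mn; rewrite lee_fin; exact: (kernel_sequence_nondecreasing _ Hl).
move=> /(_ nd); under eq_fun do rewrite iks.
have -> : (\int[mu]_(x in J) limn (fun m => (kernel_sum (l m) (x - c))%:E) =
    \int[mu]_(x in J) (kernel_limit l (x - c))%:E)%E.
  apply: eq_integral => t; rewrite inE => /Jp Jt; apply/cvg_lim => //.
  apply: cvg_EFin; first exact: nearW.
  exact: kernel_limit_cvg.
move=> cv; have E : (\int[mu]_(x in J) (kernel_limit l (x - c))%:E = 1%:E)%E.
  apply: cvg_unique cv _ => //; apply: cvg_EFin; first exact: nearW.
  have -> : (fine \o (fun m => (mass (l m))%:E)) = (fun m => 1 - 2^-1 ^+ m : R).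
    by apply/funext => m /=; have [_ -> _] := Hl m.
  rewrite -[X in _ --> X]subr0; apply: cvgB; first exact: cvg_cst.
  by apply: cvg_expr; rewrite ger0_norm ?invr_ge0// invf_lt1// ltr1n.
split; last by rewrite /Rintegral E.
apply/integrableP; split; first exact/measurable_EFinP.
have -> : (\int[mu]_(x in J) `|(kernel_limit l (x - c))%:E| = 1%:E)%E.
  rewrite -E; apply: eq_integral => t; rewrite inE => Jt.
  by rewrite gee0_abs// lee_fin l0.
exact: ltry.
Qed.

End kernel_limit.

(** * Factorization *)

Section factor.
Context {R : realType}.
Implicit Types (u v w y F : R -> R) (a b c d e x t M : R) (k : seq (R * R)) (l : nat -> seq (R * R)).
Notation mu := (@lebesgue_measure R).
Notation cmu := (@completed_lebesgue_measure R).
Local Notation BT := (measurableTypeR R).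
Local Notation CT := (caratheodory_type (wlength (@idfun R))^*%mu).

Lemma integrable_setU_disj (A B : set R) (f : R -> \bar R) :
  measurable (A : set BT) -> measurable (B : set BT) -> [disjoint A & B] ->
  mu.-integrable A f -> mu.-integrable B f -> mu.-integrable (A `|` B) f.
Proof.
move=> mA mB AB /integrableP[mfA fA] /integrableP[mfB fB].
have mU : @measurable_fun _ _ BT (\bar R) (A `|` B) f by apply/measurable_funU.
apply/integrableP; split => //.
rewrite ge0_integral_setU//; first exact: lte_add_pinfty.
exact: measurableT_comp.
Qed.

Lemma kernel_limit_periods_integrable l (N : nat) : kernel_sequence l ->
  mu.-integrable `](- (2 * N%:R + 1) * pi), ((2 * N%:R + 1) * pi)]
    (EFin \o periodize (kernel_limit l)).
Proof.
move=> Hl; have p0 := pi_gt0 R.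
have Jn (n : int) (a b : R) : a = (2 * n%:~R - 1) * pi -> b = (2 * n%:~R + 1) * pi ->
    mu.-integrable `]a, b] (EFin \o periodize (kernel_limit l)).
  move=> -> ->.
  have [] := kernel_limit_integral (2 * n%:~R * pi) Hl.
  have -> : 2 * n%:~R * pi - pi = (2 * n%:~R - 1) * pi :> R by ring.
  have -> : 2 * n%:~R * pi + pi = (2 * n%:~R + 1) * pi :> R by ring.
  move=> + _; apply: eq_integrable; first exact: measurable_itv.
  move=> t; rewrite inE/= in_itv/= => tn; congr (EFin _).
  by rewrite (periodize_shift _ tn).
have disj (a b c : R) : [disjoint `]a, b]%classic & `]b, c]%classic].
  apply/disj_setPS => t [/=]; rewrite !in_itv/= => /andP[_ tb] /andP[].
  by rewrite ltNge tb.
elim: N => [|N ih].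
  by apply: (Jn 0); rewrite mulr0 ?sub0r ?add0r.
set a := - _ * pi; set b := _ * pi.
pose a' : R := - (2 * N%:R + 1) * pi; pose b' : R := (2 * N%:R + 1) * pi.
have N0 : (0 : R) <= N%:R by [].
have ab : [/\ a <= a', a' <= b' & b' <= b].
  by rewrite /a /a' /b /b' -natr1; split; nra.
have [aa bb cc] := ab.
have E : `]a, b]%classic = `]a, a']%classic `|` `]a', b']%classic `|` `]b', b]%classic :> set R.
  rewrite -itv_bndbnd_setU ?bnd_simp//.
  by rewrite -itv_bndbnd_setU ?bnd_simp// (le_trans aa).
rewrite E; apply: integrable_setU_disj.
- by apply: measurableU; exact: measurable_itv.
- exact: measurable_itv.
- rewrite -itv_bndbnd_setU ?bnd_simp//.
- apply: integrable_setU_disj => //.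
  apply: (Jn (- (N.+1%:Z))); rewrite /a /a' mulrNz -[N.+1%:~R]/(N.+1%:R) -?natr1; ring.
- apply: (Jn (N.+1%:Z)); rewrite /b /b' -[N.+1%:~R]/(N.+1%:R) -?natr1; ring.
Qed.

Lemma L1T_kernel_limit l : kernel_sequence l -> L1T (periodize (kernel_limit l)).
Proof.
move=> Hl; split; first exact: periodize_periodic.
move=> K cK; have [M [_ HM]] := compact_bounded cK.
have p0 := pi_gt0 R.
have MM : M < `|M| + 1 by rewrite (le_lt_trans (ler_norm _))// ltrDl.
pose N := Num.bound ((`|M| + 1) / pi).
have HN : `|M| + 1 < N%:R * pi.
  rewrite -ltr_pdivrMr// archi_boundP//.
  by apply: divr_ge0; [exact: addr_ge0|exact: ltW].
have mK : measurable (K : set BT) by exact: compact_measurable.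
apply: (@integrable_completed _ K) => //.
apply: integrableS (kernel_limit_periods_integrable N Hl) => //.
move=> t Kt; have := HM _ MM _ Kt; rewrite /= ler_norml => /andP[t1 t2].
rewrite /= in_itv/=; apply/andP.
have N0 : (0 : R) <= N%:R by [].
by split; nra.
Qed.

Lemma kernel_limit_mass l : kernel_sequence l ->
  \int[cmu]_(t in `[(- pi), pi]) periodize (kernel_limit l) t = 1.
Proof.
move=> Hl; have p0 := pi_gt0 R.
have ig := L1T_integrable_period (L1T_kernel_limit Hl).
rewrite Rintegral_completed_obnd_cbnd//; last exact/ltW/Npi_lt_pi.
have [ik E] := kernel_limit_integral 0 Hl.
move: ik E; rewrite sub0r add0r => ik E.
have eqk : {in `](- pi), pi]%classic, (fun t => kernel_limit l (t - 0)) =1 periodize (kernel_limit l)}.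
  by move=> t; rewrite inE/= in_itv/= => tp; rewrite subr0 periodize_id.
rewrite Rintegral_completed//.
- by rewrite -E; apply/esym/eq_Rintegral.
- apply/measurable_EFinP; have /integrableP[mk _] := ik.
  apply: (eq_measurable_fun _ _ mk) => t tp /=; congr EFin; exact: eqk.
Qed.

(** The errors committed by replacing the limit kernel by that of step m and the
    limit function by y_m, and by dropping the atom, are all of order 2^-m. *)
Lemma kernel_limit_conv F l (y : nat -> R -> R) z x : kernel_sequence l ->
  (forall m, factorization F (2^-1 ^+ m) (y m) (l m)) ->
  periodic_continuous z -> (forall m x, `|z x - y m x| <= 2 * 2^-1 ^+ m) ->
  \int[cmu]_(t in `[(- pi), pi]) (z (x - pi - t) * periodize (kernel_limit l) t) = F x.
Proof.
move=> Hl Hf pz zy; have p0 := pi_gt0 R; have [cz perz] := pz.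
pose g := periodize (kernel_limit l).
have ig : integrable_period g := L1T_integrable_period (L1T_kernel_limit Hl).
have cr : continuous (fun t => z (x - pi - t)) by exact: continuous_reflectf.
have izg := continuous_mul_integrable cr ig.
have [M M0 HM] : exists2 M, 0 <= M & forall s, `|z s| <= M.
  have [M M0 HM] := continuous_bounded_itv (- pi) pi cz; exists M => // s.
  have [n /andP[n1 n2]] := reduce_mod_2pi s.
  have := @add2pi_int R z 0 (fun x => etrans (perz x) (esym (addr0 _))) n (s - 2 * n%:~R * pi).
  by rewrite subrK mulr0 addr0 => ->; apply: HM; rewrite n1 ltW.
have key m : `|\int[cmu]_(t in `[(- pi), pi]) (z (x - pi - t) * g t) - F x| <=
    2^-1 ^+ m * (2 * M + 4).
  have [py adm ml ->] := Hf m.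
  have q0 : 0 < 2^-1 ^+ m :> R by rewrite exprn_gt0// invr_gt0.
  have q1 : 2^-1 ^+ m <= 1 :> R by rewrite exprn_ile1// ?invr_ge0// invf_le1// ler1n.
  have ck := @kernel_sum_continuous R (l m).
  have ick := continuous_integrable_completed (- pi) pi ck.
  have czk : continuous (fun t => z (x - pi - t) * kernel_sum (l m) t) by exact: continuous_mulf.
  have mk : \int[cmu]_(t in `[(- pi), pi]) kernel_sum (l m) t = mass (l m).
    rewrite Rintegral_completed//; last exact: measurable_funTS (continuous_measurable_fun ck).
    rewrite -(Rintegral_kernel_sum 0 adm) sub0r add0r.
    by apply: eq_Rintegral => t _; rewrite subr0.
  have h1 : `|\int[cmu]_(t in `[(- pi), pi]) (z (x - pi - t) * g t) -
      resolvent_sum (l m) z x| <= M * 2^-1 ^+ m.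
    rewrite -(Rintegral_kernel_sum_conv x adm cz).
    have -> : \int[mu]_(t in `[(- pi), pi]) (kernel_sum (l m) t * z (x - pi - t)) =
       \int[cmu]_(t in `[(- pi), pi]) (z (x - pi - t) * kernel_sum (l m) t).
      rewrite Rintegral_completed//; last exact: measurable_funTS (continuous_measurable_fun czk).
      by apply: eq_Rintegral => t _; rewrite mulrC.
    rewrite -RintegralB//; [|exact: measurable_period|exact: continuous_integrable_completed].
    under eq_Rintegral do rewrite -mulrBr.
    have igk := integrable_periodB ig ick.
    apply: le_trans (Rintegral_mul_le cr igk (fun t _ => HM _)) _.
    rewrite ler_wpM2l//.
    rewrite Rintegral_completed_obnd_cbnd; last exact: (integrable_norm igk).
    - have -> : \int[cmu]_(t in `](- pi), pi]) `|g t - kernel_sum (l m) t| =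
        \int[cmu]_(t in `](- pi), pi]) (g t - kernel_sum (l m) t).
        apply: eq_Rintegral => t; rewrite inE/= in_itv/= => tp.
        rewrite ger0_norm// subr_ge0 /g periodize_id//.
        by apply: kernel_sum_le_limit => //; case/andP: tp.
      rewrite -Rintegral_completed_obnd_cbnd//; last exact/ltW/Npi_lt_pi.
      rewrite RintegralB//; last exact: measurable_period.
      by rewrite mk /g kernel_limit_mass// ml subKr.
    - exact/ltW/Npi_lt_pi.
  have h2 : `|resolvent_sum (l m) z x - resolvent_sum (l m) (y m) x| <= 2 * 2^-1 ^+ m.
    rewrite /resolvent_sum -sumrB (le_trans (ler_norm_sum _ _ _))//.
    apply: (@le_trans _ _ (\sum_(p <- l m) p.1 * (2 * 2^-1 ^+ m))).
      rewrite !big_seq; apply: ler_sum => p /adm[p1 p2].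
      have pp : 0 < p.2 by rewrite (lt_le_trans _ p2).
      rewrite -mulrBr normrM ger0_norm// ler_wpM2l//.
      have -> : resolvent p.2 z x - resolvent p.2 (y m) x =
         resolvent p.2 (fun x => 1 * z x + (- 1) * y m x) x.
        by rewrite resolvent_comb// mul1r mulN1r.
      apply: resolvent_le => //; first by case: (periodic_continuous_comb 1 (- 1) pz py).
      by move=> s; rewrite mul1r mulN1r.
    rewrite -mulr_suml -/(mass _) ml ler_piMl ?mulr_ge0 ?(ltW q0)//; lra.
  have h3 : `|y m x| <= M + 2.
    have := zy m x; have := HM x; have := ler_normB (z x) (z x - y m x).
    rewrite subKr; lra.
  set I := \int[cmu]_(t in _) _ in h1 *.
  have -> : I - (2^-1 ^+ m * y m x + resolvent_sum (l m) (y m) x) =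
    (I - resolvent_sum (l m) z x) + (resolvent_sum (l m) z x - resolvent_sum (l m) (y m) x)
     - 2^-1 ^+ m * y m x by ring.
  rewrite (le_trans (ler_normB _ _))// normrM (ger0_norm (ltW q0)).
  have := ler_normD (I - resolvent_sum (l m) z x) (resolvent_sum (l m) z x - resolvent_sum (l m) (y m) x).
  have : 2^-1 ^+ m * `|y m x| <= 2^-1 ^+ m * (M + 2) by rewrite ler_wpM2l// ltW.
  lra.
apply/eqP; rewrite -subr_eq0 -normr_le0; apply/ler_addgt0Pr => e e0; rewrite add0r.
have C0 : 0 < 2 * M + 4 by lra.
have [m Hm] := half_pow_lt (divr_gt0 e0 C0).
by rewrite (le_trans (key m))// -ler_pdivlMr// ltW.
Qed.

(** The linear part is preserved by a kernel of mass one and the periodic part is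
    factored. The kernel concentrates at the left end of the period, which the
    shift by pi in the second factor compensates. *)
Lemma Bc_factorization F : Bc F ->
  exists g H, [/\ L1T g, Bc H & conv_primitive H g = F].
Proof.
move=> BF; have cF := Bc_continuous BF; have p0 := pi_gt0 R.
(* The slope of the linear part. *)
pose c := F pi / (2 * pi).
have c2 : c * (2 * pi) = F pi by rewrite /c divfK// mulf_neq0// gt_eqF.
pose F0 x := F x - c * (x + pi).
have pF0 : periodic_continuous F0.
  split; last first.
    move=> x; rewrite /F0 Bc_add2pi// -c2; ring.
  apply: continuous_subf => //; apply: continuous_mulf; first by move=> ?; exact: cvg_cst.
  by move=> x; apply: cvgD; [exact: cvg_id|exact: cvg_cst].
have [y [l Hyl]] := factorization_sequence pF0.
have Hf m : factorization F0 (2^-1 ^+ m) (y m) (l m) by have [] := Hyl m.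
have Hl : kernel_sequence l.
  by move=> m; have [[_ h1 h2 _] _ h3] := Hyl m.
have [z pz zy] : exists2 z, periodic_continuous z & forall m x, `|z x - y m x| <= 2 * 2^-1 ^+ m.
  by apply: geometric_uniform_limit => m; have [[]] := Hyl m.
have [cz perz] := pz.
pose g := periodize (kernel_limit l).
have Lg : L1T g := L1T_kernel_limit Hl.
have ig := L1T_integrable_period Lg.
pose H x := c * (x + pi) + (z (x - pi) - z (- pi - pi)).
have BH : Bc H.
  apply: Bc_intro.
  - apply: continuous_addf.
      apply: continuous_mulf; first by move=> ?; exact: cvg_cst.
      by move=> x; apply: cvgD; [exact: cvg_id|exact: cvg_cst].
    apply: continuous_subf; last by move=> ?; exact: cvg_cst.
    exact: (@continuous_shiftf _ z (- pi)).
  - by rewrite /H addNr mulr0 subrr addr0.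
  - move=> x; rewrite /H.
    have -> : z (x + 2 * pi - pi) = z (x - pi) by rewrite -[RHS]perz; congr z; ring.
    have -> : z (pi - pi) = z (- pi - pi) by rewrite -[RHS]perz; congr z; ring.
    by ring.
exists g, H; split => //; apply/funext => x.
rewrite /conv_primitive.
have zc s : continuous (fun t => z (s - pi - t)) by exact: continuous_reflectf.
have cc : continuous (fun _ : R => c * (x + pi)) by move=> ?; exact: cvg_cst.
have i1 := continuous_mul_integrable cc ig.
have i2 := continuous_mul_integrable (zc x) ig.
have i3 := continuous_mul_integrable (zc (- pi)) ig.
transitivity (\int[cmu]_(t in `[(- pi), pi]) (c * (x + pi) * g t +
    (z (x - pi - t) * g t - z (- pi - pi - t) * g t))).
  apply: eq_Rintegral => t _; rewrite /H.
  have -> : x - t - pi = x - pi - t by ring.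
  have -> : - pi - t - pi = - pi - pi - t by ring.
  by ring.
rewrite RintegralD//; [|exact: measurable_period|exact: (integrable_periodB i2 i3)].
rewrite RintegralB//; last exact: measurable_period.
rewrite (kernel_limit_conv x Hl Hf pz zy) (kernel_limit_conv (- pi) Hl Hf pz zy).
rewrite RintegralZl//; [|exact: measurable_period].
rewrite kernel_limit_mass// mulr1 /F0 addNr mulr0 subr0.
by have [_ -> _] := BF; ring.
Qed.

End factor.

Theorem theorem8 (R : realType) :
  (forall (g : R -> R) (h : testfun R -> R),
     L1T g -> Ac h -> Ac (convL1 h g)) /\
  (forall f : testfun R -> R, Ac f ->
     exists (g : R -> R) (h : testfun R -> R),
       [/\ L1T g, Ac h & f = convL1 h g]).
Proof.
split=> [g h /L1T_integrable_period ig /AcP[H BH ->]|f /AcP[F BF ->]].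
  by rewrite convL1E//; apply: Ac_dderive_dfun; exact: Bc_conv_primitive.
have [g [H [Lg BH <-]]] := Bc_factorization BF.
exists g, (dderive (dfun H)); split => //; first exact: Ac_dderive_dfun.
by rewrite convL1E//; exact: L1T_integrable_period.
Qed.
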